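(* For any constants $\delta_1>0$ and $\delta_2>0$, there exist two constants $y_1=y_1(\delta_1)>0$ and $r_2=r_2(\delta_1,\delta_2)>0$ such that: (1) for all $\xi\ne0$, the resolvent set of $\hat B(\xi)$ satisfies $$\{\lambda\in\mathbb C:\mathrm{Re}\,\lambda\ge-\mu+\delta_1,\ |\mathrm{Im}\,\lambda|\ge y_1\}\cup\{\lambda\in\mathbb C:\mathrm{Re}\,\lambda>0\}\subset\rho(\hat B(\xi));$$ (2) for $0<|\xi|\le r_2$, the spectrum of $\hat B(\xi)$ satisfies $$\sigma(\hat B(\xi))\cap\{\lambda\in\mathbb C:\mathrm{Re}\,\lambda\ge-\mu+\delta_1\}\subset\bigcup_{j=-1}^{1}\{\lambda\in\mathbb C:|\lambda-\alpha_j(\xi)|\le\delta_2\},$$ where $\alpha_0(\xi)=0$ and $\alpha_{\pm1}(\xi)=\pm\mathrm i\sqrt{1+\tfrac53|\xi|^2}$.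
   Context: $L^2(\mathbb R^3_v)$ is the complex Hilbert space with $(f,g)=\int_{\mathbb R^3} f\bar g\,dv$ and norm $\|\cdot\|$. $M(v)=(2\pi)^{-3/2}e^{-|v|^2/2}$. The collision operator is $\mathcal Q(F,G)(v)=\int_{\mathbb R^3}\int_{\mathbb S^2}\mathcal B(|v-v_*|,\omega)\,(F(v_*')G(v')-F(v_* )G(v))\,dv_*d\omega$, with $v'=v-[(v-v_* )\cdot\omega]\omega$, $v'_*=v_*+[(v-v_* )\cdot\omega]\omega$, where the kernel is either hard sphere, $\mathcal B=|(v-v_* )\cdot\omega|$, or hard potential with angular cutoff, $\mathcal B=b(\cos\theta)|v-v_*|^\gamma$, $0\le\gamma<1$, $\cos\theta=|(v-v_* )\cdot\omega|/|v-v_*|$, $0\le b(\cos\theta)\le C|\cos\theta|$. The linearized collision operator is $Lf=M^{-1/2}[\mathcal Q(M,\sqrt Mf)+\mathcal Q(\sqrt Mf,M)]=Kf-\nu(v)f$, $D(L)=\{f\in L^2:\nu f\in L^2\}$, with $\nu(v)=\int\int \mathcal B M(v_* )\,d\omega dv_*$ and $K$ a self-adjoint compact operator on $L^2(\mathbb R^3_v)$. Standing facts: $\nu_0(1+|v|)^\gamma\le\nu(v)\le\nu_1(1+|v|)^\gamma$ ($\gamma=1$ for hard sphere); the null space $N_0$ of $L$ has orthonormal basis $\chi_0=\sqrt M$, $\chi_j=v_j\sqrt M$ ($j=1,2,3$), $\chi_4=(|v|^2-3)\sqrt M/\sqrt6$; $P_0$ is the orthogonal projection onto $N_0$, $P_1=I-P_0$;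 $(Lf,f)\le-\mu\|P_1f\|^2$ for $f\in D(L)$ with a constant $\mu>0$, and $\nu(0)\ge\nu_0\ge\mu>0$. $P_{\rm d}f=\sqrt M\int_{\mathbb R^3} f\sqrt M\,dv$. For $\xi\in\mathbb R^3\setminus\{0\}$: $(f,g)_\xi=(f,g)+|\xi|^{-2}(P_{\rm d}f,P_{\rm d}g)$, $\|f\|_\xi=\sqrt{(f,f)_\xi}$, $L^2_\xi(\mathbb R^3_v)$ is $L^2(\mathbb R^3_v)$ with this inner product, and $$\hat B(\xi)=L-\mathrm i(v\cdot\xi)-\frac{\mathrm i(v\cdot\xi)}{|\xi|^2}P_{\rm d}$$ with natural domain $\{f\in L^2:\nu f,\ (v\cdot\xi)f\in L^2\}$; $\rho(\hat B(\xi))$ and $\sigma(\hat B(\xi))$ are its resolvent set and spectrum. *)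

(* Defs.v *)
From HB Require Import structures.
From mathcomp Require Import all_boot all_order all_algebra.
From mathcomp Require Import all_classical all_reals all_analysis.
From mathcomp.real_closed Require Export complex.

Set Implicit Arguments.
Unset Strict Implicit.
Unset Printing Implicit Defensive.
Import Order.TTheory GRing.Theory Num.Theory.
Import numFieldNormedType.Exports.

Local Open Scope classical_set_scope.
Local Open Scope ring_scope.
Local Open Scope complex_scope.

Notation R3 R := (R * R * R)%type (only parsing).

Section VelocitySpace.
Variable R : realType.
Implicit Types (v w : R3 R) (f g : R3 R -> R[i]).

Definition dot v w : R := v.1.1 * w.1.1 + v.1.2 * w.1.2 + v.2 * w.2.
Definition enorm v : R := Num.sqrt (dot v v).
Definition scale3 (a : R) v : R3 R := (a * v.1.1, a * v.1.2, a * v.2).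

Definition leb3 : {measure set (R3 (measurableTypeR R)) -> \bar R} :=
  ((@lebesgue_measure R \x @lebesgue_measure R) \x @lebesgue_measure R)%E.

(* \int_(S^2) g(w) dw, with the surface measure written in spherical
   coordinates: dw = sin(theta) dphi dtheta. *)
Definition sphere_point (theta phi : R) : R3 R :=
  (sin theta * cos phi, sin theta * sin phi, cos theta).
Definition sphere_int (g : R3 R -> R) : R :=
  \int[@lebesgue_measure R]_(theta in `[0, pi])
    \int[@lebesgue_measure R]_(phi in `[0, 2 * pi])
      (g (sphere_point theta phi) * sin theta).

(* Real and complex versions of \int_(R^3) \int_(S^2) g(v_*, w) dw dv_* *)
Definition collision_int (g : R3 R -> R3 R -> R) : R :=
  \int[leb3]_vs sphere_int (g vs).
Definition collision_intC (g : R3 R -> R3 R -> R[i]) : R[i] :=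
  collision_int (fun vs w => complex.Re (g vs w))
    +i* collision_int (fun vs w => complex.Im (g vs w)).

Definition intC f : R[i] :=
  (\int[leb3]_v complex.Re (f v)) +i* (\int[leb3]_v complex.Im (f v)).

(* L^2(R^3; C): its elements are represented by functions; equality of
   elements is equality almost everywhere. *)
Definition L2 : set (R3 R -> R[i]) :=
  [set f | (fun v => complex.Re (f v)) \in Lfun leb3 2%:E /\
           (fun v => complex.Im (f v)) \in Lfun leb3 2%:E].

Definition inner f g : R[i] := intC (fun v => f v * (g v)^*).
Definition L2norm f : R := Num.sqrt (complex.Re (inner f f)).

Implicit Types T : (R3 R -> R[i]) -> R3 R -> R[i].

(* T is a well-defined linear operator from L^2 to L^2 *)
Definition L2_operator T : Prop :=
  [/\ forall f, L2 f -> L2 (T f),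
      forall f g, L2 f -> L2 g -> f = g %[ae leb3] -> T f = T g %[ae leb3] &
      forall (a : R[i]) f g, L2 f -> L2 g ->
        T (fun v => a * f v + g v) = (fun v => a * T f v + T g v) %[ae leb3]].

Definition self_adjoint T : Prop :=
  forall f g, L2 f -> L2 g -> inner (T f) g = inner f (T g).

Definition compact_operator T : Prop :=
  forall u : nat -> R3 R -> R[i], (forall n, L2 (u n)) ->
    (exists A : R, forall n, L2norm (u n) <= A) ->
    exists (s : nat -> nat) (g : R3 R -> R[i]),
      [/\ {homo s : m n / (m < n)%N}, L2 g &
          (fun n => L2norm (fun v => T (u (s n)) v - g v)) @ \oo --> (0 : R)].

(* lam - T, with domain D, is a bijection from D onto L^2 whose inverse is
   bounded for the norm nrm. *)
Definition resolvent_set (nrm : (R3 R -> R[i]) -> R) (D : set (R3 R -> R[i])) T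
  : set R[i] :=
  [set lam : R[i] | let S f := fun v => lam * f v - T f v in
    [/\ forall f g, D f -> D g -> S f = S g %[ae leb3] -> f = g %[ae leb3],
        forall g, L2 g -> exists2 f, D f & S f = g %[ae leb3] &
        exists A : R, forall f, D f -> nrm f <= A * nrm (S f)]].

Definition spectrum (nrm : (R3 R -> R[i]) -> R) (D : set (R3 R -> R[i])) T
  : set R[i] := ~` resolvent_set nrm D T.

End VelocitySpace.

Section Boltzmann.
Variable R : realType.
Implicit Types (v w xi : R3 R) (f : R3 R -> R[i]) (B : R3 R -> R3 R -> R).

Definition maxwell v : R := (2 * pi) `^ (- (3 / 2)) * expR (- (dot v v / 2)).
Definition sqrtM v : R := Num.sqrt (maxwell v).

(* The kernels B(|v - v_*|, w), as functions of z = v - v_* and w; the index is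
   the exponent in the growth of the collision frequency. The value at z = 0
   (where `|dot z w| / enorm z is 0 / 0 = 0) is irrelevant. *)
Inductive collision_kernel : R -> (R3 R -> R3 R -> R) -> Prop :=
| HardSphere : collision_kernel 1 (fun z w => `|dot z w|)
| HardPotential (gamma C : R) (b : R -> R) of 0 <= gamma < 1
    & measurable_fun (`[0, 1] : set (measurableTypeR R)) b
    & (forall c, 0 <= c <= 1 -> 0 <= b c <= C * c) :
  collision_kernel gamma
    (fun z w => b (`|dot z w| / enorm z) * enorm z `^ gamma).

Definition post1 v vs w : R3 R := v - scale3 (dot (v - vs) w) w.
Definition post2 v vs w : R3 R := vs + scale3 (dot (v - vs) w) w.

Definition Q B (F G : R3 R -> R[i]) v : R[i] :=
  collision_intC (fun vs w =>
    (B (v - vs) w)%:C *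
      (F (post2 v vs w) * G (post1 v vs w) - F vs * G v)).

Definition nu B v : R :=
  collision_int (fun vs w => B (v - vs) w * maxwell vs).

Definition Lop B f v : R[i] :=
  let MC := fun u => (maxwell u)%:C in
  let sMf := fun u => (sqrtM u)%:C * f u in
  ((sqrtM v)^-1)%:C * (Q B MC sMf v + Q B sMf MC v).

Definition Kop B f v : R[i] := Lop B f v + (nu B v)%:C * f v.

Definition domL B : set (R3 R -> R[i]) :=
  [set f | L2 f /\ L2 (fun v => (nu B v)%:C * f v)].

Definition chi (j : 'I_5) v : R[i] :=
  (sqrtM v * nth 0 [:: 1; v.1.1; v.1.2; v.2; (dot v v - 3) / Num.sqrt 6] j)%:C.

Definition P0 f v : R[i] := \sum_(j < 5) inner f (chi j) * chi j v.
Definition P1 f v : R[i] := f v - P0 f v.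

Definition null_space_spanned B : Prop :=
  forall f, domL B f ->
    (Lop B f = (fun=> 0) %[ae @leb3 R] <->
     exists c : 'I_5 -> R[i],
       f = (fun v => \sum_(j < 5) c j * chi j v) %[ae @leb3 R]).

Definition coercive B (mu : R) : Prop :=
  forall f, domL B f ->
    complex.Re (inner (Lop B f) f) <= - mu * L2norm (P1 f) ^+ 2.

Definition Pd f v : R[i] :=
  (sqrtM v)%:C * intC (fun u => f u * (sqrtM u)%:C).

Definition inner_xi xi f g : R[i] :=
  inner f g + ((enorm xi ^+ 2)^-1)%:C * inner (Pd f) (Pd g).
Definition norm_xi xi f : R := Num.sqrt (complex.Re (inner_xi xi f f)).

Definition Bhat B xi f v : R[i] :=
  Lop B f v - 'i * (dot v xi)%:C * f v
    - 'i * (dot v xi / enorm xi ^+ 2)%:C * Pd f v.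

Definition domB B xi : set (R3 R -> R[i]) :=
  [set f | [/\ L2 f, L2 (fun v => (nu B v)%:C * f v) &
               L2 (fun v => (dot v xi)%:C * f v)]].

Definition rhoB B xi : set R[i] :=
  resolvent_set (norm_xi xi) (domB B xi) (Bhat B xi).
Definition sigmaB B xi : set R[i] :=
  spectrum (norm_xi xi) (domB B xi) (Bhat B xi).

(* alpha xi 0 = 0 and alpha xi (+-1) = +- i sqrt(1 + 5/3 |xi|^2) *)
Definition alpha xi (j : int) : R[i] :=
  'i * (j%:~R * Num.sqrt (1 + 5 / 3 * enorm xi ^+ 2))%:C.

End Boltzmann.

(* Main.v *)
(** In the inner product (.,.)_xi the transport and field terms of B(xi) are skew, so coercivity
gives Re ((lambda - B) f, f)_xi >= Re lambda |f|_xi^2 + mu |P_1 f|^2. This settles Re lambda > 0;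
otherwise it controls the microscopic part of f by (lambda - B) f and the macroscopic part. Testing
the equation with the collision invariants closes the estimate: for bounded xi and large |lambda|
the momentum equations suffice; for small xi the density and momentum equations combine to
(lambda^2 + 1) n = O(|xi|), which keeps lambda near 0 or +-i; for large xi, where s = |xi|, omega =
xi / s and lambda is about -i s t, one tests with chi_j (v . omega + t) / ((v . omega + t)^2 +
eps^4), using that the Gaussian mass of the slab |v . omega + t| <= eps is small. Hence lambda - B
is bounded below. In the unknown h = (lambda + nu + i v . xi) f the equation is a compact
perturbation of the identity, so the Fredholm alternative turns the lower bound into invertibility.

Two facts are recovered from the hypotheses: nu is measurable because K sqrt M = nu sqrt M, and the
collision invariants are orthonormal because coercivity makes the projection P_0 the identity on
them while they are linearly independent. *)

Require Import Defs.
From HB Require Import structures.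
From mathcomp Require Import all_boot all_order all_algebra.
From mathcomp Require Import all_classical all_reals all_analysis.
From mathcomp Require Import measurable_realfun ring lra.

Set Implicit Arguments.
Unset Strict Implicit.
Unset Printing Implicit Defensive.
Import Order.TTheory GRing.Theory Num.Theory.
Import numFieldNormedType.Exports.
Import ComplexField.Normc.

Local Open Scope classical_set_scope.
Local Open Scope ring_scope.
Local Open Scope complex_scope.

(** * Linear identities in a module *)

(** The order in which the constants are chosen is what makes [y1] depend on [delta1] alone. A
    frequency radius comes from the large-frequency estimate, which does not restrict the imaginary
    part of lambda; [y1] is the eigenvalue threshold for that radius; only then does [delta2] enter,
    through the small-frequency radius. In each regime six macroscopic quantities, the five moments
    of f and the field n / |xi|, are bounded by kappa |f|_xi + C |(lambda - B) f|_xi. Only kappa has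
    to be small, relative to [delta1] and [mu]; C may be of any size, since it enters nothing but
    the bound on the resolvent. The estimates hold at each single xi with uniform constants, so no
    limit in xi is taken. The field is always estimated as n / |xi| and never through n, because the
    weighted norm degenerates as xi tends to 0. Elements of L^2 are functions and their equality
    holds almost everywhere, so the operator theory runs in a module with a seminorm: linearity,
    ranges and injectivity are understood modulo null vectors. *)

Section LinearTerms.
Variables (K : comNzRingType) (V : lmodType K).

(** Syntax of linear combinations for a proof by reflection: two of them agree once the coefficients
    of every atom agree, and these are identities between scalars that [ring] decides. *)
Inductive lterm :=
  | LVar of nat | LZero | LAdd of lterm & lterm | LOpp of lterm | LScale of K & lterm.

Fixpoint leval (env : seq V) (t : lterm) : V :=
  match t with
  | LVar i => nth 0 env i
  | LZero => 0
  | LAdd s u => leval env s + leval env u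
  | LOpp s => - leval env s
  | LScale a s => a *: leval env s
  end.

Fixpoint lcoef (t : lterm) (i : nat) : K :=
  match t with
  | LVar j => if eqn i j then 1 else 0
  | LZero => 0
  | LAdd s u => lcoef s i + lcoef u i
  | LOpp s => - lcoef s i
  | LScale a s => a * lcoef s i
  end.

Fixpoint same_coefs (n : nat) (s t : lterm) : Prop :=
  match n with
  | 0 => True
  | m.+1 => lcoef s m = lcoef t m /\ same_coefs m s t
  end.

Lemma leval_sum env t : leval env t = \sum_(i < size env) lcoef t i *: nth 0 env i.
Proof.
elim: t => [j||s IHs u IHu|s IHs|a s IHs] /=.
- have [js|sj] := ltnP j (size env).
    rewrite (bigD1 (Ordinal js))//= -[eqn j j]/(j == j) eqxx scale1r big1 ?addr0//.
    move=> i /eqP ij; rewrite -[eqn i j]/(nat_of_ord i == j) ifF ?scale0r//.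
    by apply/negP => /eqP e; apply: ij; exact/val_inj.
  rewrite nth_default// big1// => i _; rewrite -[eqn i j]/(nat_of_ord i == j).
  by rewrite ltn_eqF ?scale0r// (leq_trans (ltn_ord i)).
- by rewrite big1// => i _; rewrite scale0r.
- by rewrite IHs IHu -big_split; apply: eq_bigr => i _; rewrite scalerDl.
- by rewrite IHs -sumrN; apply: eq_bigr => i _; rewrite scaleNr.
- by rewrite IHs scaler_sumr; apply: eq_bigr => i _; rewrite scalerA.
Qed.

Lemma leval_eq env s t : same_coefs (size env) s t -> leval env s = leval env t.
Proof.
move=> st; rewrite !leval_sum; apply: eq_bigr => i _; congr (_ *: _).
move: (size env) st i; elim=> [|m IH] /=; first by move=> _ [].
move=> [stm /IH{}IH] i; have [im|] := ltnP i m; first exact: (IH (Ordinal im)).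
by move=> mi; have -> : nat_of_ord i = m by apply/eqP; rewrite eqn_leq mi -ltnS ltn_ord.
Qed.

End LinearTerms.

(* Atoms are compared up to conversion, since the instances that occur in them may differ. *)
Ltac latom_index x env :=
  match env with
  | cons ?y _ => let _ := constr:(erefl x : x = y) in constr:(0%N)
  | cons _ ?e => let i := latom_index x e in constr:(S i)
  end.
Ltac latoms t env :=
  lazymatch t with
  | GRing.zero => env
  | GRing.add ?a ?b => let e := latoms a env in latoms b e
  | GRing.opp ?a => latoms a env
  | GRing.scale _ ?a => latoms a env
  | ?x => match constr:(Set) with
          | _ => let _ := latom_index x env in env
          | _ => constr:(cons x env)
          end
  end.
Ltac lreify K t env :=
  lazymatch t with
  | GRing.zero => constr:(@LZero K)
  | GRing.add ?a ?b =>
      let s := lreify K a env in let u := lreify K b env in constr:(@LAdd K s u)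
  | GRing.opp ?a => let s := lreify K a env in constr:(@LOpp K s)
  | GRing.scale ?k ?a => let s := lreify K a env in constr:(@LScale K k s)
  | ?x => let i := latom_index x env in constr:(@LVar K i)
  end.
Ltac linear_identity K V :=
  lazymatch goal with
  | |- ?a = ?b =>
    let e0 := latoms a constr:(@nil V) in
    let env := latoms b e0 in
    let s := lreify K a env in
    let t := lreify K b env in
    change (leval env s = leval env t);
    apply: leval_eq;
    cbv beta iota delta [lcoef same_coefs eqn size];
    repeat split; try ring
  end.

(** * Seminorms, and linearity and compactness modulo null vectors *)

Section Seminorm.
Variables (R : realType) (H : lmodType R[i]) (N : H -> R).
Hypothesis ND : forall x y, N (x + y) <= N x + N y.
Hypothesis NZ : forall a x, N (a *: x) = normc a * N x.

Local Ltac lin := linear_identity R[i] H.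

Lemma seminorm0 : N 0 = 0.
Proof. by rewrite -(scale0r (0 : H)) NZ normc0 mul0r. Qed.

Lemma seminormN x : N (- x) = N x.
Proof.
have -> : - x = (- 1 : R[i]) *: x by rewrite scaleN1r.
by rewrite NZ (normcN (1 : R[i])) normc1 mul1r.
Qed.

Lemma seminorm_ge0 x : 0 <= N x.
Proof. by have := ND x (- x); rewrite subrr seminormN seminorm0; lra. Qed.

Lemma seminormB x y : N (x - y) <= N x + N y.
Proof. by rewrite -(seminormN y) ND. Qed.

Lemma seminorm_distC x y : N (x - y) = N (y - x).
Proof. by rewrite -opprB seminormN. Qed.

Lemma seminorm_dist x y z : N (x - z) <= N (x - y) + N (y - z).
Proof. by rewrite (le_trans _ (ND _ _))// addrA subrK. Qed.

Lemma seminorm_mod0 x y : N (x - y) = 0 -> N x = N y.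
Proof.
move=> xy; have := ND (x - y) y; have := ND (y - x) x.
by rewrite !subrK -seminorm_distC xy; lra.
Qed.

(** Linearity up to a null vector, since operators on L^2 are linear only almost everywhere. *)
Definition sub_linear (G : H -> H) := forall a x y,
  N (G (a *: x + y) - (a *: G x + G y)) = 0.

Definition sub_compact (G : H -> H) := forall u : nat -> H,
  (exists A, forall n, N (u n) <= A) ->
  exists (s : nat -> nat) (z : H), {homo s : m n / (m < n)%N} /\
    forall e, 0 < e -> exists n0, forall n, (n0 <= n)%N -> N (G (u (s n)) - z) <= e.

Lemma sub_linearB G x y : sub_linear G -> N (G (x - y) - (G x - G y)) = 0.
Proof.
move=> Gl; have := Gl (-1) y x.
have -> : (-1) *: y + x = x - y by lin.
by have -> : (-1) *: G y + G x = G x - G y by lin.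
Qed.

Lemma sub_linear_small G : sub_linear G -> N (G 0) = 0.
Proof.
move=> Gl; have := Gl 1 0 0; rewrite !scale1r addr0.
by rewrite opprD addrA subrr sub0r seminormN.
Qed.

Lemma sub_linearZ G a x : sub_linear G -> N (G (a *: x)) = normc a * N (G x).
Proof.
move=> Gl; have := Gl a x 0; rewrite addr0 => h.
rewrite (seminorm_mod0 h) -NZ; apply: seminorm_mod0.
by rewrite addrAC subrr add0r sub_linear_small.
Qed.

End Seminorm.
Arguments sub_linear {R H}.
Arguments sub_compact {R H}.

(** * The Fredholm alternative *)

Section Fredholm.
Variables (R : realType) (H : lmodType R[i]) (N : H -> R).
Hypothesis ND : forall x y, N (x + y) <= N x + N y.
Hypothesis NZ : forall a x, N (a *: x) = normc a * N x.
Variables (G : H -> H) (M c : R).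
Hypothesis G_linear : sub_linear N G.
Hypothesis G_bounded : forall x, N (G x) <= M * N x.
Hypothesis G_compact : sub_compact N G.
Hypothesis c_gt0 : 0 < c.
Hypothesis G_bounded_below : forall x, c * N x <= N (x - G x).

Local Ltac lin := linear_identity R[i] H.

Let W x := x - G x.
Let N0 := seminorm0 NZ.
Let N_ge0 := seminorm_ge0 ND NZ.
Let NN := seminormN NZ.
Let Ndist := seminorm_dist ND.
Let NdC := seminorm_distC NZ.
Let Nmod := seminorm_mod0 ND NZ.

Let W_linear a x y : N (W (a *: x + y) - (a *: W x + W y)) = 0.
Proof. by rewrite -(G_linear a x y) -NN; congr N; rewrite /W; lin. Qed.

Let W_sub x y : N (W x - W y) = N (W (x - y)).
Proof.
apply: Nmod; rewrite -(sub_linearB x y G_linear).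
by congr N; rewrite /W; lin.
Qed.

Let W_bounded x : N (W x) <= (1 + M) * N x.
Proof. by rewrite mulrDl mul1r (le_trans (seminormB ND NZ _ _))// lerD2l. Qed.

(** The range of the n-th iterate of [W], saturated at each stage by adding null vectors. *)
Fixpoint iter_range (n : nat) : set H :=
  if n is m.+1 then [set y | exists2 x, iter_range m x & N (W x - y) = 0] else setT.
Local Notation E := iter_range.

Let E_mod n y z : E n y -> N (y - z) = 0 -> E n z.
Proof.
case: n => //= n [x Ex xy] yz; exists x => //; apply/eqP; rewrite eq_le N_ge0 andbT.
by rewrite (le_trans (Ndist _ y _))// xy yz addr0.
Qed.

Let E_linear n a x y : E n x -> E n y -> E n (a *: x + y).
Proof.
elim: n x y => //= n IH x y [u Eu ux] [v Ev vy].
exists (a *: u + v); first exact: IH.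
apply/eqP; rewrite eq_le N_ge0 andbT (le_trans (Ndist _ (a *: W u + W v) _))//.
rewrite W_linear add0r.
have -> : a *: W u + W v - (a *: x + y) = a *: (W u - x) + (W v - y) by lin.
by rewrite (le_trans (ND _ _))// NZ ux vy mulr0 addr0.
Qed.

Let E_decr n m : (n <= m)%N -> E m `<=` E n.
Proof.
move=> /subnK <-; elim: (m - n)%N => // k IH y Ey; apply: IH; rewrite addSn in Ey.
elim: (k + n)%N y Ey => // j IH y [x /IH Ex xy].
by exists x.
Qed.

(* Closedness is where compactness enters: a limit of images is the limit of the images of
   a subsequence of preimages, which converges because [x = W x + G x]. *)
Let E_closed n y : (forall e, 0 < e -> exists2 u, E n u & N (u - y) <= e) -> E n y.
Proof.
elim: n y => // n IH y cl.
have {cl} /choice[x Hx] : forall k : nat, exists x, E n x /\ N (W x - y) <= k.+1%:R^-1.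
  move=> k; have [|u [x Ex xu] uy] := cl k.+1%:R^-1; first by rewrite invr_gt0.
  by exists x; split => //; rewrite (le_trans (Ndist _ u _))// xu add0r.
have [|s [z [s_incr s_cvg]]] := G_compact (u := x).
  exists ((N y + 1) / c) => k; rewrite ler_pdivlMr// mulrC (le_trans (G_bounded_below _))//.
  have -> : x k - G (x k) = (W (x k) - y) + y by rewrite /W; lin.
  rewrite (le_trans (ND _ _))// addrC lerD2l (le_trans (Hx k).2)//.
  by rewrite invf_le1// ler1n.
have s_ge k : (k <= s k)%N.
  by elim: k => // k IHk; rewrite (leq_ltn_trans IHk)// s_incr.
have x_cvg e : 0 < e -> exists k, N (x (s k) - (y + z)) <= e /\ N (W (x (s k)) - y) <= e.
  move=> e_gt0; have e2 : 0 < e / 2 by rewrite divr_gt0.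
  have [k0 Hk0] := s_cvg _ e2.
  have [k1 Hk1] : exists k1 : nat, k1.+1%:R^-1 <= e / 2.
    have /ltr_add_invr[k] : 0 < e / 2 by [].
    by rewrite add0r => /ltW ?; exists k.
  have Wk : N (W (x (s (maxn k0 k1))) - y) <= e / 2.
    rewrite (le_trans (Hx _).2)// (le_trans _ Hk1)// lef_pV2 ?posrE// ler_nat ltnS.
    by rewrite (leq_trans _ (s_ge _))// leq_maxr.
  exists (maxn k0 k1); split; last by rewrite (le_trans Wk)// ler_pdivrMr// ler_peMr ?ler1n// ltW.
  have -> : x (s (maxn k0 k1)) - (y + z) =
     (W (x (s (maxn k0 k1))) - y) + (G (x (s (maxn k0 k1))) - z) by rewrite /W; lin.
  by rewrite (le_trans (ND _ _))// [leRHS]splitr lerD// Hk0// leq_maxl.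
exists (y + z).
  apply: IH => e /x_cvg[k [xk _]]; exists (x (s k)) => //; exact: (Hx _).1.
apply/eqP; rewrite eq_le N_ge0 andbT; apply/ler_addgt0Pl => e e_gt0; rewrite addr0.
have M1 : 0 < `|1 + M| + 1 by rewrite ltr_wpDl.
have [|k [xk Wk]] := x_cvg (e / (`|1 + M| + 1)); first by rewrite divr_gt0.
rewrite (le_trans (Ndist _ (W (x (s k))) _))//.
rewrite W_sub.
have : N (W (y + z - x (s k))) <= `|1 + M| * (e / (`|1 + M| + 1)).
  rewrite (le_trans (W_bounded _))// NdC (le_trans (ler_wpM2r _ (ler_norm _)))//.
  by rewrite ler_wpM2l.
move: Wk; set d := e / _ => Wk h; rewrite (le_trans (lerD h Wk))//.
by rewrite -[X in _ + X]mul1r -mulrDl /d mulrCA divff ?mulr1// gt_eqF.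
Qed.

(** The lower bound makes [W] injective modulo null vectors, so one application of [W] can be
    cancelled at a time. Together with [iter_in] this shows that the ranges decrease strictly as
    soon as [g] is missed. *)
Let iter_notin g n : ~ E 1 g -> ~ E n.+1 (iter n W g).
Proof.
move=> Eg; elim: n => // n IH /= [x Ex /eqP]; rewrite W_sub => /eqP xW.
apply: IH; apply: (E_mod (n := n.+1)); first exact: Ex; apply/eqP; rewrite eq_le N_ge0 andbT.
by rewrite -(ler_pM2l c_gt0) mulr0 (le_trans (G_bounded_below _))// -/(W _) xW.
Qed.

Let iter_in g n : E n (iter n W g).
Proof. by elim: n => //= n IH; exists (iter n W g) => //; rewrite subrr N0. Qed.

(** The almost orthogonal element of F. Riesz: [iter n W g] lies at positive distance from the
    closed set [E n.+1]; subtracting a nearly closest point and normalising gives [x]. *)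
Let riesz g n : ~ E 1 g ->
  exists x, [/\ E n x, N x <= 1 & forall y, E n.+1 y -> 2^-1 <= N (x - y)].
Proof.
move=> /(iter_notin (n := n)); set w := iter n W g => Ew.
have [e e_gt0 He] : exists2 e, 0 < e & forall u, E n.+1 u -> e < N (w - u).
  apply: contra_notP Ew => /forall2NP h; apply: E_closed => e e_gt0.
  have [//|/existsNP[u /not_implyP[Eu /negP]]] := h e.
  by rewrite -leNgt => ue; exists u => //; rewrite NdC.
pose S := [set N (w - u) | u in E n.+1].
have S0 : S !=set0.
  exists (N (w - 0)), 0 => //; elim: (n.+1) => //= k ?; exists 0 => //.
  by rewrite subr0 /W sub0r NN (sub_linear_small NZ G_linear).
have Slb : lbound S e by move=> _ [u Eu <-]; rewrite ltW// He.
have Sinf : has_inf S by split => //; exists e.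
have e_inf : e <= inf S by exact: lb_le_inf.
have inf_gt0 : 0 < inf S by exact: lt_le_trans e_inf.
(* The margin allowed above the infimum is the infimum itself, so [t < 2 * inf S]; this is the
   origin of the constant 1/2. *)
have [_ [u Eu <-] ulow] := inf_adherent inf_gt0 Sinf.
set t := N (w - u) in ulow; have t_gt0 : 0 < t by rewrite (lt_trans e_gt0)// He.
have Nt a : N (t^-1%:C *: a) = t^-1 * N a.
  by rewrite NZ /= expr0n addr0 sqrtr_sqr gtr0_norm ?invr_gt0.
exists (t^-1%:C *: (w - u)); split.
- have -> : t^-1%:C *: (w - u) = (- t^-1%:C) *: u + t^-1%:C *: w by lin.
  apply: E_linear; first exact: (E_decr (leqnSn n)).
  have -> : t^-1%:C *: w = (t^-1%:C - 1) *: w + w by lin.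
  by apply: E_linear; exact: iter_in.
- by rewrite Nt -/t mulVf// gt_eqF.
move=> y Ey.
have -> : t^-1%:C *: (w - u) - y = t^-1%:C *: (w - (t%:C *: y + u)).
  rewrite -[X in _ - X](@scale1r _ _ y).
  have <- : t^-1%:C * t%:C = 1 by rewrite -rmorphM/= mulVf ?gt_eqF.
  lin.
rewrite Nt ler_pdivlMl// mulrC ler_pdivrMl//.
apply: (le_trans (y := 2 * inf S)); first by lra.
rewrite ler_pM2l//; apply: ge_inf; first by exists e.
by exists (t%:C *: y + u) => //; exact: E_linear.
Qed.

(** If [g] were missed, the vectors supplied by [riesz] would form a bounded sequence whose images
    under [G] stay 1/2 apart, whereas two late terms of the convergent subsequence are within 1/8 of
    the same limit. *)
Lemma fredholm_alternative g : exists h, N (h - G h - g) = 0.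
Proof.
apply: contrapT => Hg.
have {Hg} Eg : ~ E 1 g by move=> [h _ hg]; apply: Hg; exists h.
have /choice[x Hx] n := riesz n Eg.
have [|s [z [s_incr s_cvg]]] := G_compact (u := x).
  by exists 1 => n; have [] := Hx n.
have [|k Hk] := s_cvg 8^-1; first by rewrite invr_gt0.
have spq := s_incr k k.+1 (ltnSn k).
set p := s k in spq; set q := s k.+1 in spq.
have [Ep _ far] := Hx p; have [Eq _ _] := Hx q.
have Wq : E p.+1 (W (x q)).
  by apply: (E_decr (leqW spq)); exists (x q) => //; rewrite subrr N0.
have Wp : E p.+1 (W (x p)) by exists (x p) => //; rewrite subrr N0.
(* With [W = 1 - G], the difference of [G (x p)] and [G (x q)] is [x p] minus an element of
   [E p.+1], because [q] exceeds [p]. *)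
have := far _ (E_linear 1 (E_linear (-1) Wq (E_decr spq Eq)) Wp).
have -> : x p - (1 *: (-1 *: W (x q) + x q) + W (x p)) = (G (x p) - z) - (G (x q) - z).
  by rewrite /W; lin.
have := seminormB ND NZ (G (x p) - z) (G (x q) - z).
by have := Hk k (leqnn k); have := Hk k.+1 (leqnSn k); rewrite -/p -/q; lra.
Qed.

End Fredholm.
(** * Semi-inner products *)

Section ComplexNumbers.
Variable R : realType.
Implicit Types z w : R[i].

Lemma normc_ge0 z : 0 <= normc z.
Proof. by case: z => a b; rewrite sqrtr_ge0. Qed.

Lemma sqr_normc_ReIm z : normc z ^+ 2 = complex.Re z ^+ 2 + complex.Im z ^+ 2.
Proof. by case: z => a b /=; rewrite sqr_sqrtr// addr_ge0// sqr_ge0. Qed.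

Lemma conjcD z w : conjc (z + w) = conjc z + conjc w.
Proof. exact: (rmorphD (@conjc R)). Qed.

Lemma conjcM z w : conjc (z * w) = conjc z * conjc w.
Proof. exact: (rmorphM (@conjc R)). Qed.

Lemma conjcN z : conjc (- z) = - conjc z.
Proof. exact: (rmorphN (@conjc R)). Qed.

Lemma conjc_re (a : R) : conjc a%:C = a%:C.
Proof. by rewrite /= oppr0. Qed.

Lemma conjc_sum (I : finType) (F : I -> R[i]) :
  conjc (\sum_i F i) = \sum_i conjc (F i).
Proof. by apply: (big_morph _ conjcD); rewrite conjc0. Qed.

Lemma realc_sum (I : finType) (F : I -> R) :
  (\sum_i F i)%:C = \sum_i (F i)%:C :> R[i].
Proof. exact: (big_morph (fun x : R => x%:C : R[i]) (rmorphD _)). Qed.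

Lemma normc_conj z : normc (conjc z) = normc z.
Proof. by case: z => a b /=; rewrite sqrrN. Qed.

Lemma normc_real (a : R) : normc a%:C = `|a|.
Proof. by rewrite /= expr0n addr0 sqrtr_sqr. Qed.

Lemma normc_i : normc ('i : R[i]) = 1.
Proof. by rewrite /= expr0n add0r expr1n sqrtr1. Qed.

Lemma Re_le_normc z : complex.Re z <= normc z.
Proof.
rewrite (le_trans (ler_norm _))// -(ler_pXn2r (n := 2)) ?nnegrE ?normc_ge0//.
by rewrite sqr_normc_ReIm real_normK ?num_real// lerDl sqr_ge0.
Qed.

Lemma Im_le_normc z : `|complex.Im z| <= normc z.
Proof.
rewrite -(ler_pXn2r (n := 2)) ?nnegrE ?normc_ge0//.
by rewrite sqr_normc_ReIm real_normK ?num_real// lerDr sqr_ge0.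
Qed.

Lemma normcD z w : normc (z + w) <= normc z + normc w.
Proof. exact: le_normcD. Qed.

Lemma normc_opp z : normc (- z) = normc z.
Proof. exact: normcN. Qed.

Lemma normcB z w : normc (z - w) <= normc z + normc w.
Proof. by rewrite -(normc_opp w) normcD. Qed.

Lemma mulc_conj z : z * conjc z = (normc z ^+ 2)%:C.
Proof.
by rewrite sqr_normc_ReIm; case: z => a b; apply/eqP; rewrite eq_complex /=; apply/andP; split; apply/eqP; ring.
Qed.

Lemma normr_normc z : `|z| = (normc z)%:C.
Proof. by rewrite normc_def; case: z. Qed.

Lemma le_normc_ReIm z : normc z <= `|complex.Re z| + `|complex.Im z|.
Proof.
have -> : normc z = normc ((complex.Re z)%:C + 'i * (complex.Im z)%:C) by rewrite -complexE.
by rewrite (le_trans (normcD _ _))// normcM normc_i mul1r !normc_real.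
Qed.

End ComplexNumbers.

Section SemiInner.
Variables (R : realType) (H : lmodType R[i]) (ip : H -> H -> R[i]).

Definition semi_inner :=
  [/\ forall a x y z, ip (a *: x + y) z = a * ip x z + ip y z,
      forall x y, ip y x = conjc (ip x y) &
      forall x, 0 <= complex.Re (ip x x)].

Hypothesis ipP : semi_inner.

Definition ipnorm (x : H) : R := Num.sqrt (complex.Re (ip x x)).
Local Notation N := ipnorm.
Local Ltac lin := linear_identity R[i] H.

Lemma ipC x y : ip y x = conjc (ip x y). Proof. by case: ipP. Qed.

Lemma ip0l z : ip 0 z = 0.
Proof.
case: ipP => lin _ _; have := lin 1 0 0 z.
by rewrite scaler0 addr0 mul1r => /eqP; rewrite -subr_eq subrr => /eqP.
Qed.

Lemma ipDl x y z : ip (x + y) z = ip x z + ip y z.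
Proof. by case: ipP => lin _ _; rewrite -{1}(scale1r x) lin mul1r. Qed.

Lemma ipZl a x z : ip (a *: x) z = a * ip x z.
Proof. by case: ipP => lin _ _; rewrite -{1}(addr0 (a *: x)) lin ip0l addr0. Qed.

Lemma ipNl x z : ip (- x) z = - ip x z.
Proof. by rewrite -scaleN1r ipZl mulN1r. Qed.

Lemma ipBl x y z : ip (x - y) z = ip x z - ip y z.
Proof. by rewrite ipDl ipNl. Qed.

Lemma ipDr x y z : ip z (x + y) = ip z x + ip z y.
Proof. by rewrite !(ipC _ z) ipDl conjcD. Qed.

Lemma ipZr a x z : ip z (a *: x) = conjc a * ip z x.
Proof. by rewrite !(ipC _ z) ipZl conjcM. Qed.

Lemma ipNr x z : ip z (- x) = - ip z x.
Proof. by rewrite !(ipC _ z) ipNl conjcN. Qed.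

Lemma ipBr x y z : ip z (x - y) = ip z x - ip z y.
Proof. by rewrite ipDr ipNr. Qed.

Lemma ip_suml (I : finType) (f : I -> H) z : ip (\sum_i f i) z = \sum_i ip (f i) z.
Proof.
by elim/big_ind2: _ => [|x a y b xa yb|//]; rewrite ?ip0l// ipDl xa yb.
Qed.

Lemma ip_self x : ip x x = (N x ^+ 2)%:C.
Proof.
rewrite sqr_sqrtr; last by case: ipP.
have := ipC x x; case: (ip x x) => a b [] h.
by have -> : b = 0 by move: h; lra.
Qed.

Lemma ipnorm_ge0 x : 0 <= N x. Proof. exact: sqrtr_ge0. Qed.

Lemma sqr_ipnorm x : N x ^+ 2 = complex.Re (ip x x).
Proof. by rewrite ip_self. Qed.

Lemma ipnorm_sub c x y :
  N (x - c *: y) ^+ 2 = N x ^+ 2 - 2 * complex.Re (conjc c * ip x y) + normc c ^+ 2 * N y ^+ 2.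
Proof.
rewrite [LHS]sqr_ipnorm ipBl !ipBr !ipZr !ipZl (ipC x y) !ip_self.
rewrite sqr_normc_ReIm; move: (ip x y) (N x ^+ 2) (N y ^+ 2) => [a b] p q.
by case: c => c d /=; ring.
Qed.

(** The form may be degenerate, so dividing by [N y] is not always possible. When [N y = 0] the
    quadratic polynomial [key] is affine in [t], and its nonnegativity for a large [t] forces
    [ip x y = 0]. *)
Lemma cauchy_schwarz x y : normc (ip x y) <= N x * N y.
Proof.
rewrite -(ler_pXn2r (n := 2)) ?nnegrE ?mulr_ge0 ?normc_ge0 ?ipnorm_ge0//.
have key t : 0 <= N x ^+ 2 - 2 * t * normc (ip x y) ^+ 2
    + t ^+ 2 * normc (ip x y) ^+ 2 * N y ^+ 2.
  rewrite (le_trans (sqr_ge0 (N (x - (t%:C * ip x y) *: y))))// ipnorm_sub.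
  rewrite normcM normc_real exprMn real_normK ?num_real//.
  rewrite le_eqVlt; apply/orP; left; apply/eqP.
  have -> : conjc (t%:C * ip x y) * ip x y = t%:C * (ip x y * conjc (ip x y)).
    by rewrite conjcM conjc_re -mulrA (mulrC (conjc _)).
  by rewrite mulc_conj -rmorphM /=; ring.
have [y0|y0] := eqVneq (N y) 0.
  have [->|a0] := eqVneq (normc (ip x y)) 0; first by rewrite expr0n sqr_ge0.
  have a2 : 0 < normc (ip x y) ^+ 2 by rewrite exprn_gt0// lt_neqAle eq_sym a0 normc_ge0.
  have := key ((N x ^+ 2 + 1) / normc (ip x y) ^+ 2).
  rewrite y0 expr0n mulr0 addr0 -mulrA divfK ?gt_eqF//.
  by have := sqr_ge0 (N x); lra.
have y2 : 0 < N y ^+ 2 by rewrite exprn_gt0// lt_neqAle eq_sym y0 ipnorm_ge0.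
have := key (N y ^+ 2)^-1.
have -> : N x ^+ 2 - 2 * (N y ^+ 2)^-1 * normc (ip x y) ^+ 2 +
    (N y ^+ 2)^-1 ^+ 2 * normc (ip x y) ^+ 2 * N y ^+ 2
    = N x ^+ 2 - normc (ip x y) ^+ 2 / N y ^+ 2 by field; exact: y0.
by rewrite subr_ge0 ler_pdivrMr// exprMn.
Qed.

Lemma ipnormZ a x : N (a *: x) = normc a * N x.
Proof.
apply/eqP; rewrite -(eqrXn2 (n := 2)) ?mulr_ge0 ?normc_ge0 ?ipnorm_ge0//; apply/eqP.
by rewrite sqr_ipnorm ipZl ipZr mulrA mulc_conj ip_self -rmorphM /= exprMn.
Qed.

Lemma ipnormD x y : N (x + y) <= N x + N y.
Proof.
rewrite -(ler_pXn2r (n := 2)) ?nnegrE ?addr_ge0 ?ipnorm_ge0//.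
have -> : x + y = x - (-1) *: y by lin.
rewrite ipnorm_sub normc_opp normc1 expr1n mul1r sqrrD.
rewrite lerD2r lerD2l.
have -> : (conjc (- 1 : R[i]) * ip x y) = - ip x y by rewrite conjcN conjc1 mulN1r.
have : complex.Re (ip x y) <= N x * N y.
  by rewrite (le_trans (Re_le_normc _))// cauchy_schwarz.
by move: (N x * N y) (ip x y) => p [a b] /=; rewrite mulr2n; lra.
Qed.

Lemma ip_null x z : N x = 0 -> ip x z = 0.
Proof.
move=> x0; apply: eq0_normc; apply/eqP; rewrite eq_le normc_ge0 andbT.
by rewrite (le_trans (cauchy_schwarz _ _))// x0 mul0r.
Qed.

Lemma ipnorm_opp x : N (- x) = N x.
Proof. exact: (seminormN ipnormZ). Qed.

End SemiInner.
(** * A priori estimates *)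

(** Of [delta * X ^+ 2] one quarter absorbs [12 * mu * kappa ^+ 2 * X ^+ 2], whence the factor 48,
    and another quarter absorbs [G * X] by Young's inequality; the remaining half yields the
    bound. *)
Lemma absorb_macroscopic (R : realType) (delta mu kappa C X Y2 G : R) :
  0 < delta -> 0 <= mu -> 0 <= X -> 0 <= G -> 0 <= C -> 0 <= kappa ->
  48 * mu * kappa ^+ 2 <= delta ->
  delta * X ^+ 2 <= mu * Y2 + G * X ->
  Y2 <= 6 * (kappa * X + C * G) ^+ 2 ->
  X <= Num.sqrt (2 / delta * (12 * mu * C ^+ 2 + delta^-1)) * G.
Proof.
move=> d0 m0 X0 G0 C0 k0 mk h hY.
have D0 : 0 <= 2 / delta * (12 * mu * C ^+ 2 + delta^-1).
  by rewrite mulr_ge0 ?divr_ge0 ?(ltW d0)// addr_ge0 ?invr_ge0 ?(ltW d0)// !mulr_ge0 ?sqr_ge0.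
rewrite -(ler_pXn2r (n := 2)) ?nnegrE ?mulr_ge0 ?sqrtr_ge0// exprMn sqr_sqrtr//.
have hY2 : Y2 <= 12 * (kappa ^+ 2 * X ^+ 2 + C ^+ 2 * G ^+ 2).
  by rewrite (le_trans hY)//; have := sqr_ge0 (kappa * X - C * G); nra.
have mY := ler_wpM2l m0 hY2.
have gx : G * X <= delta / 4 * X ^+ 2 + delta^-1 * G ^+ 2.
  have : 0 <= delta * (X / 2 - delta^-1 * G) ^+ 2 by rewrite mulr_ge0 ?sqr_ge0 ?ltW.
  have -> : delta * (X / 2 - delta^-1 * G) ^+ 2
      = delta / 4 * X ^+ 2 - G * X + delta^-1 * G ^+ 2.
    by field; exact: lt0r_neq0.
  lra.
have kX : mu * (12 * (kappa ^+ 2 * X ^+ 2)) <= delta / 4 * X ^+ 2.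
  have := ler_wpM2r (sqr_ge0 X) mk; lra.
have : delta / 2 * X ^+ 2 <= (12 * mu * C ^+ 2 + delta^-1) * G ^+ 2.
  by move: mY h gx kX; rewrite !mulrDr !mulrDl !mulrA; lra.
have -> : 2 / delta * (12 * mu * C ^+ 2 + delta^-1) * G ^+ 2 =
   (12 * mu * C ^+ 2 + delta^-1) * G ^+ 2 / (delta / 2).
  by field; exact: lt0r_neq0.
by rewrite ler_pdivlMr ?divr_gt0// mulrC.
Qed.

Lemma cauchy_schwarz2 (R : realType) (a b c d : R) :
  a * b + c * d <= Num.sqrt (a ^+ 2 + c ^+ 2) * Num.sqrt (b ^+ 2 + d ^+ 2).
Proof.
rewrite -sqrtrM ?addr_ge0 ?sqr_ge0// (le_trans (ler_norm _))// -sqrtr_sqr ler_wsqrtr//.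
have := sqr_ge0 (a * d - b * c); nra.
Qed.

Section AprioriEstimates.
Variables (R : realType) (H : lmodType R[i]) (ip : H -> H -> R[i]).
Hypothesis ipP : semi_inner ip.
Local Notation N := (ipnorm ip).
Local Ltac lin := linear_identity R[i] H.

Variable chi : 'I_5 -> H.
Hypothesis chi_orthonormal : forall j k, ip (chi j) (chi k) = (j == k)%:R.

Definition macro (x : H) : H := \sum_j ip x (chi j) *: chi j.

Lemma ip_lincomb_l (w : 'I_5 -> R[i]) x :
  ip (\sum_j w j *: chi j) x = \sum_j w j * ip (chi j) x.
Proof. by rewrite (ip_suml ipP); apply: eq_bigr => j _; rewrite (ipZl ipP). Qed.

Lemma ip_lincomb_chi (w : 'I_5 -> R[i]) k : ip (\sum_j w j *: chi j) (chi k) = w k.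
Proof.
rewrite ip_lincomb_l (bigD1 k)//= chi_orthonormal eqxx mulr1 big1 ?addr0// => j /negPf jk.
by rewrite chi_orthonormal jk mulr0.
Qed.

Lemma ip_lincomb_r (w : 'I_5 -> R[i]) x :
  ip x (\sum_j w j *: chi j) = \sum_j conjc (w j) * ip x (chi j).
Proof.
rewrite (ipC ipP) ip_lincomb_l conjc_sum; apply: eq_bigr => j _.
by rewrite conjcM (ipC ipP (chi j) x).
Qed.

Lemma ipnorm_chi k : N (chi k) = 1.
Proof. by rewrite /ipnorm chi_orthonormal eqxx sqrtr1. Qed.

Lemma pythagoras x :
  N x ^+ 2 = \sum_j normc (ip x (chi j)) ^+ 2 + N (x - macro x) ^+ 2.
Proof.
have e : ip x (macro x) = (\sum_j normc (ip x (chi j)) ^+ 2)%:C.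
  rewrite /macro ip_lincomb_r realc_sum; apply: eq_bigr => j _ /=.
  by rewrite mulrC mulc_conj.
have e2 : N (macro x) ^+ 2 = \sum_j normc (ip x (chi j)) ^+ 2.
  rewrite sqr_ipnorm// {2}/macro ip_lincomb_r.
  under eq_bigr do rewrite ip_lincomb_chi mulrC mulc_conj.
  by rewrite -realc_sum.
have := ipnorm_sub ipP 1 x (macro x); rewrite scale1r normc1 expr1n mul1r e2.
by rewrite conjc1 mul1r e /= => ->; lra.
Qed.

(* [w] lists the components of the direction of xi, [s] is its length; [Vf] stands for the
   product of f by [v . omega], [u j] for the product of [chi j]. *)
Variables (mu s C0 : R) (w : 'I_5 -> R) (u : 'I_5 -> H) (lam : R[i]).
Hypotheses (s_gt0 : 0 < s) (mu_gt0 : 0 < mu).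
Hypotheses (w0 : w ord0 = 0) (w_unit : \sum_j w j ^+ 2 = 1).
Let W0 : H := \sum_j (w j)%:C *: chi j.
Hypothesis u_bounded : forall j, N (u j) <= C0.

Definition xi_norm (x : H) : R := Num.sqrt (N x ^+ 2 + (s^-1 * normc (ip x (chi ord0))) ^+ 2).
Local Notation X := xi_norm.

Variables (f Lf Vf : H).
Hypothesis L_chi : forall j, ip Lf (chi j) = 0.
Hypothesis L_coercive : complex.Re (ip Lf f) <= - mu * N (f - macro f) ^+ 2.
Hypothesis V_chi : forall j, ip Vf (chi j) = ip f (u j).
Hypothesis V_chi0 : ip f (u ord0) = ip f W0.
Hypothesis V_real : complex.Im (ip Vf f) = 0.

Let n := ip f (chi ord0).
Let n' := s^-1%:C * n.
(** This is (lambda - B) f: v . xi is [s] times v . omega, and since [W0] stands for (v . omega)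
    sqrt M, the field term of B becomes i n' W0 with n' = n / s. *)
Definition shifted_op : H := lam *: f - Lf + ('i * s%:C) *: Vf + ('i * n') *: W0.
Local Notation S := shifted_op.

Let C0_ge0 : 0 <= C0. Proof. exact: le_trans (ipnorm_ge0 _ _) (u_bounded ord0). Qed.

Lemma xi_norm_ge0 x : 0 <= X x. Proof. exact: sqrtr_ge0. Qed.

Let sqr_xi_norm x : X x ^+ 2 = N x ^+ 2 + (s^-1 * normc (ip x (chi ord0))) ^+ 2.
Proof. by rewrite sqr_sqrtr// addr_ge0 ?sqr_ge0. Qed.

Let N_le_X x : N x <= X x.
Proof.
rewrite -(ler_pXn2r (n := 2)) ?nnegrE ?xi_norm_ge0 ?ipnorm_ge0// sqr_xi_norm lerDl.
exact: sqr_ge0.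
Qed.

Let chi0_le_X x : normc (ip x (chi ord0)) <= s * X x.
Proof.
rewrite -ler_pdivrMl// -(ler_pXn2r (n := 2)) ?nnegrE ?xi_norm_ge0//.
  by rewrite sqr_xi_norm lerDr sqr_ge0.
by rewrite mulr_ge0 ?normc_ge0// invr_ge0 ltW.
Qed.

Let normc_n' : normc n' = s^-1 * normc n.
Proof. by rewrite normcM normc_real ger0_norm// invr_ge0 ltW. Qed.

Let n'_le_X : normc n' <= X f.
Proof. by rewrite normc_n' ler_pdivrMl// chi0_le_X. Qed.

Let ip_W0_chi k : ip W0 (chi k) = (w k)%:C.
Proof. exact: ip_lincomb_chi. Qed.

Let N_W0 : N W0 = 1.
Proof.
rewrite /ipnorm ip_lincomb_r; under eq_bigr do rewrite conjc_re ip_W0_chi -rmorphM/=.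
by rewrite -realc_sum /= -[RHS]sqrtr1 -w_unit; congr Num.sqrt; apply: eq_bigr.
Qed.

Let w_le1 j : `|w j| <= 1.
Proof.
rewrite -(ler_pXn2r (n := 2)) ?nnegrE// expr1n real_normK ?num_real// -w_unit.
by rewrite (bigD1 j)//= lerDl sumr_ge0// => i _; exact: sqr_ge0.
Qed.

Lemma energy_estimate :
  complex.Re lam * X f ^+ 2 + mu * N (f - macro f) ^+ 2 <= X S * X f.
Proof.
(* Pairing with [k] in L^2 is pairing with [f] in the weighted inner product. *)
pose k := f + (s^-1 ^+ 2)%:C * n *: chi ord0.
have e1 : complex.Re (ip S k) = complex.Re lam * X f ^+ 2 - complex.Re (ip Lf f).
  have -> : ip S k = lam * ip f k - ip Lf k + 'i * s%:C * ip (Vf + (s^-1 * s^-1)%:C * n *: W0) k.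
    have e : n' = s%:C * ((s^-1 * s^-1)%:C * n).
      by rewrite mulrA -rmorphM /= mulrA divff ?gt_eqF// mul1r.
    rewrite /S !(ipDl ipP) (ipNl ipP) !(ipZl ipP) {}e; ring.
  have -> : ip f k = (X f ^+ 2)%:C.
    rewrite (ipDr ipP) (ipZr ipP) conjcM conjc_re -mulrA [X in _ * X]mulrC mulc_conj ip_self//.
    by rewrite -rmorphM -rmorphD /= sqr_xi_norm exprMn.
  have -> : ip Lf k = ip Lf f by rewrite (ipDr ipP) (ipZr ipP) L_chi mulr0 addr0.
  (* The two cross terms between transport and field are complex conjugates of each other, and the
     field does not act on itself because omega has no density component. *)
  have im0 : complex.Im (ip (Vf + (s^-1 * s^-1)%:C * n *: W0) k) = 0.
    rewrite !(ipDr ipP) !(ipDl ipP) !(ipZr ipP) !(ipZl ipP) V_chi V_chi0 ip_W0_chi w0.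
    rewrite (ipC ipP f W0).
    move: V_real; move: (ip Vf f) n (ip f W0) s^-1 => [a b] [c d] [e h] r /= ->.
    by rewrite expr2; ring.
  move: im0; move: (ip _ k) => [a b] /= ->; rewrite sqr_xi_norm.
  by case: lam (ip Lf f) => c d [e h] /=; ring.
have : complex.Re (ip S k) <= X S * X f.
  have -> : ip S k = ip S f + (s^-1 ^+ 2)%:C * conjc n * ip S (chi ord0).
    by rewrite (ipDr ipP) (ipZr ipP) conjcM conjc_re.
  apply: le_trans (cauchy_schwarz2 _ _ _ _).
  rewrite (le_trans (Re_le_normc _))// (le_trans (normcD _ _))// lerD ?cauchy_schwarz//.
  rewrite !normcM normc_conj normc_real ger0_norm ?sqr_ge0//.
  by rewrite -/n le_eqVlt; apply/orP; left; apply/eqP; ring.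
by rewrite e1; move: L_coercive; lra.
Qed.

(** By Pythagoras [X f ^+ 2] consists of five moments, the field and the microscopic part. Adding
    [mu] times the six macroscopic terms to the energy estimate turns its left side into (Re lambda
    + mu) [X f ^+ 2]. *)
Lemma macroscopic_control (d b : R) : d <= complex.Re lam + mu ->
  (forall j, normc (ip f (chi j)) <= b) -> normc n' <= b ->
  exists2 Y2, d * X f ^+ 2 <= mu * Y2 + X S * X f & Y2 <= 6 * b ^+ 2.
Proof.
move=> hd hb hn'.
exists (\sum_j normc (ip f (chi j)) ^+ 2 + normc n' ^+ 2).
  have := energy_estimate.
  have e : X f ^+ 2 = \sum_j normc (ip f (chi j)) ^+ 2 + normc n' ^+ 2 + N (f - macro f) ^+ 2.
    by rewrite sqr_xi_norm pythagoras normc_n' -/n; ring.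
  have := ler_wpM2r (sqr_ge0 (X f)) hd.
  rewrite mulrDl => h1 h2; have : mu * X f ^+ 2 = mu * (\sum_j normc (ip f (chi j)) ^+ 2
    + normc n' ^+ 2) + mu * N (f - macro f) ^+ 2 by rewrite -mulrDr e.
  lra.
have sq z : 0 <= z -> z <= b -> z ^+ 2 <= b ^+ 2.
  by move=> z0 zb; rewrite ler_pXn2r ?nnegrE// (le_trans z0).
have -> : 6 * b ^+ 2 = \sum_(j < 5) b ^+ 2 + b ^+ 2.
  by rewrite sumr_const card_ord -mulr_natl; ring.
by rewrite lerD ?sq ?normc_ge0// ler_sum// => j _; rewrite sq ?normc_ge0.
Qed.

(** The conservation laws: collisions drop out of the five moments, and only transport and field
    remain. *)
Let ip_S_chi j :
  lam * ip f (chi j) = ip S (chi j) - 'i * s%:C * ip f (u j) - 'i * n' * (w j)%:C.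
Proof.
rewrite /S !(ipDl ipP) (ipNl ipP) !(ipZl ipP) L_chi V_chi ip_W0_chi.
by rewrite oppr0 addr0; ring.
Qed.

Let normc_is : normc ('i * s%:C : R[i]) = s.
Proof. by rewrite normcM normc_i mul1r normc_real gtr0_norm. Qed.

Let le_mulNX y z : N z <= y -> normc (ip f z) <= y * X f.
Proof.
move=> zy; rewrite (le_trans (cauchy_schwarz ipP _ _))// mulrC.
by rewrite ler_pM ?ipnorm_ge0.
Qed.

Let chi_estimate j :
  normc lam * normc (ip f (chi j)) <= X S + s * (C0 * X f) + normc n' * `|w j|.
Proof.
rewrite -normcM ip_S_chi (le_trans (normcB _ _))// lerD//; last first.
  by rewrite !normcM normc_i mul1r normc_real.
rewrite (le_trans (normcB _ _))// lerD//.
  rewrite (le_trans (cauchy_schwarz ipP _ _))// ipnorm_chi mulr1; exact: N_le_X.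
by rewrite normcM normc_is ler_pM2l// le_mulNX.
Qed.

Let m := ip f W0.

Let m_le_X : normc m <= X f.
Proof. by rewrite -[leRHS]mul1r le_mulNX// N_W0. Qed.

(** The continuity equation divided by [s]. Transport of the density is exactly [s] times the
    longitudinal momentum [m], and the weighted norm controls the right side, so nothing is lost as
    [s] tends to 0. *)
Let density_eq : lam * n' + 'i * m = s^-1%:C * ip S (chi ord0).
Proof.
have := ip_S_chi ord0; rewrite -/n w0 mulr0 subr0 V_chi0 -/m => h.
have -> : ip S (chi ord0) = lam * n + 'i * s%:C * m by rewrite h; ring.
have -> : 'i * m = s^-1%:C * ('i * s%:C * m).
  have si : s^-1%:C * s%:C = 1 :> R[i] by rewrite -rmorphM /= mulVf ?gt_eqF.
  by rewrite -[LHS]mul1r -si; ring.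
by rewrite /n'; ring.
Qed.

Let normc_density_eq : normc (lam * n' + 'i * m) <= X S.
Proof.
by rewrite density_eq normcM normc_real ger0_norm ?invr_ge0 ?(ltW s_gt0)// ler_pdivrMl// chi0_le_X.
Qed.

(** The conservation laws are divided by lambda. The field needs [density_eq], since the bound on
    the moment n itself would lose a factor 1 / s. *)
Lemma large_eigenvalue_bound (r La : R) : s <= r -> 0 < La -> La <= normc lam ->
  let b := (r * C0 + 2) / La * X f + La^-1 * X S in
  (forall j, normc (ip f (chi j)) <= b) /\ normc n' <= b.
Proof.
move=> sr La0 La_lam b.
have bE : b = La^-1 * ((r * C0 + 2) * X f + X S) by rewrite /b; ring.
have XS0 := xi_norm_ge0 S; have Xf0 := xi_norm_ge0 f.
have rC : s * (C0 * X f) <= r * (C0 * X f) by rewrite ler_wpM2r// mulr_ge0.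
have rC0 : 0 <= r * (C0 * X f).
  by apply: le_trans rC; rewrite !mulr_ge0// ltW.
split=> [j|]; rewrite bE ler_pdivlMl//.
  apply: (le_trans (y := normc lam * normc (ip f (chi j)))).
    by rewrite ler_wpM2r ?normc_ge0.
  rewrite (le_trans (chi_estimate j))//.
  have := ler_pM (normc_ge0 n') (normr_ge0 (w j)) n'_le_X (w_le1 j).
  by rewrite mulr1 mulrDl -mulrA; lra.
apply: (le_trans (y := normc lam * normc n')); first by rewrite ler_wpM2r ?normc_ge0.
rewrite -normcM.
have -> : lam * n' = (lam * n' + 'i * m) - 'i * m by ring.
rewrite (le_trans (normcB _ _))// normcM normc_i mul1r mulrDl -mulrA.
by have := m_le_X; have := normc_density_eq; lra.
Qed.

Let ip_V_W0 : normc (ip Vf W0) <= 5 * C0 * X f.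
Proof.
rewrite ip_lincomb_r; apply: (le_trans (y := \sum_(j < 5) C0 * X f)); last first.
  by rewrite sumr_const card_ord le_eqVlt; apply/orP; left; apply/eqP; ring.
elim/big_ind2 : _ => [|x a y b xa yb|j _]; first by rewrite normc0.
  by rewrite (le_trans (normcD _ _))// lerD.
rewrite V_chi conjc_re normcM normc_real -[leRHS]mul1r ler_pM ?normc_ge0//.
exact: le_mulNX.
Qed.

(** In the unknowns n' and [m] the density and momentum equations form a 2 x 2 system whose matrix
    does not depend on [s]; its determinant vanishes at the plasma oscillations +-i. Eliminating [m]
    costs two powers of [d], and dividing the remaining conservation laws by lambda costs the
    third. *)
Lemma small_frequency_bound (d La : R) : 0 < d -> d <= 1 -> normc lam <= La ->
  d <= normc lam -> d <= normc (lam - 'i) -> d <= normc (lam + 'i) ->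
  let b := 6 * C0 / d ^+ 3 * s * X f + (La + 2) / d ^+ 3 * X S in
  (forall j, normc (ip f (chi j)) <= b) /\ normc n' <= b.
Proof.
move=> d0 d1 lamLa dlam dm dp b.
have XS0 := xi_norm_ge0 S; have Xf0 := xi_norm_ge0 f.
have La0 : 0 <= La by rewrite (le_trans _ lamLa)// normc_ge0.
have momentum_eq : lam * m + 'i * n' = ip S W0 - 'i * s%:C * ip Vf W0.
  have LW : ip Lf W0 = 0 by rewrite ip_lincomb_r big1// => j _; rewrite L_chi mulr0.
  rewrite /S !(ipDl ipP) (ipNl ipP) !(ipZl ipP) LW (ip_self ipP W0) N_W0 -/m.
  by rewrite expr1n; ring.
have e2 : normc (lam * m + 'i * n') <= X S + 5 * (s * C0 * X f).
  rewrite momentum_eq (le_trans (normcB _ _))// lerD//.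
    by rewrite (le_trans (cauchy_schwarz ipP _ _))// N_W0 mulr1; exact: N_le_X.
  rewrite normcM normc_is (le_trans (ler_wpM2l (ltW s_gt0) ip_V_W0))//.
  by rewrite le_eqVlt; apply/orP; left; apply/eqP; ring.
have sqi : 'i * 'i = - 1 :> R[i] by rewrite -expr2 sqr_i.
have key : (lam - 'i) * (lam + 'i) * n' = lam * (lam * n' + 'i * m) - 'i * (lam * m + 'i * n').
  have -> : (lam - 'i) * (lam + 'i) = lam * lam - 'i * 'i by ring.
  have -> : lam * (lam * n' + 'i * m) - 'i * (lam * m + 'i * n') = (lam * lam - 'i * 'i) * n' by ring.
  by [].
have n'_est : d ^+ 2 * normc n' <= (La + 1) * X S + 5 * (s * C0 * X f).
  apply: (le_trans (y := normc (lam - 'i) * normc (lam + 'i) * normc n')).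
    by rewrite ler_wpM2r ?normc_ge0// expr2 ler_pM// ltW.
  rewrite -!normcM key (le_trans (normcB _ _))// !normcM normc_i mul1r.
  have := ler_pM (normc_ge0 lam) (normc_ge0 _) lamLa normc_density_eq.
  by move: e2; rewrite mulrDl mul1r; lra.
set A := s * C0 * X f in e2 n'_est.
have A0 : 0 <= A by rewrite /A !mulr_ge0// ltW.
have bE : b = (d ^+ 3)^-1 * (6 * A + (La + 2) * X S) by rewrite /b /A; ring.
have d3 : 0 < d ^+ 3 by rewrite exprn_gt0.
have n3 : d ^+ 3 * normc n' <= (La + 1) * X S + 5 * A.
  rewrite (le_trans _ n'_est)// ler_wpM2r ?normc_ge0//.
  by rewrite exprS ler_piMl// sqr_ge0.
have LX : 0 <= La * X S by rewrite mulr_ge0.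
split=> [j|]; rewrite bE ler_pdivlMl//; last first.
  by move: n3; rewrite !mulrDl mul1r; lra.
have cj := le_trans (ler_wpM2r (normc_ge0 (ip f (chi j))) dlam) (chi_estimate j).
have d2 : 0 < d ^+ 2 by rewrite exprn_gt0.
have d21 : d ^+ 2 <= 1 by have := d0; have := d1; nra.
have -> : d ^+ 3 * normc (ip f (chi j)) = d ^+ 2 * (d * normc (ip f (chi j))) by ring.
rewrite (le_trans (ler_wpM2l (ltW d2) cj))// !mulrDr.
have nw : d ^+ 2 * (normc n' * `|w j|) <= d ^+ 2 * normc n'.
  by rewrite ler_pM2l// ler_piMr ?normc_ge0.
have i1 : d ^+ 2 * X S <= X S by rewrite ler_piMl.
have i2 : d ^+ 2 * (s * (C0 * X f)) <= A by rewrite -/A /A -mulrA ler_piMl// !mulr_ge0// ltW.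
by move: nw i1 i2 n'_est; rewrite !mulrDl mul1r; lra.
Qed.

(* [psi j] approximates [chi j / (v . omega + t)], [phi j] is [(v . omega + t) psi j], which is
   close to [chi j] since [v . omega + t] is small on a small set only. *)
Lemma large_frequency_bound (psi Lpsi phi : 'I_5 -> H) (eta A : R) :
  complex.Re lam <= 0 -> 0 <= complex.Re lam + mu ->
  0 <= eta -> 0 <= A -> 1 <= s ->
  (forall j, ip Lf (psi j) = ip f (Lpsi j)) ->
  (forall j, ip Vf (psi j) + (complex.Im lam / s)%:C * ip f (psi j) = ip f (phi j)) ->
  (forall j, N (psi j) <= A) -> (forall j, N (Lpsi j) <= A) ->
  (forall j, N (chi j - phi j) <= eta) ->
  let b := (eta + ((mu + 2) * A + 1) / s) * X f + A * X S in
  (forall j, normc (ip f (chi j)) <= b) /\ normc n' <= b.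
Proof.
move=> re0 remu eta0 A0 s1 Lpsi_adj phiE psiA LpsiA phi_chi b.
have XS0 := xi_norm_ge0 S; have Xf0 := xi_norm_ge0 f.
have si : 0 <= s^-1 by rewrite invr_ge0 ltW.
have muA : 0 <= (mu + 2) * A by rewrite mulr_ge0// addr_ge0// ltW.
have bE : b = eta * X f + s^-1 * (((mu + 2) * A + 1) * X f) + A * X S by rewrite /b; ring.
split=> [j|]; last first.
  (* At large [s] the field n / s is small without any use of the equation. *)
  rewrite normc_n' bE -addrA.
  apply: (le_trans (y := s^-1 * (((mu + 2) * A + 1) * X f))).
    rewrite ler_wpM2l// (le_trans (cauchy_schwarz ipP _ _))// ipnorm_chi mulr1.
    by rewrite (le_trans (N_le_X f))// ler_peMl// lerDr.
  by rewrite addrCA lerDl addr_ge0// mulr_ge0.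
have sphi : s * normc (ip f (phi j)) <= (mu + 2) * A * X f + A * X S.
  rewrite -[s in leLHS]normc_is -normcM.
  (* The imaginary part of lambda is merged with transport into the multiplier v . omega + Im lambda
     / s. What remains of lambda is its real part, which is at most [mu] in absolute value. *)
  have -> : 'i * s%:C * ip f (phi j) = ip S (psi j) + ip f (Lpsi j)
      - 'i * n' * ip W0 (psi j) - (complex.Re lam)%:C * ip f (psi j).
    rewrite -phiE /S !(ipDl ipP) (ipNl ipP) !(ipZl ipP) Lpsi_adj mulrDr mulrA.
    have -> : 'i * s%:C * (complex.Im lam / s)%:C = 'i * (complex.Im lam)%:C :> R[i].
      by rewrite -mulrA -rmorphM /= mulrCA divff ?gt_eqF// mulr1.
    have -> : lam * ip f (psi j) = (complex.Re lam)%:C * ip f (psi j)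
        + 'i * (complex.Im lam)%:C * ip f (psi j) by rewrite -mulrDl -complexE.
    ring.
  rewrite (le_trans (normcB _ _))//.
  have h1 : normc ((complex.Re lam)%:C * ip f (psi j)) <= mu * (A * X f).
    rewrite normcM normc_real ler_pM ?normc_ge0 ?le_mulNX//.
    by rewrite ler0_norm//; move: remu; lra.
  have h2 : normc ('i * n' * ip W0 (psi j)) <= X f * A.
    rewrite (normcM ('i * n')) (normcM 'i) normc_i mul1r ler_pM ?normc_ge0 ?n'_le_X//.
    by rewrite (le_trans (cauchy_schwarz ipP _ _))// N_W0 mul1r.
  have h3 : normc (ip f (Lpsi j)) <= A * X f by exact: le_mulNX.
  have h4 : normc (ip S (psi j)) <= X S * A.
    by rewrite (le_trans (cauchy_schwarz ipP _ _))// ler_pM ?ipnorm_ge0.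
  have := normcD (ip S (psi j)) (ip f (Lpsi j)).
  have := normcB (ip S (psi j) + ip f (Lpsi j)) ('i * n' * ip W0 (psi j)).
  by rewrite mulrDl mulrDl -mulrA (mulrC (X S)) (mulrC (X f)) in h2 h4 *; lra.
have -> : ip f (chi j) = ip f (phi j) + ip f (chi j - phi j) by rewrite -(ipDr ipP); congr ip; lin.
rewrite (le_trans (normcD _ _))// bE [leLHS]addrC -addrA lerD ?le_mulNX//.
apply: (le_trans (y := s^-1 * ((mu + 2) * A * X f + A * X S))); first by rewrite ler_pdivlMl.
rewrite mulrDr lerD//; last by rewrite ler_piMl ?mulr_ge0// invf_le1.
by rewrite ler_wpM2l// ler_wpM2r// lerDl.
Qed.

End AprioriEstimates.
(** * The space L^2 *)

Section SquareIntegrable.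
Variable R : realType.
Implicit Types f g : R3 R -> R[i].
Local Notation T := (R3 (measurableTypeR R)).
Local Notation leb := (@leb3 R).
Local Notation ReF f := (fun v : T => complex.Re (f v) : R).
Local Notation ImF f := (fun v : T => complex.Im (f v) : R).

Definition cmeasurable f :=
  measurable_fun (setT : set T) (ReF f) /\ measurable_fun (setT : set T) (ImF f).

Lemma Lfun2P (f : T -> R) :
  f \in Lfun leb 2%:E <->
  measurable_fun setT f /\ leb.-integrable setT (fun v => (f v ^+ 2)%:E).
Proof.
split=> [fL|[mf fi]].
  split; first by case/andP: fL; rewrite inE.
  exact: (Lfun2_integrable_sqr fL).
apply/andP; split; rewrite inE//= /finite_norm unlock /Lnorm poweR_lty//.
rewrite (eq_integral (fun v => (f v ^+ 2)%:E)); last first.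
  by move=> v _; rewrite /= powR_mulrn// real_normK ?num_real.
exact: integrable_lty.
Qed.

Lemma L2P f : L2 f <->
  cmeasurable f /\ leb.-integrable setT (fun v => (normc (f v) ^+ 2)%:E).
Proof.
have e v : normc (f v) ^+ 2 = complex.Re (f v) ^+ 2 + complex.Im (f v) ^+ 2.
  exact: sqr_normc_ReIm.
split=> [[/Lfun2P[m1 i1] /Lfun2P[m2 i2]]|[[m1 m2] fi]].
  split=> //; under eq_fun do rewrite e EFinD; exact: integrableD.
have fi' : leb.-integrable setT
    (fun v => (complex.Re (f v) ^+ 2 + complex.Im (f v) ^+ 2)%:E).
  by under eq_fun do rewrite -e.
split; apply/Lfun2P; split=> //; apply: le_integrable fi' => //.
- by apply/measurable_EFinP; exact: measurable_funX.
- move=> v _; rewrite lee_fin !ger0_norm ?addr_ge0 ?sqr_ge0// lerDl sqr_ge0//.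
- by apply/measurable_EFinP; exact: measurable_funX.
- move=> v _; rewrite lee_fin !ger0_norm ?addr_ge0 ?sqr_ge0// lerDr sqr_ge0//.
Qed.

Lemma L2_cmeasurable f : L2 f -> cmeasurable f.
Proof. by case/L2P. Qed.

Lemma L2_dominated C f g : 0 <= C -> L2 f -> cmeasurable g ->
  (forall v, normc (g v) <= C * normc (f v)) -> L2 g.
Proof.
move=> C0 /L2P[_ fi] mg gf; apply/L2P; split => //.
have : leb.-integrable setT (fun v => ((C ^+ 2)%:E * (normc (f v) ^+ 2)%:E)%E).
  exact: integrableZl.
apply: le_integrable => //.
  apply/measurable_EFinP; under eq_fun do rewrite sqr_normc_ReIm.
  by apply: measurable_funD; apply: measurable_funX; case: mg.
move=> v _; rewrite -EFinM lee_fin -exprMn !ger0_norm ?sqr_ge0//.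
rewrite ler_pXn2r ?nnegrE ?normc_ge0 ?gf//.
by rewrite mulr_ge0 ?normc_ge0.
Qed.

Lemma cmeasurableM f g : cmeasurable f -> cmeasurable g ->
  cmeasurable (fun v => f v * g v).
Proof.
move=> [f1 f2] [g1 g2]; split.
  apply: (eq_measurable_fun (fun v : T => complex.Re (f v) * complex.Re (g v)
      - complex.Im (f v) * complex.Im (g v))).
    by move=> v _ /=; case: (f v) (g v) => a b [].
  by apply: measurable_funB; exact: measurable_funM.
apply: (eq_measurable_fun (fun v : T => complex.Re (f v) * complex.Im (g v)
    + complex.Im (f v) * complex.Re (g v))).
  by move=> v _ /=; case: (f v) (g v) => a b [].
by apply: measurable_funD; exact: measurable_funM.
Qed.

Lemma cmeasurableD f g : cmeasurable f -> cmeasurable g ->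
  cmeasurable (fun v => f v + g v).
Proof.
move=> [f1 f2] [g1 g2]; split.
  apply: (eq_measurable_fun (fun v : T => complex.Re (f v) + complex.Re (g v))).
    by move=> v _ /=; case: (f v) (g v) => a b [].
  exact: measurable_funD.
apply: (eq_measurable_fun (fun v : T => complex.Im (f v) + complex.Im (g v))).
  by move=> v _ /=; case: (f v) (g v) => a b [].
exact: measurable_funD.
Qed.

Lemma cmeasurable_real (h : T -> R) : measurable_fun setT h -> cmeasurable (fun v => (h v)%:C).
Proof. by move=> mh; split=> //=; exact: measurable_cst. Qed.

Lemma cmeasurable_cst (a : R[i]) : cmeasurable (fun=> a).
Proof. by split; exact: measurable_cst. Qed.

Lemma cmeasurable_conj f : cmeasurable f -> cmeasurable (fun v => conjc (f v)).
Proof.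
move=> [f1 f2]; split.
  by apply: (eq_measurable_fun (ReF f)) => // v _ /=; case: (f v).
apply: (eq_measurable_fun (fun v : T => - complex.Im (f v))).
  by move=> v _ /=; case: (f v).
exact: measurable_funN.
Qed.

Lemma cmeasurableV f : cmeasurable f -> cmeasurable (fun v => (f v)^-1).
Proof.
move=> mf; have [f1 f2] := mf.
(* The formula holds at zeros of [f] too, where both sides are 0 because the inverse of 0 is 0. *)
have -> : (fun v => (f v)^-1) = (fun v => (((normc (f v) ^+ 2)^-1)%:C * conjc (f v))).
  apply/funext => v; have [->|f0] := eqVneq (f v) 0.
    by rewrite invr0 conjc0 mulr0.
  apply: (mulfI f0); rewrite divff// mulrCA mulc_conj -rmorphM /= mulVf//.
  by apply: contra_neq f0 => /eqP; rewrite expf_eq0 => /andP[_ /eqP/eq0_normc].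
apply: cmeasurableM; last exact: cmeasurable_conj.
apply: cmeasurable_real; under eq_fun do rewrite -powR_inv1 ?sqr_ge0//.
apply: (@measurableT_comp _ _ _ _ _ _ (fun x : R => x `^ (-1))).
  exact: measurable_powR.
under eq_fun do rewrite sqr_normc_ReIm.
by apply: measurable_funD; exact: measurable_funX.
Qed.

Lemma L2_scale_add a f g : L2 f -> L2 g -> L2 (fun v => a * f v + g v).
Proof.
move=> fL gL; have [mf fi] := (L2P f).1 fL; have [mg gi] := (L2P g).1 gL.
apply/L2P; have mS : cmeasurable (fun v => a * f v + g v).
  by apply: cmeasurableD mg; apply: cmeasurableM mf; exact: cmeasurable_cst.
split=> //.
have : leb.-integrable setT (fun v => ((2 * normc a ^+ 2)%:E * (normc (f v) ^+ 2)%:E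
   + 2%:E * (normc (g v) ^+ 2)%:E)%E).
  by apply: integrableD => //; exact: integrableZl.
apply: le_integrable => //.
  apply/measurable_EFinP; under eq_fun do rewrite sqr_normc_ReIm.
  by apply: measurable_funD; apply: measurable_funX; case: mS.
move=> v _; rewrite -!EFinM -EFinD lee_fin ger0_norm ?sqr_ge0// ger0_norm; last first.
  by rewrite addr_ge0 ?mulr_ge0 ?sqr_ge0 ?normc_ge0.
have h := normcD (a * f v) (g v); rewrite normcM in h.
have n0 := normc_ge0 (a * f v + g v).
have := ler_pM n0 n0 h h; have := sqr_ge0 (normc a * normc (f v) - normc (g v)).
by nra.
Qed.

Lemma L2_0 : L2 (fun=> 0 : R[i]).
Proof.
apply/L2P; split; first exact: cmeasurable_cst.
by under eq_fun do rewrite normc0 expr0n; exact: integrable0.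
Qed.

End SquareIntegrable.
Definition L2pred (R : realType) : {pred (R3 R -> R[i]^o)} := fun f => `[< L2 f >].

Lemma L2_submod_closed (R : realType) : submod_closed (@L2pred R).
Proof.
split; first by apply/asboolP; exact: L2_0.
by move=> a f g /asboolP fL /asboolP gL; apply/asboolP; exact: L2_scale_add.
Qed.
HB.instance Definition _ (R : realType) :=
  GRing.isSubmodClosed.Build _ _ (@L2pred R) (@L2_submod_closed R).

(** No quotient is taken: equality here is pointwise, and almost everywhere equality is expressed by
    a vanishing seminorm of the difference. *)
Record L2space (R : realType) := MkL2 { L2fun :> R3 R -> R[i]^o; _ : L2fun \in @L2pred R }.
HB.instance Definition _ (R : realType) := [isSub for @L2fun R].
HB.instance Definition _ (R : realType) := [Choice of L2space R by <:].
HB.instance Definition _ (R : realType) := [SubChoice_isSubLmodule of L2space R by <:].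

Section L2inner.
Variable R : realType.
Implicit Types f g h : L2space R.
Local Notation T := (R3 (measurableTypeR R)).
Local Notation leb := (@leb3 R).

Lemma L2funP f : L2 f. Proof. by case: f => f /= /asboolP. Qed.

Definition toL2 (f : R3 R -> R[i]) (fL : L2 f) : L2space R := MkL2 (asboolT fL : f \in @L2pred R).

Lemma L2funD f g v : (f + g) v = f v + g v. Proof. by []. Qed.
Lemma L2funZ a f v : (a *: f) v = a * f v. Proof. by []. Qed.
Lemma L2funN f v : (- f) v = - f v. Proof. by []. Qed.
Lemma L2funB f g v : (f - g) v = f v - g v. Proof. by []. Qed.

Lemma L2space_eq f g : (forall v, f v = g v) -> f = g.
Proof. by move=> fg; apply/val_inj/funext. Qed.

Lemma L2fun_sum (I : finType) (F : I -> L2space R) v : (\sum_i F i) v = \sum_i F i v.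
Proof.
by apply: (big_morph (fun f : L2space R => f v : R[i])) => // f g; rewrite L2funD.
Qed.

Definition ip2 f g : R[i] := inner f g.

Lemma inner_integrable f g :
  leb.-integrable setT (fun v => (complex.Re (f v * conjc (g v)))%:E) /\
  leb.-integrable setT (fun v => (complex.Im (f v * conjc (g v)))%:E).
Proof.
have [f1 f2] := L2funP f; have [g1 g2] := L2funP g.
have i11 := (Lfun1_integrable _ _).1 (Lfun2_mul_Lfun1 f1 g1).
have i12 := (Lfun1_integrable _ _).1 (Lfun2_mul_Lfun1 f1 g2).
have i21 := (Lfun1_integrable _ _).1 (Lfun2_mul_Lfun1 f2 g1).
have i22 := (Lfun1_integrable _ _).1 (Lfun2_mul_Lfun1 f2 g2).
split.
  apply: eq_integrable (integrableD _ i11 i22) => // v _ /=.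
  by rewrite -EFinD; congr EFin; case: (f v) (g v) => a b [c d] /=; ring.
apply: eq_integrable (integrableB _ i21 i12) => // v _ /=.
by rewrite -EFinB; congr EFin; case: (f v) (g v) => a b [c d] /=; ring.
Qed.

Lemma intC_linear (a : R[i]) (F G : T -> R[i]) :
  leb.-integrable setT (fun v => (complex.Re (F v))%:E) ->
  leb.-integrable setT (fun v => (complex.Im (F v))%:E) ->
  leb.-integrable setT (fun v => (complex.Re (G v))%:E) ->
  leb.-integrable setT (fun v => (complex.Im (G v))%:E) ->
  intC (fun v => a * F v + G v) = a * intC F + intC G.
Proof.
move=> f1 f2 g1 g2; have iZ r F' : leb.-integrable setT (fun v => (F' v)%:E) ->
  leb.-integrable setT (fun v => (r * F' v)%:E).
  by move=> iF; apply: eq_integrable (integrableZl measurableT r iF).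
have iD r p F' G' : leb.-integrable setT (fun v => (F' v)%:E) ->
    leb.-integrable setT (fun v => (G' v)%:E) ->
    leb.-integrable setT (fun v => (r * F' v + p * G' v)%:E).
  by move=> iF iG; apply: eq_integrable (integrableD _ (iZ r _ iF) (iZ p _ iG)).
case: a => a b; apply/eqP; rewrite eq_complex; apply/andP; split; apply/eqP => /=.
  transitivity (\int[leb]_v ((a * complex.Re (F v) + (- b) * complex.Im (F v))
     + complex.Re (G v))).
    by apply: eq_Rintegral => v _; case: (F v) (G v) => x y [z t] /=; ring.
  rewrite RintegralD//; last exact: iD.
  rewrite RintegralD; [|by []|exact: iZ|exact: iZ].
  by rewrite !RintegralZl// mulNr.
transitivity (\int[leb]_v ((a * complex.Im (F v) + b * complex.Re (F v))
   + complex.Im (G v))).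
  by apply: eq_Rintegral => v _; case: (F v) (G v) => x y [z t] /=; ring.
rewrite RintegralD//; last exact: iD.
rewrite RintegralD; [|by []|exact: iZ|exact: iZ].
by rewrite !RintegralZl.
Qed.

Lemma ip2_semi_inner : semi_inner ip2.
Proof.
split.
- move=> a f g h; have [f1 f2] := inner_integrable f h; have [g1 g2] := inner_integrable g h.
  rewrite /ip2 /inner -(intC_linear a f1 f2 g1 g2); congr intC; apply/funext => v.
  by rewrite L2funD L2funZ; ring.
- move=> f g; have [f1 f2] := inner_integrable f g.
  apply/eqP; rewrite eq_complex; apply/andP; split; apply/eqP => /=.
    by apply: eq_Rintegral => v _; case: (f v) (g v) => a b [c d] /=; ring.
  rewrite -mulN1r -RintegralZl//.
  by apply: eq_Rintegral => v _; case: (f v) (g v) => a b [c d] /=; ring.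
- move=> f; apply: Rintegral_ge0 => v _; case: (f v) => a b /=.
  by rewrite mulrN opprK addr_ge0 -?expr2 ?sqr_ge0.
Qed.

Lemma ip2norm_sqr f : ipnorm ip2 f ^+ 2 = \int[leb]_v (normc (f v) ^+ 2).
Proof.
rewrite (sqr_ipnorm ip2_semi_inner); apply: eq_Rintegral => v _.
by rewrite sqr_normc_ReIm; case: (f v) => a b /=; ring.
Qed.

Lemma ip2norm_dominated C f g : 0 <= C ->
  (forall v, normc (g v) <= C * normc (f v)) -> ipnorm ip2 g <= C * ipnorm ip2 f.
Proof.
move=> C0 gf; rewrite -(ler_pXn2r (n := 2)) ?nnegrE ?mulr_ge0 ?ipnorm_ge0//.
rewrite exprMn !ip2norm_sqr -RintegralZl//; last by have [] := (L2P f).1 (L2funP f).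
apply: le_Rintegral => //.
- by have [] := (L2P g).1 (L2funP g).
- have [_ fi] := (L2P f).1 (L2funP f).
  by apply: eq_integrable (integrableZl measurableT (C ^+ 2) fi).
move=> v _; rewrite -exprMn ler_pXn2r ?nnegrE ?normc_ge0 ?gf//.
by rewrite mulr_ge0 ?normc_ge0.
Qed.

Lemma aeS (P Q : T -> Prop) :
  (\forall v \ae leb, P v) -> (forall v, P v -> Q v) -> \forall v \ae leb, Q v.
Proof. by move=> h PQ; exact: (@filterS _ _ (ae_filter_ringOfSetsType leb) P Q PQ h). Qed.

(** The bridge between the seminorm arguments and statements almost everywhere: a nonnegative
    function with zero integral vanishes almost everywhere. *)
Lemma ip2norm_ae f g : ipnorm ip2 (f - g) = 0 <-> f = g %[ae leb].
Proof.
have [[m1 m2] ifg] := (L2P (f - g)).1 (L2funP (f - g)).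
have mfg : measurable_fun setT (fun v : T => (normc ((f - g) v) ^+ 2)%:E).
  by case/integrableP: ifg.
have [h1 h2] := ae_eq_integral_abs leb measurableT mfg.
have e : (\int[leb]_v `|(normc ((f - g) v) ^+ 2)%:E|)%E = (ipnorm ip2 (f - g) ^+ 2)%:E.
  rewrite ip2norm_sqr /Rintegral fineK; last exact: integrable_fin_num.
  by apply: eq_integral => v _; rewrite gee0_abs// lee_fin sqr_ge0.
split=> [fg|fg].
  have /h1 : (\int[leb]_v `|(normc ((f - g) v) ^+ 2)%:E|)%E = 0%E by rewrite e fg expr0n.
  move=> /aeS; apply => v /(_ I) h _.
  have /eqP : normc ((f - g) v) ^+ 2 = 0 by exact: EFin_inj h.
  rewrite sqrf_eq0 => /eqP/eq0_normc.
  by rewrite L2funB => /eqP; rewrite subr_eq0 => /eqP.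
apply/eqP; rewrite -sqrf_eq0 -eqe -e; apply/eqP/h2.
apply: (aeS fg) => v {}fg _; rewrite L2funB fg// subrr normc0 expr0n; by [].
Qed.

End L2inner.
(** * Gaussian weights *)

Section TonelliBounds.
Local Open Scope ereal_scope.
Context d1 d2 (T1 : measurableType d1) (T2 : measurableType d2) (R : realType).
Variables (m1 : {sigma_finite_measure set T1 -> \bar R})
  (m2 : {sigma_finite_measure set T2 -> \bar R}).
Variables (G : T1 * T2 -> \bar R) (k : R).
Hypotheses (mG : measurable_fun setT G) (G0 : forall v, 0 <= G v) (k0 : (0 <= k)%R).

Lemma tonelli_le1 (f : T1 -> R) : measurable_fun setT f -> (forall x, 0 <= f x)%R ->
  (forall x, \int[m2]_y G (x, y) <= (k * f x)%:E) ->
  \int[m1 \x m2]_v G v <= k%:E * \int[m1]_x (f x)%:E.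
Proof.
move=> mf f0 h; rewrite fubini_tonelli1// -ge0_integralZl//; last 2 first.
- exact/measurable_EFinP.
- by move=> x _; rewrite lee_fin.
apply: ge0_le_integral => //.
- by move=> x _; apply: integral_ge0.
- exact: measurable_fun_fubini_tonelli_F.
- by apply/measurable_EFinP; exact: measurable_funM.
- by move=> x _; exact: h.
Qed.

Lemma tonelli_le2 (f : T2 -> R) : measurable_fun setT f -> (forall x, 0 <= f x)%R ->
  (forall y, \int[m1]_x G (x, y) <= (k * f y)%:E) ->
  \int[m1 \x m2]_v G v <= k%:E * \int[m2]_y (f y)%:E.
Proof.
move=> mf f0 h; rewrite fubini_tonelli2// -ge0_integralZl//; last 2 first.
- exact/measurable_EFinP.
- by move=> x _; rewrite lee_fin.
apply: ge0_le_integral => //.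
- by move=> x _; apply: integral_ge0.
- exact: measurable_fun_fubini_tonelli_G.
- by apply/measurable_EFinP; exact: measurable_funM.
- by move=> x _; exact: h.
Qed.

End TonelliBounds.
Arguments tonelli_le1 {d1 d2 T1 T2 R} m1 m2 {G k} mG G0 k0 {f}.
Arguments tonelli_le2 {d1 d2 T1 T2 R} m1 m2 {G k} mG G0 k0 {f}.

(* The library infers that a product measure is sigma-finite only when its factors are finite. *)
Definition leb2 (R : realType) : set (measurableTypeR R * measurableTypeR R)%type -> \bar R :=
  (@lebesgue_measure R \x @lebesgue_measure R)%E.
HB.instance Definition _ (R : realType) := Measure.on (@leb2 R).
HB.instance Definition _ (R : realType) := Measure_isSigmaFinite.Build _ _ _ (@leb2 R)
  (lebesgue_integral_fubini.product_measure_sigma_finite_subproof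
    (@lebesgue_measure R) (@lebesgue_measure R)).

Section GaussianWeight.
Variable R : realType.
Local Notation T := (R3 (measurableTypeR R)).
Local Notation leb := (@leb3 R).
Local Notation mu1 := (@lebesgue_measure R).

(** A multiple of exp (-x^2 / 4) with total mass 1. It decays more slowly than the Maxwellian, so
    its three-dimensional product dominates the Maxwellian times any polynomial, up to a
    constant. *)
Definition gweight (x : measurableTypeR R) : R := normal_pdf 0 (Num.sqrt 2) x.
Local Notation q := gweight.

Let sigma0 : Num.sqrt 2 != 0 :> R.
Proof. by rewrite sqrtr_eq0 -ltNge. Qed.

Lemma gweightE x : q x = normal_peak (Num.sqrt 2) * expR (- (x ^+ 2 / 4)).
Proof.
rewrite /gweight normal_pdfE// /normal_fun subr0 sqr_sqrtr//.
by congr (_ * expR _); field.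
Qed.

Lemma gweight_ge0 x : 0 <= q x. Proof. exact: normal_pdf_ge0. Qed.

Lemma gweight_le x : q x <= normal_peak (Num.sqrt 2).
Proof. exact: normal_pdf_ub. Qed.

Lemma measurable_gweight : measurable_fun setT q.
Proof. exact: measurable_normal_pdf. Qed.

Lemma integral_gweight : (\int[mu1]_x (q x)%:E = 1)%E.
Proof. exact: integral_normal_pdf. Qed.

Definition gweight3 (v : T) : R := q v.1.1 * q v.1.2 * q v.2.

Lemma gweight3_ge0 v : 0 <= gweight3 v.
Proof. by rewrite !mulr_ge0 ?gweight_ge0. Qed.

Let mx : measurable_fun setT (fun v : T => v.1.1 : measurableTypeR R).
Proof. by apply: measurableT_comp => //; exact: measurable_fst. Qed.
Let my : measurable_fun setT (fun v : T => v.1.2 : measurableTypeR R).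
Proof. by apply: measurableT_comp => //; exact: measurable_snd. Qed.
Let mz : measurable_fun setT (fun v : T => v.2 : measurableTypeR R).
Proof. exact: measurable_snd. Qed.

Lemma measurable_gweight3 : measurable_fun setT gweight3.
Proof.
apply: measurable_funM; [apply: measurable_funM|].
- exact: (measurableT_comp measurable_gweight mx).
- exact: (measurableT_comp measurable_gweight my).
- exact: (measurableT_comp measurable_gweight mz).
Qed.

Lemma gweight3_E v :
  gweight3 v = normal_peak (Num.sqrt 2) ^+ 3 * expR (- (dot v v / 4)).
Proof.
rewrite /gweight3 !gweightE /dot.
have -> : - ((v.1.1 * v.1.1 + v.1.2 * v.1.2 + v.2 * v.2) / 4) =
  - (v.1.1 ^+ 2 / 4) + - (v.1.2 ^+ 2 / 4) + - (v.2 ^+ 2 / 4) by ring.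
by rewrite !expRD; ring.
Qed.

Lemma measurable_dot (w : R3 R) : measurable_fun setT (fun v : T => dot v w).
Proof. by apply: measurable_funD; [apply: measurable_funD|]; exact: measurable_funM. Qed.

Lemma measurable_dot_self : measurable_fun setT (fun v : T => dot v v).
Proof. by apply: measurable_funD; [apply: measurable_funD|]; exact: measurable_funM. Qed.

Local Notation P := (normal_peak (Num.sqrt 2) : R).

(** Since [a] is at least 1/2 in absolute value, the set lies in an interval of length [4 * eta],
    and the density never exceeds its peak. *)
Lemma gweight_slab (a c eta : R) (b : measurableTypeR R -> bool) : 2^-1 <= `|a| -> 0 <= eta ->
  (forall x, b x -> `|a * x + c| <= eta) -> measurable_fun setT (fun x => (b x)%:R : R) ->
  (\int[mu1]_x (q x * (b x)%:R)%:E <= (P * (4 * eta))%:E)%E.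
Proof.
move=> a2 e0 hb mb; pose I := `[- c / a - 2 * eta, - c / a + 2 * eta]%classic.
have a0 : 0 < `|a| by rewrite (lt_le_trans _ a2)// invr_gt0.
have an0 : a != 0 by rewrite -normr_gt0.
have mq := measurable_gweight.
apply: (@le_trans _ _ (\int[mu1]_x (P%:E * (\1_I x)%:E))%E).
  apply: ge0_le_integral => //.
  - by move=> x _; rewrite lee_fin mulr_ge0 ?gweight_ge0.
  - by apply/measurable_EFinP; exact: measurable_funM.
  - apply/measurable_EFinP; apply: measurable_funM => //.
    by apply: measurable_indic; exact: measurable_itv.
  move=> x _; rewrite -EFinM lee_fin; have [bx|_] := boolP (b x); last first.
    by rewrite mulr0 mulr_ge0 ?normal_peak_ge0// indicE.
  rewrite mulr1 indicE mem_set ?mulr1 ?gweight_le// /I /= in_itv /=.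
  have xa : `|x + c / a| <= 2 * eta.
    have -> : x + c / a = (a * x + c) / a by field.
    rewrite normrM normfV ler_pdivrMr// (le_trans (hb x bx))//.
    by have := ler_wpM2l e0 a2; lra.
  by move: xa; rewrite ler_norml => /andP[h1 h2]; apply/andP; split; rewrite mulNr; lra.
rewrite ge0_integralZl//; last 2 first.
- by apply/measurable_EFinP; apply: measurable_indic; exact: measurable_itv.
- by rewrite lee_fin normal_peak_ge0.
rewrite integral_indic//; last exact: measurable_itv.
rewrite setIT EFinM; apply: lee_wpmul2l; first by rewrite lee_fin normal_peak_ge0.
have -> : (4 * eta)%:E = (((- c / a + 2 * eta)%:E - (- c / a - 2 * eta)%:E))%E.
  by rewrite -EFinB; congr EFin; ring.
have := lebesgue_measure_itv `[- c / a - 2 * eta, - c / a + 2 * eta] => /= ->.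
case: ifPn => // _; rewrite -EFinB lee_fin; lra.
Qed.

Definition in_slab (w : R3 R) t eta (v : T) : bool := `|dot v w + t| <= eta.

Lemma measurable_slab w t eta : measurable_fun setT (fun v : T => (in_slab w t eta v)%:R : R).
Proof.
have mS : measurable [set v : T | `|dot v w + t| <= eta].
  rewrite -[X in measurable X]setTI.
  have m : measurable_fun setT (fun v : T => `|dot v w + t|).
    apply: measurableT_comp => //; apply: measurable_funD => //; exact: measurable_dot.
  have := m measurableT `]-oo, eta]%classic (measurable_itv _).
  by rewrite set_itvNyc.
apply: (eq_measurable_fun (\1_[set v : T | `|dot v w + t| <= eta] : T -> R)).
  by move=> v _; rewrite indicE /in_slab; congr ((nat_of_bool _)%:R); apply/idP/idP; rewrite inE.
exact: measurable_indic.
Qed.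

Let measurable_gweight2 : measurable_fun setT
  (fun p : measurableTypeR R * measurableTypeR R => q p.1 * q p.2).
Proof. by apply: measurable_funM; apply: (measurableT_comp measurable_gweight). Qed.

Let integral_gweight2 : (\int[@leb2 R]_p (q p.1 * q p.2)%:E <= 1)%E.
Proof.
have mq := measurable_gweight; have mqq := measurable_gweight2.
rewrite -[leRHS](mule1 1%:E) -[X in (_ <= _ * X)%E]integral_gweight.
apply: (tonelli_le1 mu1 mu1) => //.
- exact/measurable_EFinP.
- by move=> v; rewrite lee_fin mulr_ge0 ?gweight_ge0.
- exact: gweight_ge0.
move=> x; rewrite (eq_integral (fun y => (q x)%:E * (q y)%:E)%E)//.
rewrite ge0_integralZl//; last 3 first.
- exact/measurable_EFinP.
- by move=> y _; rewrite lee_fin gweight_ge0.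
- by rewrite lee_fin gweight_ge0.
by rewrite integral_gweight mule1 mul1r.
Qed.

(** Some coordinate of a unit vector is at least 1/2 in absolute value, as otherwise the squares
    would sum to less than 3/4. Integrating first along that coordinate reduces to one dimension,
    with a bound uniform in [w] and [t] and without any rotation. *)
Lemma gweight3_slab (w : R3 R) (t eta : R) : dot w w = 1 -> 0 <= eta ->
  (\int[leb]_v (gweight3 v * (in_slab w t eta v)%:R)%:E <= (P * (4 * eta))%:E)%E.
Proof.
move=> w1 e0; set k := P * (4 * eta).
have k0 : 0 <= k by rewrite !mulr_ge0 ?normal_peak_ge0.
have mq := measurable_gweight; have mq3 := measurable_gweight3.
have G0 (v : T) : (0 <= (gweight3 v * (in_slab w t eta v)%:R)%:E)%E.
  by rewrite lee_fin mulr_ge0 ?gweight3_ge0.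
have mG : measurable_fun setT (fun v : T => (gweight3 v * (in_slab w t eta v)%:R)%:E).
  by apply/measurable_EFinP; apply: measurable_funM => //; exact: measurable_slab.
have mS (X : R -> T) : measurable_fun (setT : set (measurableTypeR R)) X ->
    measurable_fun setT (fun x : measurableTypeR R => (in_slab w t eta (X x))%:R : R).
  by move=> mX; exact: (measurableT_comp (measurable_slab w t eta) mX).
have qk (r : R) : 0 <= r -> 0 <= r * k by move=> ?; rewrite mulr_ge0.
have slab1 (X : R -> T) (a c r : R) : 2^-1 <= `|a| -> 0 <= r ->
    measurable_fun (setT : set (measurableTypeR R)) X ->
    (forall x, dot (X x) w + t = a * x + c) ->
    (forall x, gweight3 (X x) = r * q x) ->
    (\int[mu1]_x (gweight3 (X x) * (in_slab w t eta (X x))%:R)%:E <= (k * r)%:E)%E.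
  move=> a2 r0 mX hX gX.
  rewrite (eq_integral (fun x => r%:E * (q x * (in_slab w t eta (X x))%:R)%:E)%E); last first.
    by move=> x _; rewrite gX -EFinM mulrA.
  rewrite ge0_integralZl//; last 2 first.
  - by apply/measurable_EFinP; apply: measurable_funM => //; exact: mS.
  - by move=> x _; rewrite lee_fin mulr_ge0 ?gweight_ge0.
  rewrite mulrC EFinM; apply: lee_wpmul2l; first by rewrite lee_fin.
  apply: (gweight_slab (a := a) (c := c)) => //; last exact: mS.
  by move=> x; rewrite /in_slab hX.
have : [|| 2^-1 <= `|w.1.1|, 2^-1 <= `|w.1.2| | 2^-1 <= `|w.2|].
  apply: contra_eqT w1; rewrite !negb_or -!ltNge => /and3P[h1 h2 h3]; rewrite lt_eqF//.
  have sq (x : R) : `|x| < 2^-1 -> x * x < 4^-1.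
    move=> xh; rewrite -expr2 -(real_normK (num_real x)).
    by have := normr_ge0 x; nra.
  rewrite /dot; have := sq _ h1; have := sq _ h2; have := sq _ h3; lra.
have leb3E (F : T -> \bar R) : (\int[leb]_v F v = \int[(@leb2 R \x mu1)%E]_v F v)%E by [].
rewrite leb3E; case/or3P => h.
- apply: (le_trans (tonelli_le2 (@leb2 R) mu1 mG G0 k0 mq (@gweight_ge0) _)); last first.
    by rewrite integral_gweight mule1.
  move=> z; apply: le_trans (tonelli_le2 mu1 mu1 _ _ (qk (q z) (gweight_ge0 z)) mq gweight_ge0 _) _.
  + exact: (measurableT_comp mG (measurable_pair2 z)).
  + by move=> v; exact: G0.
  + move=> y; apply: le_trans (slab1 (fun x => (x, y, z)) w.1.1 (y * w.1.2 + z * w.2 + t)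
      (q y * q z) _ _ _ _ _) _ => //.
    * by rewrite mulr_ge0 ?gweight_ge0.
    * by apply/measurable_fun_pair => //; apply/measurable_fun_pair.
    * by move=> x; rewrite /dot /=; ring.
    * by move=> x; rewrite /gweight3 /=; ring.
    * by rewrite lee_fin le_eqVlt; apply/orP; left; apply/eqP; ring.
  by rewrite integral_gweight mule1 mulrC.
- apply: (le_trans (tonelli_le2 (@leb2 R) mu1 mG G0 k0 mq (@gweight_ge0) _)); last first.
    by rewrite integral_gweight mule1.
  move=> z; apply: le_trans (tonelli_le1 mu1 mu1 _ _ (qk (q z) (gweight_ge0 z)) mq gweight_ge0 _) _.
  + exact: (measurableT_comp mG (measurable_pair2 z)).
  + by move=> v; exact: G0.
  + move=> x; apply: le_trans (slab1 (fun y => (x, y, z)) w.1.2 (x * w.1.1 + z * w.2 + t)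
      (q x * q z) _ _ _ _ _) _ => //.
    * by rewrite mulr_ge0 ?gweight_ge0.
    * by apply/measurable_fun_pair => //; apply/measurable_fun_pair.
    * by move=> y; rewrite /dot /=; ring.
    * by move=> y; rewrite /gweight3 /=; ring.
    * by rewrite lee_fin le_eqVlt; apply/orP; left; apply/eqP; ring.
  by rewrite integral_gweight mule1 mulrC.
- have mqq := measurable_gweight2.
  apply: (le_trans (tonelli_le1 (@leb2 R) mu1 mG G0 k0 mqq _ _)).
  + by move=> p; rewrite mulr_ge0 ?gweight_ge0.
  + move=> [x y]; apply: le_trans (slab1 (fun z => (x, y, z)) w.2 (x * w.1.1 + y * w.1.2 + t)
      (q x * q y) _ _ _ _ _) _ => //.
    * by rewrite mulr_ge0 ?gweight_ge0.
    * by apply/measurable_fun_pair => //; apply/measurable_fun_pair.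
    * by move=> z; rewrite /dot /=; ring.
  rewrite -[leRHS]mule1; apply: lee_wpmul2l; first by rewrite lee_fin.
  exact: integral_gweight2.
Qed.

Lemma integral_gweight3 : (\int[leb]_v (gweight3 v)%:E <= 1)%E.
Proof.
have mq3 := measurable_gweight3.
have leb3E (F : T -> \bar R) : (\int[leb]_v F v = \int[(@leb2 R \x mu1)%E]_v F v)%E by [].
rewrite leb3E -[leRHS](mule1 1%:E).
apply: le_trans (tonelli_le1 (@leb2 R) mu1 _ _ ler01 measurable_gweight2 _ _) _.
- exact/measurable_EFinP.
- by move=> v; rewrite lee_fin gweight3_ge0.
- by move=> p; rewrite mulr_ge0 ?gweight_ge0.
- move=> [x y]; rewrite (eq_integral (fun z => (q x * q y)%:E * (q z)%:E)%E)//.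
  rewrite ge0_integralZl//; last 3 first.
  + by apply/measurable_EFinP; exact: measurable_gweight.
  + by move=> z _; rewrite lee_fin gweight_ge0.
  + by rewrite lee_fin mulr_ge0 ?gweight_ge0.
  by rewrite integral_gweight mule1 mul1r.
by apply: lee_wpmul2l => //; exact: integral_gweight2.
Qed.

End GaussianWeight.

(** * Polynomials times the Maxwellian in L^2 *)

Section GaussianBounds.
Variable R : realType.
Local Notation T := (R3 (measurableTypeR R)).
Local Notation leb := (@leb3 R).
Local Notation P := (normal_peak (Num.sqrt 2) : R).

Lemma L2_gweight (g : T -> R[i]) (C : R) : 0 <= C -> cmeasurable g ->
  (forall v, normc (g v) ^+ 2 <= C * gweight3 v) -> L2 g.
Proof.
move=> C0 mg gC; apply/L2P; split=> //.
have ig : leb.-integrable setT (fun v => (gweight3 v)%:E).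
  apply/integrableP; split; first by apply/measurable_EFinP; exact: measurable_gweight3.
  rewrite (eq_integral (fun v => (gweight3 v)%:E)).
    by apply: le_lt_trans (integral_gweight3 R) _; rewrite ltry.
  by move=> v _; rewrite gee0_abs// lee_fin gweight3_ge0.
apply: le_integrable (integrableZl measurableT C ig) => //.
  apply/measurable_EFinP; under eq_fun do rewrite sqr_normc_ReIm.
  by apply: measurable_funD; apply: measurable_funX; case: mg.
move=> v _; rewrite -EFinM lee_fin !ger0_norm ?sqr_ge0//.
by rewrite mulr_ge0 ?gweight3_ge0.
Qed.

Lemma ip2norm_gweight (f : L2space R) (C : R) : 0 <= C ->
  (forall v, normc (f v) ^+ 2 <= C * gweight3 v) -> ipnorm (@ip2 R) f ^+ 2 <= C.
Proof.
move=> C0 fC; rewrite ip2norm_sqr -lee_fin /Rintegral fineK; last first.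
  by apply: integrable_fin_num => //; have [] := (L2P f).1 (L2funP f).
apply: (@le_trans _ _ (C%:E * \int[leb]_v (gweight3 v)%:E)%E); last first.
  by rewrite -[leRHS]mule1; apply: lee_wpmul2l; rewrite ?lee_fin ?integral_gweight3.
rewrite -ge0_integralZl//; last 2 first.
- by apply/measurable_EFinP; exact: measurable_gweight3.
- by move=> v _; rewrite lee_fin gweight3_ge0.
apply: ge0_le_integral => //.
- by move=> v _; rewrite lee_fin sqr_ge0.
- by have [_ /integrableP[]] := (L2P f).1 (L2funP f).
- by apply/measurable_EFinP; apply: measurable_funM => //; exact: measurable_gweight3.
- by move=> v _; rewrite -EFinM lee_fin.
Qed.

Lemma ip2norm_slab (f : L2space R) (w : R3 R) (t d C : R) :
  dot w w = 1 -> 0 <= d -> 0 <= C ->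
  (forall v, normc (f v) ^+ 2 <= C * gweight3 v * ((in_slab w t d v)%:R + d)) ->
  ipnorm (@ip2 R) f ^+ 2 <= C * (P * (4 * d) + d).
Proof.
move=> w1 d0 C0 fC; rewrite ip2norm_sqr -lee_fin /Rintegral fineK; last first.
  by apply: integrable_fin_num => //; have [] := (L2P f).1 (L2funP f).
have mq := @measurable_gweight3 R; have mS := @measurable_slab R w t d.
have mqS : measurable_fun setT (fun v : T => gweight3 v * (in_slab w t d v)%:R).
  exact: measurable_funM.
apply: (@le_trans _ _ (C%:E * (\int[leb]_v (gweight3 v * (in_slab w t d v)%:R)%:E +
   d%:E * \int[leb]_v (gweight3 v)%:E))%E); last first.
  rewrite EFinM; apply: lee_wpmul2l; first by rewrite lee_fin.
  rewrite EFinD; apply: leeD; first exact: gweight3_slab.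
  by rewrite -[leRHS]mule1; apply: lee_wpmul2l; rewrite ?lee_fin ?integral_gweight3.
rewrite -ge0_integralZl//; last 2 first.
- exact/measurable_EFinP.
- by move=> v _; rewrite lee_fin gweight3_ge0.
rewrite -ge0_integralD//; last 4 first.
- by move=> v _; rewrite lee_fin mulr_ge0 ?gweight3_ge0.
- exact/measurable_EFinP.
- by move=> v _; rewrite -EFinM lee_fin mulr_ge0 ?gweight3_ge0.
- by apply/measurable_EFinP; exact: measurable_funM.
rewrite -ge0_integralZl//; last 2 first.
- by apply/measurable_EFinP; apply: measurable_funD => //; exact: measurable_funM.
- by move=> v _; rewrite adde_ge0 ?mule_ge0// lee_fin ?gweight3_ge0// mulr_ge0 ?gweight3_ge0.
apply: ge0_le_integral => //.
- by move=> v _; rewrite lee_fin sqr_ge0.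
- by have [_ /integrableP[]] := (L2P f).1 (L2funP f).
- apply/measurable_EFinP; apply: measurable_funM => //.
  by apply: measurable_funD => //; exact: measurable_funM.
- move=> v _; rewrite lee_fin (le_trans (fC v))//.
  by rewrite le_eqVlt; apply/orP; left; apply/eqP; ring.
Qed.

(* [(1 + r)^4 <= 16^4 exp (r / 4)] absorbs the polynomial factors. *)
Definition gauss_const : R := 16 ^+ 4 * (2 * pi) `^ (- (3 / 2)) / P ^+ 3.

Lemma dot_ge0 (v : R3 R) : 0 <= dot v v.
Proof. by rewrite /dot -!expr2 !addr_ge0 ?sqr_ge0. Qed.

Lemma P_gt0 : 0 < P.
Proof. by apply: normal_peak_gt0; rewrite sqrtr_eq0 -ltNge. Qed.

Lemma gauss_const_ge0 : 0 <= gauss_const.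
Proof. by rewrite divr_ge0 ?mulr_ge0 ?powR_ge0 ?exprn_ge0// ltW// P_gt0. Qed.

Lemma maxwell_gweight (v : R3 R) : (1 + dot v v) ^+ 4 * maxwell v <= gauss_const * gweight3 v.
Proof.
have r0 := dot_ge0 v; rewrite gweight3_E /gauss_const /maxwell; set r := dot v v in r0 *.
set b := _ `^ _; have b0 : 0 <= b by exact: powR_ge0.
have -> : 16 ^+ 4 * b / P ^+ 3 * (P ^+ 3 * expR (- (r / 4))) = 16 ^+ 4 * b * expR (- (r / 4)).
  by field; rewrite gt_eqF// P_gt0.
have -> : expR (- (r / 2)) = expR (- (r / 4)) * expR (- (r / 4)).
  by rewrite -expRD; congr expR; field.
have e0 := expR_gt0 (r / 16).
have -> : expR (- (r / 4)) * expR (- (r / 4)) = expR (- (r / 4)) * (expR (r / 16) ^+ 4)^-1.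
  rewrite -!expRM_natl -expRN; congr (_ * expR _); by field.
have h : 1 + r <= 16 * expR (r / 16) by have := expR_ge1Dx (r / 16); lra.
have h4 : (1 + r) ^+ 4 <= (16 * expR (r / 16)) ^+ 4.
  by rewrite lerXn2r ?nnegrE// addr_ge0.
apply: (@le_trans _ _ ((1 + r) ^+ 4 / expR (r / 16) ^+ 4 * (b * expR (- (r / 4))))).
  by rewrite le_eqVlt; apply/orP; left; apply/eqP; ring.
rewrite -[leRHS]mulrA ler_wpM2r ?mulr_ge0 ?expR_ge0// ler_pdivrMr ?exprn_gt0//.
by rewrite -exprMn.
Qed.

Lemma sqr_sqrtM (v : R3 R) : sqrtM v ^+ 2 = maxwell v.
Proof. by rewrite sqr_sqrtr// mulr_ge0 ?powR_ge0 ?expR_ge0. Qed.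

Lemma sqrtM_gt0 (v : R3 R) : 0 < sqrtM v.
Proof. by rewrite sqrtr_gt0 mulr_gt0 ?expR_gt0// powR_gt0// mulr_gt0// pi_gt0. Qed.

Lemma measurable_sqrtM : measurable_fun setT (fun v : T => sqrtM v).
Proof.
rewrite (_ : (fun v : T => sqrtM v) =
    (fun v : T => Num.sqrt ((2 * pi) `^ (- (3 / 2))) * expR (- (dot v v / 4)))).
  apply: measurable_funM => //; apply: measurableT_comp => //; apply: measurable_funN.
  by apply: measurable_funM => //; exact: measurable_dot_self.
apply/funext => v; rewrite /sqrtM /maxwell sqrtrM ?powR_ge0//; congr (_ * _).
have -> : expR (- (dot v v / 2)) = expR (- (dot v v / 4)) ^+ 2.
  by rewrite -expRM_natl; congr expR; field.
by rewrite sqrtr_sqr ger0_norm ?expR_ge0.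
Qed.

Lemma gweight_bound (g : T -> R[i]) (c : R) : 0 <= c ->
  (forall v, normc (g v) <= c * (1 + dot v v) ^+ 2 * sqrtM v) ->
  forall v, normc (g v) ^+ 2 <= c ^+ 2 * gauss_const * gweight3 v.
Proof.
move=> c0 gc v.
apply: (@le_trans _ _ ((c * (1 + dot v v) ^+ 2 * sqrtM v) ^+ 2)).
  by rewrite lerXn2r ?nnegrE ?normc_ge0// (le_trans _ (gc v))// normc_ge0.
have -> : (c * (1 + dot v v) ^+ 2 * sqrtM v) ^+ 2 =
  c ^+ 2 * ((1 + dot v v) ^+ 4 * sqrtM v ^+ 2) by ring.
by rewrite sqr_sqrtM -mulrA ler_wpM2l ?sqr_ge0 ?maxwell_gweight.
Qed.

Lemma L2_polynomial_growth (g : T -> R[i]) (c : R) : 0 <= c -> cmeasurable g ->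
  (forall v, normc (g v) <= c * (1 + dot v v) ^+ 2 * sqrtM v) -> L2 g.
Proof.
move=> c0 mg gc; apply: (L2_gweight _ mg (gweight_bound c0 gc)).
by rewrite mulr_ge0 ?sqr_ge0 ?gauss_const_ge0.
Qed.

Lemma ip2norm_polynomial_growth (f : L2space R) (c : R) : 0 <= c ->
  (forall v, normc (f v) <= c * (1 + dot v v) ^+ 2 * sqrtM v) ->
  ipnorm (@ip2 R) f <= c * Num.sqrt gauss_const.
Proof.
move=> c0 fc; rewrite -(ler_pXn2r (n := 2)) ?nnegrE ?mulr_ge0 ?ipnorm_ge0//.
rewrite [leRHS]exprMn [X in _ <= _ * X]sqr_sqrtr ?gauss_const_ge0//.
by apply: ip2norm_gweight (gweight_bound c0 fc); rewrite mulr_ge0 ?sqr_ge0 ?gauss_const_ge0.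
Qed.

End GaussianBounds.
(** * Orthonormality of the collision invariants *)

Section LinearIndependence.
Variable R : realType.
Local Notation T := (R3 (measurableTypeR R)).
Local Notation leb := (@leb3 R).

Let I (e x : R) : set (measurableTypeR R) := `](x - e), (x + e)[%classic.

Lemma leb3_box_gt0 (a b c e : R) : 0 < e -> (0 < leb (I e a `*` I e b `*` I e c))%E.
Proof.
move=> e0; have h x : (@lebesgue_measure R) (I e x) = (2 * e)%:E.
  have := lebesgue_measure_itv `](x - e), (x + e)[ => /= ->.
  rewrite lte_fin ifT; last by lra.
  by rewrite -EFinB; congr EFin; ring.
have m x : measurable (I e x) by exact: measurable_itv.
have e2 := product_measure1E (@lebesgue_measure R) (@lebesgue_measure R) (m a) (m b).
have e3 := product_measure1E (@leb2 R) (@lebesgue_measure R) (measurableX (m a) (m b)) (m c).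
have -> : leb (I e a `*` I e b `*` I e c) = (2 * e * (2 * e) * (2 * e))%:E.
  rewrite [LHS]e3 [X in (X * _)%E]e2.
  by rewrite !EFinM; congr (_ * _ * _)%E; exact: h.
by rewrite lte_fin !mulr_gt0.
Qed.

(** The set where [p] does not vanish is open; if nonempty it would contain a box, which has
    positive measure. *)
Lemma continuous_ae_zero (p : R * R * R -> R) : continuous p ->
  (\forall v \ae leb, p v = 0) -> forall v, p v = 0.
Proof.
move=> pc [A [mA A0 pA]] v0; apply/eqP/negP => /negP pv0.
have [e /= e0 be] : exists2 e : R, 0 < e & forall v, ball v0 e v -> p v != 0.
  have nb : \forall v \near v0, p v != 0 by exact: (cvgr_neq0 _ (pc v0) pv0).
  have [e /= e0 be] := (nbhs_ballP _ _).1 nb.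
  by exists e => // v; exact: be.
have := leb3_box_gt0 v0.1.1 v0.1.2 v0.2 e0; rewrite ltNge => /negP; apply.
rewrite -A0; apply: le_measure; rewrite ?inE//.
  by apply: measurableX; [apply: measurableX|]; exact: measurable_itv.
have hI x y : I e x y -> `|x - y| < e by rewrite /I /= in_itv /= ltr_distlC.
move=> v [[/hI h1 /hI h2] /hI h3]; apply: pA => /= pv.
by have /negP := be v (conj (conj h1 h2) h3); rewrite pv eqxx; apply.
Qed.

Definition cpoly (j : 'I_5) (v : R3 R) : R :=
  nth 0 [:: 1; v.1.1; v.1.2; v.2; (dot v v - 3) / Num.sqrt 6] j.

Lemma chiE j (v : R3 R) : chi j v = (sqrtM v * cpoly j v)%:C.
Proof. by []. Qed.

Lemma sum5 (V : zmodType) (F : 'I_5 -> V) : \sum_j F j =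
  F (@Ordinal 5 0 isT) + F (@Ordinal 5 1 isT) + F (@Ordinal 5 2 isT)
  + F (@Ordinal 5 3 isT) + F (@Ordinal 5 4 isT).
Proof.
rewrite !big_ord_recr big_ord0 /= add0r.
by congr (_ + _ + _ + _ + _); congr F; exact/val_inj.
Qed.

Lemma cpoly_independent (d : 'I_5 -> R) :
  (\forall v \ae leb, \sum_j d j * cpoly j v = 0) -> forall j, d j = 0.
Proof.
move=> /continuous_ae_zero h.
have {h} : forall v, \sum_j d j * cpoly j v = 0.
  apply: h => v.
  have -> : (fun v : R * R * R => \sum_j d j * cpoly j v) = (fun v : R * R * R =>
    d (@Ordinal 5 0 isT) + d (@Ordinal 5 1 isT) * v.1.1 + d (@Ordinal 5 2 isT) * v.1.2 +
    d (@Ordinal 5 3 isT) * v.2 +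
    d (@Ordinal 5 4 isT) / Num.sqrt 6 * ((v.1.1 * v.1.1 + v.1.2 * v.1.2 + v.2 * v.2) - 3)).
    by apply/funext => u; rewrite sum5 /cpoly /dot /=; ring.
  have c1 : (fun u : R * R * R => u.1.1) x @[x --> v] --> v.1.1 by exact: cvg_comp cvg_fst cvg_fst.
  have c2 : (fun u : R * R * R => u.1.2) x @[x --> v] --> v.1.2 by exact: cvg_comp cvg_fst cvg_snd.
  have c3 : (fun u : R * R * R => u.2) x @[x --> v] --> v.2 by exact: cvg_snd.
  have cc (r : R) : (fun=> r) x @[x --> v] --> r by exact: cvg_cst.
  apply: cvgD; [apply: cvgD; [apply: cvgD; [apply: cvgD|]|]|]; try exact: cc.
  - exact: cvgM (cc _) c1.
  - exact: cvgM (cc _) c2.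
  - exact: cvgM (cc _) c3.
  - apply: cvgM (cc _) _; apply: cvgB (cc _); apply: cvgD; [apply: cvgD|]; exact: cvgM.
move=> h.
have s6 : Num.sqrt 6 != 0 :> R by rewrite sqrtr_eq0 -ltNge.
pose s := (Num.sqrt 6)^-1 : R; have s0 : s != 0 by rewrite invr_eq0.
have ev x y z : d (@Ordinal 5 0 isT) + d (@Ordinal 5 1 isT) * x + d (@Ordinal 5 2 isT) * y +
    d (@Ordinal 5 3 isT) * z + d (@Ordinal 5 4 isT) * s * (x * x + y * y + z * z - 3) = 0.
  by rewrite -[RHS](h (x, y, z)) sum5 /cpoly /dot /= -/s; ring.
(* The second difference along the first axis isolates the energy coefficient; the values at 0 and
   at the basis vectors then give the other four. *)
have e0 := ev 0 0 0; have e1 := ev 1 0 0; have e1' := ev (-1) 0 0.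
have e2 := ev 0 1 0; have e2' := ev 0 (-1) 0; have e3 := ev 0 0 1; have e3' := ev 0 0 (-1).
have d4s : d (@Ordinal 5 4 isT) * s = 0 by move: e0 e1 e1'; lra.
have d4 : d (@Ordinal 5 4 isT) = 0 by move/eqP: d4s; rewrite mulf_eq0 (negPf s0) orbF => /eqP.
rewrite d4 !mul0r in e0 e1 e1' e2 e2' e3 e3'.
have D0 : d (@Ordinal 5 0 isT) = 0 by move: e0; lra.
have D1 : d (@Ordinal 5 1 isT) = 0 by move: e0 e1; lra.
have D2 : d (@Ordinal 5 2 isT) = 0 by move: e0 e2; lra.
have D3 : d (@Ordinal 5 3 isT) = 0 by move: e0 e3; lra.
have D (i j : 'I_5) : i = j :> nat -> d j = 0 -> d i = 0 by move=> /val_inj ->.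
case; case=> [|[|[|[|[|//]]]]] lt5.
- exact: D D0.
- exact: D D1.
- exact: D D2.
- exact: D D3.
- exact: D d4.
Qed.

End LinearIndependence.
(** * The collision operator *)

Section CollisionInvariance.
Variable R : realType.
Implicit Types v w : R3 R.

Lemma dot_sphere_point (theta phi : R) :
  dot (sphere_point theta phi) (sphere_point theta phi) = 1.
Proof.
rewrite /dot /=; have h := cos2Dsin2 theta; have h' := cos2Dsin2 phi.
have -> : sin theta * cos phi * (sin theta * cos phi) + sin theta * sin phi * (sin theta * sin phi)
  + cos theta * cos theta = sin theta ^+ 2 * (cos phi ^+ 2 + sin phi ^+ 2) + cos theta ^+ 2 by ring.
by rewrite h' mulr1 addrC.
Qed.

(** Conservation of kinetic energy: the collision map changes it by a multiple of [dot w w - 1]. *)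
Lemma maxwell_post v vs w : dot w w = 1 ->
  maxwell (post2 v vs w) * maxwell (post1 v vs w) = maxwell vs * maxwell v.
Proof.
move=> w1; rewrite /maxwell mulrACA [RHS]mulrACA -!expRD; congr (_ * expR _).
have e : dot (post2 v vs w) (post2 v vs w) + dot (post1 v vs w) (post1 v vs w)
    = dot vs vs + dot v v + 2 * dot (v - vs) w ^+ 2 * (dot w w - 1).
  case: v vs w {w1} => [[v1 v2] v3] [[s1 s2] s3] [[w1 w2] w3].
  by rewrite /post1 /post2 /scale3 /dot /=; ring.
by rewrite w1 subrr mulr0 addr0 in e; move: e; lra.
Qed.

Lemma Q_maxwell B v :
  Q B (fun u => (maxwell u)%:C) (fun u => (maxwell u)%:C) v = 0.
Proof.
pose g (h : R[i] -> R) (vs w : R3 R) := h ((B (v - vs) w)%:C *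
  ((maxwell (post2 v vs w))%:C * (maxwell (post1 v vs w))%:C - (maxwell vs)%:C * (maxwell v)%:C)).
have z (h : R[i] -> R) : h 0 = 0 -> collision_int (g h) = 0.
  move=> h0; rewrite /collision_int /Rintegral integral0_eq// => vs _.
  congr EFin; rewrite /sphere_int /Rintegral integral0_eq// => theta _.
  congr EFin; rewrite /Rintegral integral0_eq// => phi _; congr EFin.
  rewrite /g -!rmorphM /= maxwell_post ?dot_sphere_point// subrr mulr0 h0 mul0r//.
by rewrite /Q /collision_intC -/(g (@complex.Re R)) -/(g (@complex.Im R)) !z.
Qed.

Lemma Lop_sqrtM B v : Lop B (fun u => (sqrtM u)%:C) v = 0.
Proof.
have e : (fun u : R3 R => (sqrtM u)%:C * (sqrtM u)%:C) = (fun u => (maxwell u)%:C).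
  by apply/funext => u; rewrite -rmorphM /= -expr2 sqr_sqrtM.
by rewrite /Lop e Q_maxwell addr0 mulr0.
Qed.

End CollisionInvariance.

(** * The collision frequency, the operator K and the collision invariants in L^2 *)

Section LinearizedOperator.
Variables (R : realType) (gamma nu0 nu1 mu : R) (B : R3 R -> R3 R -> R).
Hypotheses (B_kernel : collision_kernel gamma B)
    (nu_bounds : forall v : R3 R,
       nu0 * (1 + enorm v) `^ gamma <= nu B v <= nu1 * (1 + enorm v) `^ gamma)
    (K_operator : L2_operator (Kop B))
    (K_self_adjoint : self_adjoint (Kop B))
    (K_compact : compact_operator (Kop B))
    (L_null_space : null_space_spanned B)
    (mu_gt0 : 0 < mu)
    (L_coercive : coercive B mu)
    (mu_le_nu0 : mu <= nu0 <= nu B 0).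
Local Notation T := (R3 (measurableTypeR R)).
Local Notation leb := (@leb3 R).
Local Notation ip := (@ip2 R).
Local Notation N := (ipnorm ip).
Implicit Types (v w xi : R3 R) (f g : L2space R).

Lemma gamma_bounds : 0 <= gamma <= 1.
Proof. by case: B_kernel => [|? ? ? /andP[-> /ltW ->]]//; rewrite ler01 lexx. Qed.

Lemma nu0_gt0 : 0 < nu0.
Proof. by have /andP[h _] := mu_le_nu0; exact: lt_le_trans h. Qed.

Lemma enorm_weight v : 1 <= (1 + enorm v) `^ gamma <= 2 * (1 + dot v v).
Proof.
have /andP[g0 g1] := gamma_bounds; have e0 : 0 <= enorm v by exact: sqrtr_ge0.
have e1 : 1 <= 1 + enorm v by rewrite lerDl.
apply/andP; split; first by rewrite -[leLHS](powRr0 (1 + enorm v)) ler_powR.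
apply: (@le_trans _ _ ((1 + enorm v) `^ 1)); first by rewrite ler_powR.
rewrite powRr1 ?addr_ge0//; have : enorm v ^+ 2 = dot v v by rewrite sqr_sqrtr ?dot_ge0.
by have := sqr_ge0 (enorm v - 1); nra.
Qed.

Lemma nu_ge v : nu0 <= nu B v.
Proof.
have /andP[h _] := nu_bounds v; have /andP[h1 _] := enorm_weight v.
by rewrite (le_trans _ h)// ler_peMr// ltW// nu0_gt0.
Qed.

Lemma nu1_ge0 : 0 <= nu1.
Proof.
have /andP[h1 _] := enorm_weight 0; have /andP[_ h] := nu_bounds 0.
have : 0 < nu1 * (1 + enorm (0 : R3 R)) `^ gamma.
  by rewrite (lt_le_trans _ h)// (lt_le_trans nu0_gt0)// nu_ge.
by rewrite pmulr_lgt0 => [/ltW//|]; rewrite (lt_le_trans _ h1).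
Qed.

Lemma nu_le v : nu B v <= nu1 * (2 * (1 + dot v v)).
Proof.
have /andP[_ h] := nu_bounds v; rewrite (le_trans h)// ler_wpM2l ?nu1_ge0//.
by have /andP[] := enorm_weight v.
Qed.

Lemma nu_ge0 v : 0 <= nu B v. Proof. exact: le_trans (ltW nu0_gt0) (nu_ge v). Qed.

Lemma cmeasurable_sqrtM : cmeasurable (fun v : T => (sqrtM v)%:C).
Proof. by apply: cmeasurable_real; exact: measurable_sqrtM. Qed.

Lemma le_1_growth v : 1 <= (1 + dot v v) ^+ 2.
Proof. by rewrite exprn_ege1// lerDl dot_ge0. Qed.

Lemma sqrtM_L2 : L2 (fun v : T => (sqrtM v)%:C).
Proof.
apply: (L2_polynomial_growth ler01 cmeasurable_sqrtM) => v.
rewrite normc_real gtr0_norm ?sqrtM_gt0// mul1r ler_peMl ?le_1_growth//.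
by rewrite ltW// sqrtM_gt0.
Qed.

(* The Maxwellian annihilates the collision integral pointwise, so [K sqrt M = nu sqrt M];
   this is where the measurability of [nu] comes from. *)
Lemma measurable_nu : measurable_fun setT (fun v : T => nu B v).
Proof.
have [K1 _ _] := K_operator; have := L2_cmeasurable (K1 _ sqrtM_L2).
have -> : Kop B (fun v => (sqrtM v)%:C) = (fun v => (nu B v)%:C * (sqrtM v)%:C).
  by apply/funext => v; rewrite /Kop Lop_sqrtM add0r.
move=> /cmeasurableM /(_ (cmeasurableV cmeasurable_sqrtM)) [m _].
apply: eq_measurable_fun m => v _; rewrite mulfK//.
by rewrite eq_complex /= negb_and gt_eqF// sqrtM_gt0.
Qed.


Lemma cmeasurable_nu : cmeasurable (fun v : T => (nu B v)%:C).
Proof. by apply: cmeasurable_real; exact: measurable_nu. Qed.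

Lemma cpoly_growth j v : `|cpoly j v| <= 2 * (1 + dot v v).
Proof.
have sq (x : R) : `|x| <= 1 + x * x.
  rewrite -[x * x]/(x ^+ 2) -[x ^+ 2](real_normK (num_real x)).
  by have := sqr_ge0 (`|x| - 1); have := sqr_ge0 (`|x|); nra.
have r0 := dot_ge0 v.
have xd : v.1.1 * v.1.1 <= dot v v /\ v.1.2 * v.1.2 <= dot v v /\ v.2 * v.2 <= dot v v.
  have := sqr_ge0 v.1.1; have := sqr_ge0 v.1.2; have := sqr_ge0 v.2.
  by rewrite !expr2 /dot => *; do !split; lra.
case: xd => x1 [x2 x3].
have s6 : 2 <= Num.sqrt 6 :> R.
  by rewrite -[leLHS]ger0_norm// -sqrtr_sqr ler_wsqrtr//; lra.
case: j => -[|[|[|[|[|//]]]]] lt5; rewrite /cpoly /=.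
- by rewrite normr1; lra.
- by have := sq v.1.1; lra.
- by have := sq v.1.2; lra.
- by have := sq v.2; lra.
rewrite normrM normfV [`|Num.sqrt _|]ger0_norm ?sqrtr_ge0// ler_pdivrMr; last by lra.
have : `|dot v v - 3| <= dot v v + 3 by rewrite ler_norml; lra.
by move: s6; move: (Num.sqrt 6) => q6; nra.
Qed.

Lemma measurable_cpoly j : measurable_fun setT (fun v : T => cpoly j v).
Proof.
case: j => -[|[|[|[|[|//]]]]] lt5; rewrite /cpoly /=.
- exact: measurable_cst.
- by apply: measurableT_comp => //; exact: measurable_fst.
- by apply: measurableT_comp => //; exact: measurable_snd.
- exact: measurable_snd.
- apply: measurable_funM => //; apply: measurable_funB => //; exact: measurable_dot_self.
Qed.

Lemma cmeasurable_chi j : cmeasurable (fun v : T => chi j v).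
Proof.
by apply: cmeasurable_real; apply: measurable_funM; [exact: measurable_sqrtM|exact: measurable_cpoly].
Qed.

Lemma normc_chi j v : normc (chi j v) <= 2 * (1 + dot v v) * sqrtM v.
Proof.
rewrite chiE normc_real normrM (gtr0_norm (sqrtM_gt0 v)) [leLHS]mulrC.
by rewrite ler_wpM2r ?cpoly_growth// ltW// sqrtM_gt0.
Qed.

(** One factor [1 + dot v v] comes from the multiplier and one from the polynomial in [chi]; this is
    the reason for the square in the Gaussian growth bounds. *)
Lemma normc_mul_chi (m : T -> R[i]) c j v : normc (m v) <= c * (1 + dot v v) ->
  normc (m v * chi j v) <= 2 * c * (1 + dot v v) ^+ 2 * sqrtM v.
Proof.
move=> mc; rewrite normcM.
apply: le_trans (ler_pM (normc_ge0 _) (normc_ge0 _) mc (normc_chi j v)) _.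
by rewrite le_eqVlt; apply/orP; left; apply/eqP; ring.
Qed.

Lemma mul_chi_L2 (m : T -> R[i]) c j : 0 <= c -> cmeasurable m ->
  (forall v, normc (m v) <= c * (1 + dot v v)) -> L2 (fun v => m v * chi j v).
Proof.
move=> c0 mm mc; have c20 : 0 <= 2 * c by rewrite mulr_ge0.
apply: (L2_polynomial_growth c20 (cmeasurableM mm (cmeasurable_chi j))) => v.
exact: normc_mul_chi.
Qed.

Lemma N_mul_chi (m : T -> R[i]) c j f : 0 <= c ->
  (forall v, normc (m v) <= c * (1 + dot v v)) -> (forall v, f v = m v * chi j v) ->
  N f <= 2 * c * Num.sqrt (gauss_const R).
Proof.
move=> c0 mc fE; apply: ip2norm_polynomial_growth; first by rewrite mulr_ge0.
by move=> v; rewrite fE; exact: normc_mul_chi.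
Qed.

Lemma chi_L2 j : L2 (chi j : R3 R -> R[i]).
Proof.
have := @mul_chi_L2 (fun=> 1) 1 j ler01 (cmeasurable_cst 1).
have -> : (fun v : R3 R => 1 * chi j v) = chi j by apply/funext => v; rewrite mul1r.
by apply=> v; rewrite normc1 mul1r lerDl dot_ge0.
Qed.

Lemma nu_chi_L2 j : L2 (fun v : R3 R => (nu B v)%:C * chi j v).
Proof.
apply: (@mul_chi_L2 _ (nu1 * 2) j _ cmeasurable_nu); first by rewrite mulr_ge0 ?nu1_ge0.
by move=> v; rewrite normc_real ger0_norm ?nu_ge0// -mulrA nu_le.
Qed.

Definition chiL j : L2space R := toL2 (chi_L2 j).
Definition nuchiL j : L2space R := toL2 (nu_chi_L2 j).

Lemma domL_chi j : domL B (chi j).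
Proof. by split; [exact: chi_L2|exact: nu_chi_L2]. Qed.

Lemma Lop_chi j : Lop B (chi j) = (fun=> 0) %[ae leb].
Proof.
apply/(L_null_space (domL_chi j)); exists (fun i => (i == j)%:R).
apply: aeW => v _; rewrite (bigD1 j)//= eqxx mul1r big1 ?addr0// => i /negPf ->.
by rewrite mul0r.
Qed.

Let K_L2 f : L2 (Kop B f). Proof. by case: K_operator => h _ _; exact: h (L2funP f). Qed.

Definition KL f : L2space R := toL2 (K_L2 f).

Lemma KL_linear : sub_linear N KL.
Proof.
move=> a f g; apply/ip2norm_ae; case: K_operator => _ _ h.
exact: (h a f g (L2funP f) (L2funP g)).
Qed.

Lemma KL_ext f g : N (f - g) = 0 -> N (KL f - KL g) = 0.
Proof.
move=> /ip2norm_ae fg; apply/ip2norm_ae; case: K_operator => _ h _.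
exact: (h f g (L2funP f) (L2funP g) fg).
Qed.

Lemma KL_self_adjoint f g : ip (KL f) g = ip f (KL g).
Proof. exact: K_self_adjoint (L2funP f) (L2funP g). Qed.

Lemma KL_compact : sub_compact N KL.
Proof.
move=> u [A uA]; have [|s [g [s_incr gL s_cvg]]] := K_compact (fun n => L2funP (u n)).
  by exists A => n; exact: uA.
exists s, (toL2 gL); split=> // e e0.
move/cvgrPdist_le : s_cvg => /(_ _ e0)[n0 _ h]; exists n0 => n n0n.
have := h n n0n; rewrite /= sub0r normrN; apply: le_trans.
exact: ler_norm.
Qed.

Let ipP : semi_inner ip := @ip2_semi_inner R.
Let ND := ipnormD ipP.
Let NZ := ipnormZ ipP.

(** A compact operator is bounded: otherwise vectors in the unit ball with images of norm above [n]
    would have no subsequence with convergent images. *)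
Lemma KL_bounded : exists2 CK, 0 <= CK & forall f, N (KL f) <= CK * N f.
Proof.
suff [CK h] : exists CK, forall f, N (KL f) <= CK * N f.
  exists (Num.max CK 0); first by rewrite le_max lexx orbT.
  by move=> f; rewrite (le_trans (h f))// ler_wpM2r ?ipnorm_ge0// le_max lexx.
apply: contrapT => /forallNP nb.
have {nb} /choice[x Hx] (n : nat) : exists f, N f <= 1 /\ n%:R < N (KL f).
  have /existsNP[f /negP] := nb n%:R; rewrite -ltNge => fn.
  have f0 : N f != 0.
    apply: contraTneq fn => f0; rewrite f0 mulr0 -leNgt.
    have <- : N (KL 0) = 0 by apply: (sub_linear_small NZ KL_linear).
    rewrite (seminorm_mod0 ND NZ (x := KL f) (y := KL 0))//.
    by apply: KL_ext; rewrite subr0.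
  have fp : 0 < N f by rewrite lt_neqAle eq_sym f0 ipnorm_ge0.
  exists ((N f)^-1%:C *: f); rewrite (sub_linearZ ND NZ _ _ KL_linear) NZ.
  rewrite normc_real gtr0_norm ?invr_gt0// mulVf//; split => //.
  by rewrite ltr_pdivlMl// mulrC.
have [|s [z [s_incr /(_ 1 ltr01)[n0 h]]]] := KL_compact (u := x).
  by exists 1 => n; have [] := Hx n.
have s_ge k : (k <= s k)%N.
  by elim: k => // k IHk; rewrite (leq_ltn_trans IHk)// s_incr.
pose n := maxn n0 (Num.trunc (N z + 1)).+1.
have h1 := h n (leq_maxl _ _); have [_ h2] := Hx (s n).
have : N (KL (x (s n))) <= 1 + N z.
  by rewrite -[KL (x (s n))](subrK z) (le_trans (ND _ _))// lerD2r.
rewrite leNgt => /negP; apply; apply: le_lt_trans h2.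
rewrite addrC (le_trans (ltW (truncnS_gt _)))// ler_nat.
by rewrite (leq_trans _ (s_ge n))// leq_maxr.
Qed.

Lemma macro_chi k : N (chiL k - macro ip chiL (chiL k)) = 0.
Proof.
have e0 : ip (KL (chiL k) - nuchiL k) (chiL k) = 0.
  apply: (ip_null ipP); have -> : KL (chiL k) - nuchiL k = (KL (chiL k) - nuchiL k) - 0 by rewrite subr0.
  apply/ip2norm_ae; apply: (aeS (Lop_chi k)) => v h _.
  rewrite L2funB /= /Kop addrK; exact: h.
have := L_coercive (domL_chi k).
have -> : Lop B (chi k) = (KL (chiL k) - nuchiL k : L2space R).
  by apply/funext => v; rewrite L2funB /= /Kop addrK.
rewrite -[inner _ _]/(ip (KL (chiL k) - nuchiL k) (chiL k)).
have -> : L2norm (P1 (chi k)) = N (chiL k - macro ip chiL (chiL k)).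
  have -> : P1 (chi k) = (chiL k - macro ip chiL (chiL k) : L2space R) => //.
  apply/funext => v; rewrite /P1 /P0 L2funB; congr (_ - _).
  by rewrite /macro L2fun_sum.
rewrite e0 /= => h; have : N (chiL k - macro ip chiL (chiL k)) ^+ 2 <= 0.
  by rewrite -(ler_pM2l mu_gt0) mulr0; move: h; rewrite mulNr; lra.
by move=> h2; apply/eqP; rewrite -sqrf_eq0 eq_le h2 sqr_ge0.
Qed.

Lemma chi_orthonormal j k : ip (chiL j) (chiL k) = (j == k)%:R.
Proof.
have /ip2norm_ae m := macro_chi j.
pose d i : R[i] := (j == i)%:R - ip (chiL j) (chiL i).
have {m} dz : \forall v \ae leb, \sum_i d i * (cpoly i v)%:C = 0.
  apply: (aeS m) => v /(_ I) h.
  have sv : (sqrtM v)%:C != 0 :> R[i] by rewrite eq_complex /= negb_and gt_eqF// sqrtM_gt0.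
  apply: (mulfI sv); rewrite mulr0 mulr_sumr.
  have -> : \sum_i (sqrtM v)%:C * (d i * (cpoly i v)%:C) = \sum_i d i * chi i v.
    by apply: eq_bigr => i _; rewrite chiE rmorphM mulrCA.
  rewrite /d; under eq_bigr do rewrite mulrBl.
  rewrite sumrB (bigD1 j)//= eqxx mul1r big1 ?addr0; last first.
    by move=> i; rewrite eq_sym => /negPf ->; rewrite mul0r.
  apply/eqP; rewrite subr_eq0; apply/eqP; rewrite -[chi j v]/(chiL j v) h.
  by rewrite /macro L2fun_sum.
have dre i : complex.Re (d i) = 0.
  apply: (@cpoly_independent R (fun i => complex.Re (d i))); apply: (aeS dz) => v.
  rewrite !sum5; move: (d _) (d _) (d _) (d _) (d _) => [a a'] [b b'] [c c'] [p p'] [q q'].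
  by move=> /(congr1 (@complex.Re R)) /=; rewrite !mulr0 !subr0.
have dim i : complex.Im (d i) = 0.
  apply: (@cpoly_independent R (fun i => complex.Im (d i))); apply: (aeS dz) => v.
  rewrite !sum5; move: (d _) (d _) (d _) (d _) (d _) => [a a'] [b b'] [c c'] [p p'] [q q'].
  by move=> /(congr1 (@complex.Im R)) /=; rewrite !mulr0 !add0r.
have : d k = 0 by apply/eqP; rewrite eq_complex dre dim !eqxx.
by move/eqP; rewrite subr_eq0 => /eqP.
Qed.

(** * The resolvent set *)

(** The multipliers [nu], v . omega and v . omega + t are unbounded, so the products are passed as
    elements of L^2 in their own right. *)
Lemma ip_real_multiplier (m : R3 R -> R) (f f' g g' : L2space R) :
  (forall v, f' v = (m v)%:C * f v) -> (forall v, g' v = (m v)%:C * g v) ->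
  ip f' g = ip f g'.
Proof.
move=> fE gE; congr intC; apply/funext => v; rewrite fE gE.
rewrite -[X in _ * X]/(conjc (g v)) -[X in _ = _ * X]/(conjc ((m v)%:C * g v)).
by rewrite conjcM conjc_re; ring.
Qed.

Lemma enorm_gt0 xi : xi != 0 -> 0 < enorm xi.
Proof.
move=> x0; rewrite sqrtr_gt0 lt_neqAle dot_ge0 andbT eq_sym; apply: contra_neq x0.
case: xi => [[a b] c]; rewrite /dot /= -!expr2 => h.
have := sqr_ge0 a; have := sqr_ge0 b; have := sqr_ge0 c => hc hb ha.
have [a0 [b0 c0]] : a ^+ 2 = 0 /\ b ^+ 2 = 0 /\ c ^+ 2 = 0 by do !split; lra.
by move: a0 b0 c0 => /eqP + /eqP + /eqP; rewrite !sqrf_eq0 => /eqP -> /eqP -> /eqP ->.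
Qed.

Section FixedFrequency.
Variables (xi : R3 R) (lam : R[i]).
Hypothesis xi_neq0 : xi != 0.
Local Notation s := (enorm xi).

Let s_gt0 : 0 < s. Proof. exact: enorm_gt0. Qed.
Let sqr_s : s ^+ 2 = dot xi xi. Proof. by rewrite sqr_sqrtr ?dot_ge0. Qed.

Definition direction (j : 'I_5) : R :=
  nth 0 [:: 0; xi.1.1 / s; xi.1.2 / s; xi.2 / s; 0] j.

Lemma direction_unit : \sum_j direction j ^+ 2 = 1.
Proof.
rewrite sum5 /direction /= expr0n !addr0 add0r !expr_div_n -!mulrDl sqr_s /dot !expr2 divff//.
by rewrite -[X in X != 0]/(dot xi xi) -sqr_s sqrf_eq0 gt_eqF.
Qed.

Definition dir3 : R3 R := scale3 s^-1 xi.

Lemma dot_dir3 v : dot v dir3 = dot v xi / s.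
Proof. by rewrite /dot /=; ring. Qed.

Lemma dir3_unit : dot dir3 dir3 = 1.
Proof.
have -> : dot dir3 dir3 = dot xi xi * s^-1 ^+ 2 by rewrite /dot /dir3 /scale3 /=; ring.
by rewrite -sqr_s -exprMn divff ?expr1n// gt_eqF.
Qed.

Lemma dot_dir3_le v : `|dot v dir3| <= 1 + dot v v.
Proof.
have [] : 0 <= dot v v + dot dir3 dir3 + 2 * dot v dir3 /\
    0 <= dot v v + dot dir3 dir3 - 2 * dot v dir3.
  case: v dir3 => [[a b] c] [[d e] k]; rewrite /dot /=.
  have := sqr_ge0 (a + d); have := sqr_ge0 (b + e); have := sqr_ge0 (c + k).
  have := sqr_ge0 (a - d); have := sqr_ge0 (b - e); have := sqr_ge0 (c - k).
  by rewrite !expr2 => *; split; lra.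
rewrite dir3_unit ler_norml; have := dot_ge0 v.
by move: (dot v v) (dot v dir3) => p q *; apply/andP; split; lra.
Qed.

Lemma measurable_dot_dir3 : measurable_fun setT (fun v : T => dot v dir3).
Proof. exact: measurable_dot. Qed.

Let u_L2 j : L2 (fun v : R3 R => (dot v dir3)%:C * chi j v).
Proof.
apply: (@mul_chi_L2 _ 1 j ler01); first exact: cmeasurable_real measurable_dot_dir3.
by move=> v; rewrite normc_real mul1r dot_dir3_le.
Qed.

Definition uL j : L2space R := toL2 (u_L2 j).

(** Independent of [xi], because |v . omega| <= 1 + |v|^2 for every unit vector omega; the
    thresholds below owe their uniformity to this. *)
Definition C0 : R := 2 * 1 * Num.sqrt (gauss_const R).

Lemma N_uL j : N (uL j) <= C0.
Proof.
apply: (@N_mul_chi (fun v => (dot v dir3)%:C) 1 j) => // v.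
by rewrite normc_real mul1r dot_dir3_le.
Qed.

Lemma direction_lincomb v :
  (\sum_j (direction j)%:C *: chiL j : L2space R) v = (dot v dir3)%:C * (sqrtM v)%:C.
Proof.
rewrite L2fun_sum.
under eq_bigr do rewrite L2funZ [chiL _ _]chiE -rmorphM /=.
rewrite -realc_sum -rmorphM /=; congr (_%:C).
rewrite sum5 /direction /cpoly /dir3 /dot /=; ring.
Qed.

Section DomainElement.
Variable f : L2space R.
Hypothesis f_dom : domB B xi f.

Definition nuf : L2space R := let: And3 _ h _ := f_dom in toL2 h.
Definition xif : L2space R := let: And3 _ _ h := f_dom in toL2 h.

Lemma nufE v : nuf v = (nu B v)%:C * f v.
Proof. by rewrite /nuf; case: f_dom. Qed.
Lemma xifE v : xif v = (dot v xi)%:C * f v.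
Proof. by rewrite /xif; case: f_dom. Qed.

Definition Lf : L2space R := KL f - nuf.
Definition Vf : L2space R := s^-1%:C *: xif.
Definition Sf : L2space R := shifted_op ip chiL s direction lam f Lf Vf.

Lemma LfE v : Lf v = Lop B f v.
Proof. by rewrite /Lf L2funB nufE /= /Kop addrK. Qed.

Lemma VfE v : Vf v = (dot v dir3)%:C * f v.
Proof. by rewrite /Vf L2funZ xifE dot_dir3 (mulrC (dot v xi)) rmorphM mulrA. Qed.

Lemma Pd_chi0 g v : Pd g v = ip g (chiL ord0) * (sqrtM v)%:C.
Proof.
rewrite /Pd mulrC; congr (_ * _); congr intC; apply/funext => u.
congr (_ * _); rewrite [chiL _ _]chiE /cpoly /= mulr1.
by apply/eqP; rewrite eq_complex /= oppr0 !eqxx.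
Qed.

Lemma SfE : (fun v => lam * f v - Bhat B xi f v) = Sf.
Proof.
apply/funext => v.
rewrite /Sf /shifted_op; move: Lf Vf LfE VfE => LF VF LFE VFE.
rewrite !L2funD L2funN !L2funZ direction_lincomb LFE VFE /Bhat Pd_chi0.
rewrite !dot_dir3; set n := ip f _.
have si : s%:C * s^-1%:C = 1 :> R[i] by rewrite -rmorphM /= divff// gt_eqF.
have -> : (dot v xi / s)%:C = (dot v xi)%:C * s^-1%:C by rewrite -rmorphM.
have -> : (dot v xi / s ^+ 2)%:C = (dot v xi)%:C * (s^-1%:C * s^-1%:C) :> R[i].
  by rewrite -!rmorphM /= -invfM -expr2.
have -> : 'i * s%:C * ((dot v xi)%:C * s^-1%:C * f v) = 'i * ((dot v xi)%:C * f v) * (s%:C * s^-1%:C) by ring.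
rewrite si; ring.
Qed.

Lemma Lf_chi j : ip Lf (chiL j) = 0.
Proof.
rewrite /Lf (ipBl ipP) KL_self_adjoint.
rewrite (ip_real_multiplier (m := fun v => nu B v) (g := chiL j) (g' := nuchiL j) nufE)//.
rewrite -(ipBr ipP) (ipC ipP) (ip_null ipP) ?conjc0//.
have -> : KL (chiL j) - nuchiL j = (KL (chiL j) - nuchiL j) - 0 by rewrite subr0.
apply/ip2norm_ae; apply: (aeS (Lop_chi j)) => v h _.
by rewrite L2funB /= /Kop addrK; exact: h.
Qed.

Lemma Lf_coercive :
  complex.Re (ip Lf f) <= - mu * N (f - macro ip chiL f) ^+ 2.
Proof.
have fd : domL B f by case: f_dom => h1 h2 _; split.
have := L_coercive fd.
have -> : Lop B f = Lf by apply/funext => v; rewrite LfE.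
have -> : L2norm (P1 f) = N (f - macro ip chiL f) => //.
have -> : P1 f = (f - macro ip chiL f : L2space R) => //.
apply/funext => v; rewrite /P1 /P0 L2funB; congr (_ - _).
by rewrite /macro L2fun_sum.
Qed.

Lemma Vf_chi j : ip Vf (chiL j) = ip f (uL j).
Proof. exact: (ip_real_multiplier VfE). Qed.

Lemma Vf_chi0 : ip f (uL ord0) = ip f (\sum_j (direction j)%:C *: chiL j).
Proof.
congr ip; apply: L2space_eq => v; rewrite direction_lincomb -[LHS]/((dot v dir3)%:C * chi ord0 v) chiE.
by rewrite /cpoly /= mulr1.
Qed.

Lemma Vf_real : complex.Im (ip Vf f) = 0.
Proof.
have := ip_real_multiplier VfE VfE; rewrite (ipC ipP Vf f).
by case: (ip Vf f) => a b [] /=; lra.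
Qed.

End DomainElement.

Lemma norm_xiE g : norm_xi xi g = xi_norm ip chiL s g.
Proof.
rewrite /norm_xi /inner_xi -[inner g g]/(ip g g) (ip_self ipP).
have -> : inner (Pd g) (Pd g) = ip (ip g (chiL ord0) *: chiL ord0) (ip g (chiL ord0) *: chiL ord0).
  have -> : Pd g = (ip g (chiL ord0) *: chiL ord0 : L2space R) => //.
  apply/funext => v; rewrite Pd_chi0 L2funZ [chiL _ _]chiE /cpoly /=; congr (_ * _).
  by rewrite mulr1.
rewrite (ipZl ipP) (ipZr ipP) chi_orthonormal eqxx mulr1 mulc_conj.
by rewrite -rmorphM -rmorphD /= /xi_norm exprMn exprVn.
Qed.

Local Notation X := (xi_norm ip chiL s).

Lemma le_xi_norm g : N g <= X g.
Proof.
rewrite -(ler_pXn2r (n := 2)) ?nnegrE ?ipnorm_ge0 ?sqrtr_ge0//.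
by rewrite [leRHS]sqr_sqrtr ?addr_ge0 ?sqr_ge0// lerDl sqr_ge0.
Qed.

Lemma xi_norm_le g : X g <= (1 + s^-1) * N g.
Proof.
have si : 0 <= s^-1 by rewrite invr_ge0 ltW.
have h : normc (ip g (chiL ord0)) <= N g.
  rewrite (le_trans (cauchy_schwarz ipP _ _))//.
  by rewrite (ipnorm_chi chi_orthonormal) mulr1.
have n0 := ipnorm_ge0 ip g; have c0 := normc_ge0 (ip g (chiL ord0)).
rewrite -(ler_pXn2r (n := 2)) ?nnegrE ?mulr_ge0 ?addr_ge0 ?sqrtr_ge0//.
rewrite [leLHS]sqr_sqrtr ?addr_ge0 ?sqr_ge0//.
have h2 : s^-1 * normc (ip g (chiL ord0)) <= s^-1 * N g by rewrite ler_wpM2l.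
have h3 : 0 <= s^-1 * normc (ip g (chiL ord0)) by rewrite mulr_ge0.
by rewrite mulrDl mul1r; nra.
Qed.

Lemma domB_sub (f g : L2space R) : domB B xi f -> domB B xi g ->
  domB B xi (f - g : L2space R).
Proof.
move=> [f1 f2 f3] [g1 g2 g3]; split; first exact: L2funP.
  have := L2_scale_add (-1) g2 f2; congr L2; apply/funext => v.
  by rewrite L2funB; ring.
have := L2_scale_add (-1) g3 f3; congr L2; apply/funext => v.
by rewrite L2funB; ring.
Qed.

Lemma Sf_sub (f g : L2space R) (fd : domB B xi f) (gd : domB B xi g) (hd : domB B xi (f - g : L2space R)) :
  N (Sf hd - (Sf fd - Sf gd)) = 0.
Proof.
have e1 : nuf hd = nuf fd - nuf gd.
  by apply: L2space_eq => v; rewrite L2funB !nufE L2funB mulrBr.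
have e2 : xif hd = xif fd - xif gd.
  by apply: L2space_eq => v; rewrite L2funB !xifE L2funB mulrBr.
rewrite -(sub_linearB f g KL_linear) -(ipnorm_opp ipP); congr N.
rewrite /Sf /shifted_op /Lf /Vf e1 e2 (ipBl ipP).
move: (nuf fd) (nuf gd) (xif fd) (xif gd) (KL _) (KL _) (KL _) => a b c d k k' k''.
set W := \sum_j _; linear_identity R[i] (L2space R).
Qed.

(** * Invertibility of lambda - B at one frequency *)

Section Resolvent.
Hypothesis lam_gt : 0 < complex.Re lam + nu0.
Let d := complex.Re lam + nu0.

Definition symbol v : R[i] := lam + (nu B v)%:C + 'i * (dot v xi)%:C.

Lemma Re_symbol v : complex.Re (symbol v) = complex.Re lam + nu B v.
Proof. by rewrite /symbol; case: lam => a b /=; ring. Qed.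

Lemma Im_symbol v : complex.Im (symbol v) = complex.Im lam + dot v xi.
Proof. by rewrite /symbol; case: lam => a b /=; ring. Qed.

Lemma symbol_ge v : d <= normc (symbol v).
Proof. by rewrite (le_trans _ (Re_le_normc _))// Re_symbol lerD2l nu_ge. Qed.

Lemma symbol_neq0 v : symbol v != 0.
Proof.
apply: contraTneq lam_gt => h; rewrite -leNgt; have := symbol_ge v.
by rewrite h normc0.
Qed.

Lemma cmeasurable_symbol : cmeasurable (symbol : T -> R[i]).
Proof.
apply: cmeasurableD.
  by apply: cmeasurableD cmeasurable_nu; exact: cmeasurable_cst.
apply: cmeasurableM; first exact: cmeasurable_cst.
by apply: cmeasurable_real; exact: measurable_dot.
Qed.

Lemma mul_symbolV_L2 (m : T -> R[i]) c (h : L2space R) : 0 <= c -> cmeasurable m ->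
  (forall v, normc (m v) <= c * normc (symbol v)) -> L2 (fun v => m v * ((symbol v)^-1 * h v)).
Proof.
move=> c0 mm mc; apply: (L2_dominated c0 (L2funP h)).
  apply: cmeasurableM mm _; apply: cmeasurableM; last exact: L2_cmeasurable (L2funP h).
  exact: cmeasurableV cmeasurable_symbol.
move=> v; rewrite !normcM mulrA ler_wpM2r ?normc_ge0// normcV ler_pdivrMr//.
exact: lt_le_trans (symbol_ge v).
Qed.

Let symbolV_L2 (h : L2space R) : L2 (fun v => (symbol v)^-1 * h v).
Proof.
have := @mul_symbolV_L2 (fun=> 1) d^-1 h; rewrite invr_ge0 => /(_ (ltW lam_gt) (cmeasurable_cst 1)).
have -> : (fun v => 1 * ((symbol v)^-1 * h v)) = (fun v => (symbol v)^-1 * h v).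
  by apply/funext => v; rewrite mul1r.
by apply=> v; rewrite normc1 ler_pdivlMl// mulr1 symbol_ge.
Qed.

Definition symbolV (h : L2space R) : L2space R := toL2 (symbolV_L2 h).

Lemma symbolVE h v : symbolV h v = (symbol v)^-1 * h v. Proof. by []. Qed.

Lemma symbolVK h v : symbol v * symbolV h v = h v.
Proof. by rewrite mulrA divff ?mul1r// symbol_neq0. Qed.

Lemma N_symbolV h : N (symbolV h) <= d^-1 * N h.
Proof.
have di : 0 <= d^-1 by rewrite invr_ge0 ltW.
apply: ip2norm_dominated => // v; rewrite normcM ler_wpM2r ?normc_ge0//.
rewrite normcV lef_pV2 ?symbol_ge// posrE//; exact: lt_le_trans (symbol_ge v).
Qed.

Let symbol_dominates (x y : R) v : `|x| <= normc (symbol v) + `|y| ->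
  normc (x%:C : R[i]) <= (1 + `|y| / d) * normc (symbol v).
Proof.
move=> xy; rewrite normc_real (le_trans xy)// mulrDl mul1r lerD2l -mulrA ler_peMr//.
by rewrite ler_pdivlMl// mulr1 symbol_ge.
Qed.

(** Up to constants [nu] and v . xi are the real and imaginary parts of [symbol], so its modulus
    dominates both; division by it therefore lands in the domain. *)
Lemma symbolV_dom h : domB B xi (symbolV h).
Proof.
have yd (y : R) : 0 <= 1 + `|y| / d by rewrite addr_ge0// divr_ge0// ltW.
split; first exact: L2funP.
  apply: (mul_symbolV_L2 h (yd (complex.Re lam)) cmeasurable_nu) => v.
  apply: symbol_dominates; have -> : nu B v = complex.Re (symbol v) - complex.Re lam.
    by rewrite Re_symbol; ring.
  rewrite (le_trans (ler_normB _ _))// lerD2r.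
  rewrite ger0_norm ?Re_le_normc// Re_symbol.
  by apply: le_trans (ltW lam_gt) _; rewrite lerD2l nu_ge.
have md : cmeasurable (fun v : T => (dot v xi)%:C) by apply: cmeasurable_real; exact: measurable_dot.
apply: (mul_symbolV_L2 h (yd (complex.Im lam)) md) => v.
apply: symbol_dominates; have -> : dot v xi = complex.Im (symbol v) - complex.Im lam.
  by rewrite Im_symbol; ring.
by rewrite (le_trans (ler_normB _ _))// lerD2r Im_le_normc.
Qed.

Let W0 : L2space R := \sum_j (direction j)%:C *: chiL j.
Let k h : R[i] := s^-1%:C * ip (symbolV h) (chiL ord0).
Let G h := KL (symbolV h) - ('i * k h) *: W0.

(** The multiplication part of lambda - B undoes the division by [symbol]. What remains is K and the
    field, and the latter has rank one. *)
Lemma Sf_symbolV h : Sf (symbolV_dom h) = h - G h.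
Proof.
rewrite /Sf /shifted_op /G -/(k h) -/W0.
have -> : Lf (symbolV_dom h) = KL (symbolV h) - nuf (symbolV_dom h) by [].
have e : h = lam *: symbolV h + nuf (symbolV_dom h) + ('i * s%:C) *: Vf (symbolV_dom h).
  apply: L2space_eq => v; rewrite -[LHS](symbolVK h v) /symbol.
  have := nufE (symbolV_dom h) v; have := VfE (symbolV_dom h) v; rewrite dot_dir3.
  move: (nuf _) (Vf _) => nf vf vfE nfE.
  rewrite !L2funD !L2funZ vfE nfE (rmorphM _ (dot v xi)) /=.
  have si : s%:C * s^-1%:C = 1 :> R[i] by rewrite -rmorphM /= divff// gt_eqF.
  have -> : 'i * s%:C * ((dot v xi)%:C * s^-1%:C * symbolV h v) =
    'i * (dot v xi)%:C * (s%:C * s^-1%:C) * symbolV h v by ring.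
  by rewrite si -!symbolVE; ring.
move: e; move: (symbolV h) (k h) (KL _) (Vf _) (nuf _) => sh kh kf vf nf ->.
linear_identity R[i] (L2space R).
Qed.

Let symbolV_linear c h h' : symbolV (c *: h + h') = c *: symbolV h + symbolV h'.
Proof. by apply: L2space_eq => v; rewrite L2funD L2funZ !symbolVE L2funD L2funZ; ring. Qed.

Let k_linear c h h' : k (c *: h + h') = c * k h + k h'.
Proof. by rewrite /k symbolV_linear (ipDl ipP) (ipZl ipP); ring. Qed.

Let normc_k h : normc (k h) <= s^-1 * N (symbolV h).
Proof.
rewrite normcM normc_real ger0_norm ?invr_ge0 ?(ltW s_gt0)// ler_pM2l ?invr_gt0//.
by rewrite (le_trans (cauchy_schwarz ipP _ _))// (ipnorm_chi chi_orthonormal) mulr1.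
Qed.

Let G_linear : sub_linear N G.
Proof.
move=> c h h'; rewrite -(KL_linear c (symbolV h) (symbolV h')) -symbolV_linear; congr N.
rewrite /G k_linear symbolV_linear; move: W0 (KL _) (KL _) (KL _) => W a b e.
linear_identity R[i] (L2space R).
Qed.

Let G_bounded : exists2 M, 0 <= M & forall h, N (G h) <= M * N (symbolV h).
Proof.
have [CK CK0 hK] := KL_bounded; exists (CK + s^-1 * N W0).
  by rewrite addr_ge0// mulr_ge0 ?invr_ge0 ?ipnorm_ge0// ltW.
move=> h; rewrite (le_trans (seminormB ND NZ _ _))// mulrDl lerD//.
rewrite NZ normcM normc_i mul1r mulrAC ler_wpM2r ?ipnorm_ge0//; exact: normc_k.
Qed.

(** After a subsequence for K, the complex coefficients of the rank-one part are bounded, and two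
    further extractions make their real and imaginary parts converge. *)
Let G_compact : sub_compact N G.
Proof.
move=> x [A xA]; have di : 0 < d^-1 by rewrite invr_gt0.
have yA n : N (symbolV (x n)) <= d^-1 * A.
  by rewrite (le_trans (N_symbolV _))// ler_wpM2l// ltW.
have kA n : normc (k (x n)) <= s^-1 * (d^-1 * A).
  by rewrite (le_trans (normc_k _))// ler_wpM2l ?invr_ge0// ltW.
have [|s1 [z [s1_incr z_cvg]]] := KL_compact (u := fun n => symbolV (x n)).
  by exists (d^-1 * A).
pose ku n := k (x (s1 n)).
have bnd (h : R[i] -> R) : (forall c, `|h c| <= normc c) -> bounded_fun (fun n => h (ku n)).
  move=> hc; exists (s^-1 * (d^-1 * A)); split; first exact: num_real.
  by move=> y Ay n _ /=; rewrite (le_trans (hc _))// (le_trans (kA _))// ltW.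
have [|s2 s2_incr /cvg_ex[/= a a_cvg]] := bolzano_weierstrass (bnd (@complex.Re R) _).
  by move=> c; rewrite -(ler_pXn2r (n := 2)) ?nnegrE ?normc_ge0// sqr_normc_ReIm
    real_normK ?num_real// lerDl sqr_ge0.
have bnd2 : bounded_fun (fun n => complex.Im (ku (s2 n))).
  have [M [Mr hM]] := bnd (@complex.Im R) (@Im_le_normc R).
  by exists M; split=> // y My n _; exact: (hM y My (s2 n) I).
have [s3 s3_incr /cvg_ex[/= b b_cvg]] := bolzano_weierstrass bnd2.
have incr (t : nat -> nat) : increasing_seq t -> {homo t : m n / (m < n)%N}.
  by move=> /leW_mono h m n mn; have := h m n; rewrite !ltEnat /= => ->.
have t_ge (t : nat -> nat) : {homo t : m n / (m < n)%N} -> forall n, (n <= t n)%N.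
  by move=> ht; elim=> // n IH; rewrite (leq_ltn_trans IH)// ht.
exists (s1 \o s2 \o s3), (z - ('i * (a +i* b)) *: W0); split.
  by move=> m n mn /=; apply: s1_incr; apply: (incr _ s2_incr); exact: (incr _ s3_incr).
move=> e e0; pose w := N W0 + 1; have w0 : 0 < w by rewrite ltr_wpDl ?ipnorm_ge0.
have e3 : 0 < e / 3 by rewrite divr_gt0.
have [n1 h1] := z_cvg _ e3.
have ew : 0 < e / 3 / w by rewrite divr_gt0.
move/cvgrPdist_le : a_cvg => /(_ _ ew)[n2 _ h2].
move/cvgrPdist_le : b_cvg => /(_ _ ew)[n3 _ h3].
exists (maxn n1 (maxn n2 n3)) => n; rewrite !geq_max => /and3P[n1n n2n n3n].
have m1 : (n1 <= s2 (s3 n))%N.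
  by rewrite (leq_trans n1n)// (leq_trans (t_ge _ (incr _ s3_incr) n))// t_ge//; exact: incr.
have m2 : (n2 <= s3 n)%N by rewrite (leq_trans n2n)// t_ge//; exact: incr.
rewrite /G /=; set kn := k _.
have -> : KL (symbolV (x (s1 (s2 (s3 n))))) - 'i * kn *: W0 - (z - 'i * (a +i* b) *: W0) =
    (KL (symbolV (x (s1 (s2 (s3 n))))) - z) + ('i * (a +i* b - kn)) *: W0.
  by move: W0 (KL _) => W kl; linear_identity R[i] (L2space R).
rewrite (le_trans (ND _ _))// NZ normcM normc_i mul1r.
have k1 := h1 _ m1.
have k2 : `|a - complex.Re kn| <= e / 3 / w := h2 _ m2.
have k3 : `|b - complex.Im kn| <= e / 3 / w := h3 _ n3n.
have : normc (a +i* b - kn) <= e / 3 / w + e / 3 / w.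
  by rewrite (le_trans (le_normc_ReIm _))// lerD.
have N0 := ipnorm_ge0 ip W0.
move=> /(ler_wpM2r N0) h.
have : (e / 3 / w + e / 3 / w) * N W0 <= e / 3 + e / 3.
  rewrite -mulrDl -mulrA ler_piMr//; first by rewrite addr_ge0// ltW.
  by rewrite ler_pdivrMl// mulr1 /w lerDl.
by move=> h'; have := le_trans h h'; lra.
Qed.

Lemma resolvent_criterion C : 0 <= C ->
  (forall f (fd : domB B xi f), X f <= C * X (Sf fd)) -> rhoB B xi lam.
Proof.
move=> C0 lower; split.
- move=> f g fD gD fg.
  have [f1 _ _] := fD; have [g1 _ _] := gD.
  have fd : domB B xi (toL2 f1) by []; have gd : domB B xi (toL2 g1) by [].
  have hd := domB_sub fd gd.
  have N0 : N (Sf fd - Sf gd) = 0.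
    by apply/ip2norm_ae; rewrite -(SfE fd) -(SfE gd).
  have N1 : N (Sf hd) = 0.
    have := seminorm_mod0 ND NZ (Sf_sub fd gd hd); by rewrite N0.
  apply/(ip2norm_ae (toL2 f1) (toL2 g1)); apply/eqP; rewrite eq_le ipnorm_ge0 andbT.
  rewrite (le_trans (le_xi_norm _))// (le_trans (lower _ hd))//.
  by rewrite (le_trans (ler_wpM2l C0 (xi_norm_le _)))// N1 !mulr0.
- move=> g gL; have [M M0 GM] := G_bounded.
  (* The lower bound passes from [symbolV h] to [h] itself: [h] is [h - G h] plus [G h], and [G h]
     is controlled by [symbolV h]. The factor [1 + s^-1] compares the weighted norm with the plain
     one. *)
  pose c := (1 + M * (C * (1 + s^-1)))^-1.
  have si : 0 <= 1 + s^-1 by rewrite addr_ge0// invr_ge0 ltW.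
  have c0 : 0 < 1 + M * (C * (1 + s^-1)) by rewrite ltr_wpDr ?mulr_ge0.
  have [h /ip2norm_ae hg] : exists h, N (h - G h - toL2 gL) = 0.
    apply: (fredholm_alternative ND NZ (M := M * d^-1) (c := c)) => //.
    + by move=> h; rewrite (le_trans (GM h))// -mulrA ler_wpM2l// N_symbolV.
    + by rewrite invr_gt0.
    move=> h; rewrite ler_pdivrMl//.
    have hW : N (symbolV h) <= C * (1 + s^-1) * N (h - G h).
      rewrite -Sf_symbolV (le_trans (le_xi_norm _))// (le_trans (lower _ (symbolV_dom h)))//.
      by rewrite -mulrA ler_wpM2l// xi_norm_le.
    have hN : N h <= N (h - G h) + N (G h) by rewrite -{1}(subrK (G h) h) ND.
    rewrite (le_trans hN)// mulrDl mul1r lerD2l (le_trans (GM h))//.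
    by rewrite -mulrA ler_wpM2l.
  exists (symbolV h); first exact: symbolV_dom.
  apply: (aeS hg) => v /(_ I) hv _.
  have e : lam * symbolV h v - Bhat B xi (symbolV h) v = (h - G h : L2space R) v.
    by rewrite -Sf_symbolV -(SfE (symbolV_dom h)).
  exact: etrans e hv.
exists C => f fD; have [f1 _ _] := fD; have fd : domB B xi (toL2 f1) by [].
by have := lower _ fd; rewrite -!norm_xiE -(SfE fd).
Qed.

End Resolvent.

End FixedFrequency.

(** * Regions of the resolvent set, uniformly in the frequency *)

Section SpectralGap.
Variable delta : R.
Hypothesis delta_gt0 : 0 < delta.

(** The largest coefficient that [absorb_macroscopic] tolerates: 48 mu kappa0^2 = delta. *)
Let kappa0 : R := Num.sqrt (delta / (48 * mu)).

Let kappa0_gt0 : 0 < kappa0.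
Proof. by rewrite sqrtr_gt0 divr_gt0// mulr_gt0. Qed.

Lemma rhoB_right_half_plane xi lam : xi != 0 -> 0 < complex.Re lam -> rhoB B xi lam.
Proof.
move=> xi0 re0; have s0 := enorm_gt0 xi0.
have ri : 0 <= (complex.Re lam)^-1 by rewrite invr_ge0 ltW.
have lam_gt : 0 < complex.Re lam + nu0 by rewrite addr_gt0// nu0_gt0.
apply: (resolvent_criterion xi0 lam_gt ri).
move=> f fd.
have := energy_estimate ipP chi_orthonormal lam s0 (erefl _) (Lf_chi fd) (Lf_coercive fd)
  (Vf_chi xi0 fd) (Vf_chi0 xi0 f) (Vf_real fd).
rewrite -/(Sf lam fd); set X := xi_norm _ _ _ _; set Y := xi_norm _ _ _ _ => h.
have Y0 : 0 <= Y by exact: xi_norm_ge0.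
have X0 : 0 <= X by exact: xi_norm_ge0.
have h2 : complex.Re lam * X ^+ 2 <= Y * X.
  by apply: le_trans h; rewrite lerDl mulr_ge0 ?sqr_ge0// ltW.
have [->|Xn] := eqVneq X 0; first by rewrite mulr_ge0.
have Xp : 0 < X by rewrite lt_neqAle eq_sym Xn.
by rewrite ler_pdivlMl// -(ler_pM2r Xp); move: h2; rewrite expr2 mulrA.
Qed.

Lemma rhoB_of_macroscopic_bound xi lam k C : xi != 0 -> delta <= complex.Re lam + mu ->
  0 <= k -> k <= kappa0 -> 0 <= C ->
  (forall f (fd : domB B xi f),
    let b := k * xi_norm ip chiL (enorm xi) f + C * xi_norm ip chiL (enorm xi) (Sf lam fd) in
    (forall j, normc (ip f (chiL j)) <= b) /\
    normc ((enorm xi)^-1%:C * ip f (chiL ord0)) <= b) ->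
  rhoB B xi lam.
Proof.
move=> xi0 dlam k0 kk C0 hb; have s0 := enorm_gt0 xi0.
have lam_gt : 0 < complex.Re lam + nu0.
  rewrite (lt_le_trans delta_gt0)// (le_trans dlam)// lerD2l.
  by have /andP[] := mu_le_nu0.
apply: (resolvent_criterion xi0 lam_gt
  (sqrtr_ge0 (2 / delta * (12 * mu * C ^+ 2 + delta^-1)))).
move=> f fd; have [b1 b2] := hb f fd.
have [Y2 hY hY2] := macroscopic_control ipP chi_orthonormal s0 (erefl _) (Lf_chi fd)
  (Lf_coercive fd) (Vf_chi xi0 fd) (Vf_chi0 xi0 f) (Vf_real fd) dlam b1 b2.
apply: (absorb_macroscopic delta_gt0 (ltW mu_gt0) _ _ C0 k0 _ hY hY2).
- exact: xi_norm_ge0.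
- exact: xi_norm_ge0.
have : k ^+ 2 <= kappa0 ^+ 2 by rewrite lerXn2r ?nnegrE// ltW.
rewrite sqr_sqrtr ?divr_ge0 ?mulr_ge0 ?(ltW delta_gt0) ?(ltW mu_gt0)//.
by rewrite ler_pdivlMr ?mulr_gt0// mulrC.
Qed.

Let C0_ge0 : 0 <= C0. Proof. by rewrite /C0 !mulr_ge0. Qed.

Lemma rhoB_large_eigenvalue r : 0 <= r -> exists2 La, 0 < La &
  forall xi lam, xi != 0 -> enorm xi <= r -> La <= normc lam ->
    delta <= complex.Re lam + mu -> rhoB B xi lam.
Proof.
(* With this threshold the coefficient of [X f] in [large_eigenvalue_bound] equals [kappa0]. *)
move=> r0; pose La := (r * C0 + 2) / kappa0.
have n0 : 0 < r * C0 + 2 by rewrite ltr_wpDl ?mulr_ge0.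
have La0 : 0 < La by rewrite divr_gt0.
exists La => // xi lam xi0 xir Lal dlam; have s0 := enorm_gt0 xi0.
apply: (@rhoB_of_macroscopic_bound _ _ ((r * C0 + 2) / La) La^-1) => //.
- by rewrite divr_ge0// ltW.
- by rewrite ler_pdivrMr// [leRHS]mulrCA divff ?mulr1// gt_eqF.
- by rewrite invr_ge0 ltW.
move=> f fd.
exact: (large_eigenvalue_bound ipP chi_orthonormal s0 (erefl _) (direction_unit xi0)
  (N_uL xi0) (Lf_chi fd) (Vf_chi xi0 fd) (Vf_chi0 xi0 f) xir La0 Lal).
Qed.

Lemma rhoB_small_frequency La d : 0 <= La -> 0 < d -> d <= 1 -> exists2 r, 0 < r &
  forall xi lam, xi != 0 -> enorm xi <= r -> normc lam <= La -> d <= normc lam ->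
    d <= normc (lam - 'i) -> d <= normc (lam + 'i) ->
    delta <= complex.Re lam + mu -> rhoB B xi lam.
Proof.
move=> La0 d0 d1; pose c := 6 * C0 / d ^+ 3.
have d3 : 0 < d ^+ 3 by rewrite exprn_gt0.
have c0 : 0 <= c by rewrite divr_ge0 ?mulr_ge0// ltW.
have c1 : 0 < c + 1 by rewrite ltr_wpDl.
(* Below this radius [c * enorm xi] is at most [kappa0]; the added 1 keeps the denominator
   positive. *)
exists (kappa0 / (c + 1)); first by rewrite divr_gt0.
move=> xi lam xi0 xir lamLa dl dm dp dlam; have s0 := enorm_gt0 xi0.
apply: (@rhoB_of_macroscopic_bound _ _ (c * enorm xi) ((La + 2) / d ^+ 3)) => //.
- by rewrite mulr_ge0// ltW.
- rewrite (le_trans (ler_wpM2l c0 xir))// mulrCA ler_piMr ?(ltW kappa0_gt0)//.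
  by rewrite ler_pdivrMr// mul1r lerDl.
- by rewrite divr_ge0 ?addr_ge0// ltW.
move=> f fd.
exact: (small_frequency_bound ipP chi_orthonormal s0 (erefl _) (direction_unit xi0)
  (N_uL xi0) (Lf_chi fd) (Vf_chi xi0 fd) (Vf_chi0 xi0 f) d0 d1 lamLa dl dm dp).
Qed.

Section TestFunctions.
Variables (xi : R3 R) (xi0 : xi != 0) (t e : R).
Hypotheses (e0 : 0 < e) (e1 : e <= 1).

Let u v : R := dot v (dir3 xi) + t.
(** The power 4 makes the regularisation negligible beside the slab of width [e]: outside it the
    ratio of [e ^+ 4] to [D] is at most [e ^+ 2], while [m] remains bounded by [e ^- 2]
    everywhere. *)
Let D v : R := u v ^+ 2 + e ^+ 4.
Let D_gt0 v : 0 < D v. Proof. by rewrite ltr_wpDl ?sqr_ge0// exprn_gt0. Qed.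
Let m v : R := u v / D v.

Let measurable_m : measurable_fun setT (fun v : T => m v).
Proof.
have mu_ : measurable_fun setT (fun v : T => u v).
  by apply: measurable_funD => //; exact: measurable_dot_dir3.
apply: measurable_funM => //; under eq_fun do rewrite -powR_inv1 ?(ltW (D_gt0 _))//.
apply: (@measurableT_comp _ _ _ _ _ _ (fun x : R => x `^ (-1))).
  exact: measurable_powR.
by apply: measurable_funD => //; exact: measurable_funX.
Qed.

Let m_le v : `|m v| <= e ^- 2.
Proof.
have e2 : 0 < e ^+ 2 by rewrite exprn_gt0.
rewrite normrM normfV (gtr0_norm (D_gt0 v)) ler_pdivrMr// ler_pdivlMl//.
rewrite /D -[u v ^+ 2](real_normK (num_real (u v))).
have -> : e ^+ 4 = (e ^+ 2) ^+ 2 by rewrite -exprM.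
by have := sqr_ge0 (`|u v| - e ^+ 2); have := sqr_ge0 (`|u v|); nra.
Qed.

Let le_growth (c : R) v : 0 <= c -> c <= c * (1 + dot v v).
Proof. by move=> c0; rewrite ler_peMr// lerDl dot_ge0. Qed.

Let e2_ge0 : 0 <= e ^- 2. Proof. by rewrite invr_ge0 exprn_ge0// ltW. Qed.

Let m_growth v : normc ((m v)%:C : R[i]) <= e ^- 2 * (1 + dot v v).
Proof. by rewrite normc_real (le_trans (m_le v))// le_growth. Qed.

Let psi_L2 j : L2 (fun v => (m v)%:C * chi j v).
Proof. by apply: (mul_chi_L2 _ e2_ge0 _ m_growth); exact: cmeasurable_real. Qed.

Definition psiL j : L2space R := toL2 (psi_L2 j).

Let num_growth v : normc (((nu B v)%:C * (m v)%:C) : R[i]) <= e ^- 2 * (nu1 * 2) * (1 + dot v v).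
Proof.
rewrite normcM !normc_real ger0_norm ?nu_ge0// mulrC -mulrA ler_pM ?nu_ge0//.
by rewrite -mulrA nu_le.
Qed.

Let c2_ge0 : 0 <= e ^- 2 * (nu1 * 2). Proof. by rewrite !mulr_ge0// nu1_ge0. Qed.

Let nupsi_L2 j : L2 (fun v => ((nu B v)%:C * (m v)%:C) * chi j v).
Proof.
apply: (mul_chi_L2 _ c2_ge0 _ num_growth).
by apply: cmeasurableM; [exact: cmeasurable_nu|exact: cmeasurable_real].
Qed.

Definition nupsiL j : L2space R := toL2 (nupsi_L2 j).

Definition LpsiL j : L2space R := KL (psiL j) - nupsiL j.

Let phi_growth v : normc ((u v * m v)%:C : R[i]) <= 1 * (1 + dot v v).
Proof.
have -> : u v * m v = u v ^+ 2 / D v by rewrite /m mulrA -expr2.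
rewrite normc_real ger0_norm ?divr_ge0 ?sqr_ge0 ?(ltW (D_gt0 v))//.
apply: le_trans (le_growth _ ler01).
by rewrite ler_pdivrMr// mul1r lerDl exprn_ge0// ltW.
Qed.

Let phi_L2 j : L2 (fun v => (u v * m v)%:C * chi j v).
Proof.
apply: (mul_chi_L2 _ ler01 _ phi_growth); apply: cmeasurable_real.
apply: measurable_funM => //.
by apply: measurable_funD => //; exact: measurable_dot_dir3.
Qed.

Definition phiL j : L2space R := toL2 (phi_L2 j).

Lemma N_psiL j : N (psiL j) <= 2 * e ^- 2 * Num.sqrt (gauss_const R).
Proof.
by apply: (@N_mul_chi (fun v => (m v)%:C) (e ^- 2) j (psiL j) e2_ge0 m_growth).
Qed.

Lemma N_nupsiL j : N (nupsiL j) <= 2 * (e ^- 2 * (nu1 * 2)) * Num.sqrt (gauss_const R).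
Proof.
by apply: (@N_mul_chi (fun v => (nu B v)%:C * (m v)%:C) (e ^- 2 * (nu1 * 2)) j (nupsiL j)
  c2_ge0 num_growth).
Qed.

(** The difference is [chi j] times e^4 / D, which is at most 1 on the slab and at most e elsewhere.
    The slab has Gaussian mass of order e, so the norm is of order sqrt e, whatever [t]. *)
Lemma N_chi_phi j : N (chiL j - phiL j) <=
  Num.sqrt (4 * gauss_const R * (normal_peak (Num.sqrt 2) * 4 + 1) * e).
Proof.
have gc := gauss_const_ge0 R.
have fe v : (chiL j - phiL j) v = (e ^+ 4 / D v)%:C * chi j v.
  rewrite L2funB -[chiL j v]/(chi j v) -[phiL j v]/((u v * m v)%:C * chi j v).
  have -> : e ^+ 4 / D v = 1 - u v * m v.
    by rewrite /m; have := D_gt0 v; rewrite /D => h; field; exact: lt0r_neq0.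
  by rewrite rmorphB rmorph1 mulrBl mul1r.
rewrite -[leLHS]ger0_norm ?ipnorm_ge0// -sqrtr_sqr ler_wsqrtr//.
have pk := ltW (@P_gt0 R).
apply: (@le_trans _ _ (4 * gauss_const R * (normal_peak (Num.sqrt 2) * (4 * e) + e))); last first.
  by rewrite le_eqVlt; apply/orP; left; apply/eqP; ring.
apply: (ip2norm_slab (t := t) (dir3_unit xi0) (ltW e0)); first by rewrite mulr_ge0.
move=> v; rewrite fe normcM exprMn mulrC.
have chib : normc (chi j v) ^+ 2 <= 4 * gauss_const R * gweight3 v.
  have -> : 4 = 2 ^+ 2 :> R by ring.
  apply: (@gweight_bound R (fun v => chi j v) 2) => // v'.
  apply: le_trans (normc_chi j v') _; rewrite ler_wpM2r ?(ltW (sqrtM_gt0 _))//.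
  by rewrite ler_wpM2l//; move: (dot_ge0 v'); move: (dot v' v') => q; nra.
apply: ler_pM => //; first exact: sqr_ge0; first exact: sqr_ge0.
rewrite normc_real ger0_norm; last by rewrite divr_ge0 ?exprn_ge0// ltW.
have e4 : 0 < e ^+ 4 by rewrite exprn_gt0.
have u2 := sqr_ge0 (u v).
have q0 : 0 <= e ^+ 4 / D v by rewrite divr_ge0// ltW.
have q1 : e ^+ 4 / D v <= 1 by rewrite ler_pdivrMr// mul1r lerDr.
rewrite /in_slab -/(u v); have [_|eu] := leP `|u v| e.
  rewrite /= (@le_trans _ _ 1)//; first by rewrite expr2; nra.
  by rewrite lerDl ltW.
rewrite add0r.
have ue : e ^+ 2 <= u v ^+ 2.
  by rewrite -(real_normK (num_real (u v))) lerXn2r ?nnegrE// ltW.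
have qe : e ^+ 4 / D v <= e ^+ 2.
  rewrite ler_pdivrMr// /D; have : 0 <= e ^+ 2 * e ^+ 4 by rewrite mulr_ge0 ?exprn_ge0// ltW.
  have : e ^+ 4 <= e ^+ 2 * u v ^+ 2.
    by rewrite (_ : e ^+ 4 = e ^+ 2 * e ^+ 2) ?ler_wpM2l ?sqr_ge0//; ring.
  by rewrite mulrDr; lra.
have e2 : e ^+ 2 <= e by rewrite expr2 ler_piMr// ltW.
have qe' := le_trans qe e2.
by rewrite expr2 (le_trans (ler_pM q0 q0 q1 qe'))// mul1r.
Qed.

Lemma ip_LpsiL f (fd : domB B xi f) j : ip (Lf fd) (psiL j) = ip f (LpsiL j).
Proof.
rewrite /Lf /LpsiL (ipBl ipP) (ipBr ipP) KL_self_adjoint; congr (_ - _).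
apply: (ip_real_multiplier (nufE fd)) => v.
by rewrite -[nupsiL j v]/((nu B v)%:C * (m v)%:C * chi j v) -mulrA.
Qed.

Lemma ip_phiL f (fd : domB B xi f) j :
  ip (Vf fd) (psiL j) + t%:C * ip f (psiL j) = ip f (phiL j).
Proof.
rewrite -(ipZl ipP) -(ipDl ipP); apply: (@ip_real_multiplier u) => v.
  have := VfE fd v; move: (Vf fd) => vf vfE.
  by rewrite L2funD L2funZ vfE -mulrDl -rmorphD.
by rewrite -[phiL j v]/((u v * m v)%:C * chi j v) rmorphM -mulrA.
Qed.

End TestFunctions.

Lemma rhoB_large_frequency : exists2 r, 0 < r &
  forall xi lam, xi != 0 -> r <= enorm xi -> complex.Re lam <= 0 ->
    delta <= complex.Re lam + mu -> rhoB B xi lam.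
Proof.
have [CK CK0 hK] := KL_bounded.
pose E := 4 * gauss_const R * (normal_peak (Num.sqrt 2) * 4 + 1).
have E0 : 0 <= E.
  have pk := ltW (@P_gt0 R); have gc := gauss_const_ge0 R.
  apply: mulr_ge0; first exact: mulr_ge0.
  by apply: addr_ge0 => //; exact: mulr_ge0.
have E1 : 0 < E + 1 by rewrite ltr_wpDl.
(* Half of [kappa0] is reserved for the slab error sqrt (E e), which fixes [e] once and for all. *)
pose e := Num.min 1 ((kappa0 / 2) ^+ 2 / (E + 1)).
have k2 : 0 < kappa0 / 2 by rewrite divr_gt0.
have e0 : 0 < e by rewrite lt_min ltr01 divr_gt0// exprn_gt0.
have e1 : e <= 1 by rewrite ge_min lexx.
have eta_le : Num.sqrt (E * e) <= kappa0 / 2.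
  rewrite -[leRHS]ger0_norm ?(ltW k2)// -sqrtr_sqr ler_wsqrtr//.
  have : e <= (kappa0 / 2) ^+ 2 / (E + 1) by rewrite ge_min lexx orbT.
  rewrite ler_pdivlMr// => h; apply: le_trans h.
  by rewrite mulrC ler_wpM2l ?(ltW e0)// lerDl.
pose a := 2 * e ^- 2 * Num.sqrt (gauss_const R).
have a0 : 0 <= a by rewrite !mulr_ge0 ?sqrtr_ge0 ?invr_ge0 ?exprn_ge0// ltW.
pose c := 2 * (e ^- 2 * (nu1 * 2)) * Num.sqrt (gauss_const R).
have c0 : 0 <= c.
  by rewrite !mulr_ge0 ?sqrtr_ge0 ?nu1_ge0 ?invr_ge0 ?exprn_ge0// ltW.
pose A := a + CK * a + c.
have A0 : 0 <= A by rewrite !addr_ge0// mulr_ge0.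
have aA : a <= A by rewrite /A -addrA lerDl addr_ge0// mulr_ge0.
have caA : CK * a + c <= A by rewrite /A -addrA lerDr.
pose M := (mu + 2) * A + 1.
have M0 : 0 < M by rewrite ltr_wpDl// mulr_ge0// addr_ge0// ltW.
(* The test functions are of size e^-2, but their contribution [M / enorm xi] falls below the other
   half of [kappa0] at large frequency. *)
exists (Num.max 1 (M / (kappa0 / 2))); first by rewrite lt_max ltr01.
move=> xi lam xi0; rewrite ge_max => /andP[s1 sM] re0 dlam; have s0 := enorm_gt0 xi0.
apply: (@rhoB_of_macroscopic_bound _ _ (Num.sqrt (E * e) + M / enorm xi) A) => //.
- by rewrite addr_ge0 ?sqrtr_ge0// divr_ge0// ltW.
- rewrite [leRHS]splitr lerD// ler_pdivrMr// mulrC -ler_pdivrMr//.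
move=> f fd.
apply: (large_frequency_bound (psi := psiL xi (complex.Im lam / enorm xi) e0)
  (Lpsi := LpsiL xi (complex.Im lam / enorm xi) e0)
  (phi := phiL xi (complex.Im lam / enorm xi) e0) ipP chi_orthonormal s0 mu_gt0
  (direction_unit xi0) re0 _ (sqrtr_ge0 _) A0 s1).
- by rewrite (le_trans (ltW delta_gt0)).
- by move=> j; exact: ip_LpsiL.
- by move=> j; exact: ip_phiL.
- by move=> j; rewrite (le_trans (N_psiL _ _ _ _)).
- move=> j; rewrite (le_trans _ caA)// (le_trans (seminormB ND NZ _ _))// lerD//.
    by rewrite (le_trans (hK _))// ler_wpM2l// N_psiL.
  exact: N_nupsiL.
- by move=> j; exact: N_chi_phi.
Qed.

End SpectralGap.

End LinearizedOperator.

(** * Comparison of alpha with 0 and +-i, and choice of the constants *)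

Lemma alpha_near_pm_i (R : realType) (xi : R3 R) (j : int) :
  (normc (alpha xi j - 'i * (j%:~R)%:C) <= normc (j%:~R : R[i]) * enorm xi ^+ 2)%R.
Proof.
have s2 := sqr_ge0 (enorm xi).
set a := Num.sqrt (1 + 5 / 3 * enorm xi ^+ 2).
have x0 : 0 <= 1 + 5 / 3 * enorm xi ^+ 2 by rewrite addr_ge0// mulr_ge0// divr_ge0.
have a0 : 0 <= a by exact: sqrtr_ge0.
have aa : a ^+ 2 = 1 + 5 / 3 * enorm xi ^+ 2 by exact: sqr_sqrtr.
have a1 : 1 <= a by nra.
(* The square of 1 + x is at least 1 + 2 x, and 2 exceeds 5/3. *)
have a2 : a <= 1 + enorm xi ^+ 2 by nra.
have -> : alpha xi j - 'i * (j%:~R)%:C = 'i * ((j%:~R)%:C * (a - 1)%:C).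
  by rewrite /alpha -/a rmorphM rmorphB rmorph1 /=; ring.
rewrite !normcM normc_i mul1r -(rmorph_int (real_complex R)) ler_wpM2l ?normc_ge0//.
by rewrite normc_real ger0_norm; lra.
Qed.

Theorem lemma2p6 (R : realType) (gamma nu0 nu1 mu : R)
    (B : R3 R -> R3 R -> R)
    (B_kernel : collision_kernel gamma B)
    (nu_bounds : forall v : R3 R,
       nu0 * (1 + enorm v) `^ gamma <= nu B v <= nu1 * (1 + enorm v) `^ gamma)
    (K_operator : L2_operator (Kop B))
    (K_self_adjoint : self_adjoint (Kop B))
    (K_compact : compact_operator (Kop B))
    (L_null_space : null_space_spanned B)
    (mu_gt0 : 0 < mu)
    (L_coercive : coercive B mu)
    (mu_le_nu0 : mu <= nu0 <= nu B 0) :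
  forall delta1 : R, 0 < delta1 ->
  exists2 y1 : R, 0 < y1 &
  forall delta2 : R, 0 < delta2 ->
  exists2 r2 : R, 0 < r2 &
    (forall xi : R3 R, xi != 0 ->
       [set lam : R[i] | - mu + delta1 <= complex.Re lam /\
                         y1 <= `|complex.Im lam|]
         `|` [set lam : R[i] | 0 < complex.Re lam]
       `<=` rhoB B xi)
    /\
    (forall xi : R3 R, 0 < enorm xi <= r2 ->
       sigmaB B xi `&` [set lam : R[i] | - mu + delta1 <= complex.Re lam]
       `<=` \bigcup_(j in [set -1; 0; 1 : int])
              [set lam : R[i] | `|lam - alpha xi j| <= delta2%:C]).
Proof.
move=> delta1 delta1_gt0.
have right_half := rhoB_right_half_plane B_kernel nu_bounds K_operator K_self_adjoint K_compact
  L_null_space mu_gt0 L_coercive mu_le_nu0.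
have [R0 R0_gt0 large] := rhoB_large_frequency B_kernel nu_bounds K_operator K_self_adjoint
  K_compact L_null_space mu_gt0 L_coercive mu_le_nu0 delta1_gt0.
(* The radius [R0] at which the large-frequency estimate takes over is already fixed, so this
   threshold serves every remaining frequency. *)
have [y1 y1_gt0 large_lam] := rhoB_large_eigenvalue B_kernel nu_bounds K_operator K_self_adjoint
  K_compact L_null_space mu_gt0 L_coercive mu_le_nu0 delta1_gt0 (ltW R0_gt0).
exists y1 => // delta2 delta2_gt0.
have part1 xi lam : xi != 0 -> - mu + delta1 <= complex.Re lam /\ y1 <= `|complex.Im lam| ->
    rhoB B xi lam.
  move=> xi0 [re_ge im_ge]; have re_ge' : delta1 <= complex.Re lam + mu by lra.
  have [re_gt|re_le] := ltP 0 (complex.Re lam); first exact: right_half.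
  have [xi_le|xi_gt] := leP (enorm xi) R0; last exact: large (ltW xi_gt) re_le re_ge'.
  by apply: large_lam => //; rewrite (le_trans im_ge)// Im_le_normc.
(* Half of [delta2] covers the distance from alpha to 0 or +-i, which is at most |xi|^2 <= d once
   |xi| <= d <= 1; the other half is the distance kept between lambda and these three points. *)
pose d := Num.min 1 (delta2 / 2).
have d_gt0 : 0 < d by rewrite lt_min ltr01 divr_gt0.
have d_le1 : d <= 1 by rewrite ge_min lexx.
have d_le : d <= delta2 / 2 by rewrite ge_min lexx orbT.
(* The values of lambda left over by the first part have real part between [- mu] and 0 and
   imaginary part below [y1], so their modulus is at most [mu + y1]. *)
have La_ge0 : 0 <= mu + y1 by rewrite addr_ge0// ltW.
have [r r_gt0 small] := rhoB_small_frequency B_kernel nu_bounds K_operator K_self_adjoint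
  K_compact L_null_space mu_gt0 L_coercive mu_le_nu0 delta1_gt0 La_ge0 d_gt0 d_le1.
exists (Num.min r d); first by rewrite lt_min r_gt0.
split=> [xi xi0 lam [h|h]|xi /andP[s_gt0]]; [exact: part1|exact: right_half|].
rewrite le_min => /andP[s_r s_d] lam [lam_sigma /= re_ge].
have xi0 : xi != 0.
  by apply: contraTneq s_gt0 => ->; rewrite /enorm /dot /= !mulr0 !addr0 sqrtr0 ltxx.
have re_ge' : delta1 <= complex.Re lam + mu by lra.
apply: contrapT => far; apply: lam_sigma.
have [re_gt|re_le] := ltP 0 (complex.Re lam); first exact: right_half.
have [im_ge|im_lt] := leP y1 `|complex.Im lam|; first by apply: part1.
have far_alpha j : [set -1; 0; 1 : int] j -> delta2 < normc (lam - alpha xi j).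
  move=> jP; rewrite ltNge; apply/negP => near; apply: far; exists j => //=.
  by rewrite normr_normc lecR.
have s2_d : enorm xi ^+ 2 <= delta2 / 2.
  by have := ltW s_gt0; rewrite expr2; nra.
have far_i j : [set -1; 0; 1 : int] j -> normc (j%:~R : R[i]) <= 1 ->
    d <= normc (lam - 'i * (j%:~R)%:C).
  move=> /far_alpha lt_j nj; have := alpha_near_pm_i xi j.
  have := normcD (lam - 'i * (j%:~R)%:C) (- (alpha xi j - 'i * (j%:~R)%:C)).
  rewrite normc_opp opprB addrA subrK => h1 h2.
  have : normc (j%:~R : R[i]) * enorm xi ^+ 2 <= enorm xi ^+ 2 by rewrite ler_piMl ?sqr_ge0.
  by move: lt_j h1 h2 s2_d d_le; lra.
apply: small => //.
- rewrite (le_trans (le_normc_ReIm _))// lerD//; last exact: ltW.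
  by rewrite ler_norml; lra.
- have := far_i 0; rewrite mulr0z mulr0 subr0 normc0; apply => //; by left; right.
- have := far_i 1; rewrite mulr1z mulr1 normc1; apply => //; by right.
- have := far_i (-1); rewrite mulrN1z mulrN1z rmorphN mulrN mulr1 opprK normc_opp normc1.
  by apply => //; left; left.
Qed.
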